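(* Let $q$ be a prime power, $k=\mathbb{F}_q(T)$, $R_T=\mathbb{F}_q[T]$, and let $\ell$ be a prime and $n\ge1$ with $\ell^n\mid q-1$. For $X\in R_T$ write $X^*:=(-1)^{\deg X}X$. Let $D=P_1^{\alpha_1}\cdots P_r^{\alpha_r}$ where $r\ge1$, $P_1,\dots,P_r\in R_T$ are distinct monic irreducible polynomials, $1\le\alpha_j\le \ell^n-1$, $\alpha_j=b_j\ell^{a_j}$ with $\gcd(b_j,\ell)=1$, and $\deg P_j=c_j\ell^{d_j}$ with $\gcd(c_j,\ell)=1$ ($1\le j\le r$); the $P_j$ are ordered so that $0=a_1\le a_2\le\cdots\le a_r\le n-1$. Let $E:=k\big(\sqrt[\ell^n]{D^*}\big)$, $E_j:=k\big(\sqrt[\ell^{n-a_j}]{P_j^*}\big)$ for $1\le j\le r$, and $E_{\mathfrak{gex}}:=E_1\cdots E_r$. Put $$t:=n-\min\{n,\nu_\ell(\deg D)\},\qquad m:=\max\{\,n-a_j-\min\{n-a_j,d_j\}\;:\;1\le j\le r\,\}$$ (so that $e_\infty(E/k)=\ell^t$ and $e_\infty(E_{\mathfrak{gex}}/k)=\ell^m$). Let $i_0\in\{1,\dots,r\}$ be such that $n-a_{i_0}-\min\{n-a_{i_0},d_{i_0}\}=m$ and $n-a_j-d_j<m$ for all $j>i_0$. When $m>0$ one has $\gcd(\deg P_{i_0},\ell^n)=\ell^{d_{i_0}}$, so there are $a,b\in\mathbb{Z}$ with $a\deg P_{i_0}+b\ell^n=\ell^{d_{i_0}}$; moreover $d_{i_0}\le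 d_j$ for $j<i_0$, and one sets $z_j:=-ac_j\ell^{d_j-d_{i_0}}$ for $j<i_0$, and chooses integers $y_j\equiv -c_jc_{i_0}^{-1}\pmod{\ell^n}$ for $j>i_0$. Then the genus field of $E$ is $E_{\mathfrak{ge}}=F_1\cdots F_r$, where: if $m=t$, then $F_j=E_j$ for all $1\le j\le r$ (i.e. $E_{\mathfrak{ge}}=E_{\mathfrak{gex}}$); and if $m>t\ge0$, then $$F_j=\begin{cases} k\big(\sqrt[\ell^{n-a_j}]{P_jP_{i_0}^{z_j}}\big) & \text{if } j<i_0,\\ k\big(\sqrt[\ell^{d_{i_0}+t}]{P_{i_0}^*}\big) & \text{if } j=i_0,\\ k\big(\sqrt[\ell^{n-a_j}]{P_jP_{i_0}^{y_j\ell^{d_j-d_{i_0}}}}\big) & \text{if } j>i_0 \text{ and } d_j\ge d_{i_0},\\ k\big(\sqrt[\ell^{n-a_j+d_{i_0}-d_j}]{P_j^{\ell^{d_{i_0}-d_j}}P_{i_0}^{y_j}}\big) & \text{if } j>i_0 \text{ and } d_{i_0}>d_j.\end{cases}$$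
   Context: $\mathcal{P}_\infty$ is the infinite prime of $k$ and $e_\infty(\cdot/k)$ its ramification index; $\nu_\ell$ is the $\ell$-adic valuation. For a finite abelian extension $K/k$, the genus field $K_{\mathfrak{ge}}$ is the maximal extension of $K$ of the form $Kk^*$ with $k^*/k$ abelian such that $K_{\mathfrak{ge}}/K$ is unramified at all primes and every prime of $K$ lying over $\mathcal{P}_\infty$ decomposes fully in $K_{\mathfrak{ge}}/K$ (i.e. $K\subseteq K_{\mathfrak{ge}}\subseteq K_{H,S}$, the Rosen Hilbert class field of $K$ relative to the set $S$ of infinite primes of $K$). *)

(* Defs.v *)
From HB Require Import structures.
From mathcomp Require Import all_boot all_order all_algebra all_field.
Set Implicit Arguments.
Unset Strict Implicit.
Unset Printing Implicit Defensive.
Import Order.TTheory GRing.Theory Num.Theory.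
Local Open Scope ring_scope.

Definition ratfun (F : finFieldType) := {fraction {poly F}}.
Definition pfrac (F : finFieldType) (p : {poly F}) : ratfun F :=
  FracField.tofrac p.
Definition varT (F : finFieldType) : ratfun F := pfrac 'X.
Definition pdeg (F : finFieldType) (p : {poly F}) : nat := (size p).-1.
Definition pstar (F : finFieldType) (p : {poly F}) : {poly F} :=
  (-1) ^+ pdeg p * p.

Section Fields.
(* Subsets of a fixed field Om (an algebraic closure of k) are predicates. *)
Variable Om : fieldType.

Definition sset := Om -> Prop.
Definition ssub (A B : sset) := forall x, A x -> B x.
Definition seqs (A B : sset) := forall x, A x <-> B x.

Definition is_subfield (K : sset) : Prop :=
  [/\ K 0, K 1, (forall x y, K x -> K y -> K (x - y)),
      (forall x y, K x -> K y -> K (x * y)) & (forall x, K x -> K x^-1)].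

Definition gen (S : sset) : sset :=
  fun x => forall M, is_subfield M -> ssub S M -> M x.

Definition sunion (A B : sset) : sset := fun x => A x \/ B x.

(* Places of a field K in Om: nontrivial valuation rings O of K. *)
Definition is_place (K O : sset) : Prop :=
  [/\ ssub O K, O 1, (forall x y, O x -> O y -> O (x - y))
      & (forall x y, O x -> O y -> O (x * y))] /\ (exists x, K x /\ ~ O x) /\
      (forall x, K x -> x != 0 -> O x \/ O x^-1).

Definition mideal (O : sset) : sset := fun x => O x /\ (x != 0 -> ~ O x^-1).

Definition restr (K O : sset) : sset := fun x => K x /\ O x.

(* Q (a place of L) is unramified over K:  m_{Q cap K} O_Q = m_Q *)
Definition unram (K Q : sset) : Prop :=
  forall y, mideal Q y ->
    exists x u, [/\ mideal (restr K Q) x, Q u & y = x * u].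

Definition resdeg1 (K Q : sset) : Prop :=
  forall y, Q y -> exists x, [/\ K x, Q x & mideal Q (y - x)].

End Fields.

Section OverK.
Variables (F : finFieldType) (Om : fieldType) (iota : {rmorphism ratfun F -> Om}).

Definition kimg : sset Om := fun x => exists c, x = iota c.

(* k-automorphisms of Om (ring endomorphisms fixing k; Om algebraic over k) *)
Definition fixes_k (s : {rmorphism Om -> Om}) := forall c, s (iota c) = iota c.

Definition finext (K : sset Om) : Prop :=
  [/\ is_subfield K, ssub kimg K &
      exists s : seq Om, (forall y, y \in s -> K y) /\
        forall x, K x -> exists c : nat -> ratfun F,
          x = \sum_(i < size s) iota (c i) * s`_i].

Definition abelian_ext (K : sset Om) : Prop :=
  [/\ finext K,
      (forall s : {rmorphism Om -> Om}, fixes_k s -> forall x, K x -> K (s x)),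
      (forall x, K x -> exists p : {poly ratfun F},
          [/\ p != 0, separable_poly p & root (map_poly iota p) x]) &
      (forall s t : {rmorphism Om -> Om}, fixes_k s -> fixes_k t ->
         forall x, K x -> s (t x) = t (s x))].

Definition over_inf (Q : sset Om) : Prop := mideal Q (iota (varT F)^-1).

Definition unram_ext (K L : sset Om) : Prop :=
  forall Q, is_place L Q -> unram K Q.

Definition inf_split (K L : sset Om) : Prop :=
  forall Q, is_place L Q -> over_inf Q -> unram K Q /\ resdeg1 K Q.

Definition genus_form (K L : sset Om) : Prop :=
  exists ks, abelian_ext ks /\ seqs L (gen (sunion K ks)).

Definition admissible (K L : sset Om) : Prop :=
  [/\ genus_form K L, unram_ext K L & inf_split K L].

Definition is_genus_field (K G : sset Om) : Prop :=
  admissible K G /\ forall L, admissible K L -> ssub L G.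

Definition kadjoin (g : nat -> Om) (r : nat) : sset Om :=
  gen (sunion kimg (fun x => exists2 j, (j < r)%N & x = g j)).

End OverK.

(* data (N_j, X_j) of F_j = k( N_j-th root of X_j ) in the case m > t *)
Definition gf_data (F : finFieldType) (l n t i0 : nat) (P : nat -> {poly F})
  (a c d : nat -> nat) (za : int) (y : nat -> int) (j : nat) : nat * ratfun F :=
  if (j < i0)%N then
    ((l ^ (n - a j))%N, pfrac (P j) * pfrac (P i0) ^ (- za * (c j)%:Z * (l ^ (d j - d i0))%N%:Z))
  else if j == i0 then
    ((l ^ (d i0 + t))%N, pfrac (pstar (P i0)))
  else if (d i0 <= d j)%N then
    ((l ^ (n - a j))%N, pfrac (P j) * pfrac (P i0) ^ (y j * (l ^ (d j - d i0))%N%:Z))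
  else
    ((l ^ (n - a j + d i0 - d j))%N,
     pfrac (P j) ^+ (l ^ (d i0 - d j))%N * pfrac (P i0) ^ y j).

(* Main.v *)
Require Import Defs.
From HB Require Import structures.
From mathcomp Require Import boolp classical_sets.
From mathcomp Require Import all_boot all_order all_algebra all_fingroup all_field.
From mathcomp Require Import cyclic pgroup classfun character.
From mathcomp Require Import ring zify.
Import Order.TTheory GRing.Theory Num.Theory.
Set Implicit Arguments.
Unset Strict Implicit.
Unset Printing Implicit Defensive.
Local Open Scope ring_scope.


(** Write M = l^n. Call an exponent vector x good when l^(a_j) divides each x_j and l^(n-t)
    divides the sum of the x_j deg P_j. At the prime P_j the ramification index of E is
    l^(n-a_j), and at infinity it is l^t, without residue extension because P^* is a one-unit
    times a power of -1/T. Comparing uniformizers at each place, one finds that for x good the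
    M-th roots of the product S_x of the (P_j^* )^(x_j) generate over E an extension
    unramified at every place and split at infinity.
    Conversely, let L = E ks be admissible. The infinite places have residue field F in L, so
    expansions in 1/T show that ks meets kbar = Fbar(T) in k only. If s fixes kbar, then
    s^M = 1 on ks: otherwise a character of the group induced on ks would provide an
    Artin-Schreier generator, or the M-th power of a Kummer generator, with no ramification
    over Fbar(T), hence an element of Fbar(T). So ks is spanned by elements y with y^M in k,
    and the local conditions on L force y^M to be c^M S_x h^M with c in F, h in k and x good.
    The genus field is therefore generated by the M-th roots of the S_x, x good, and it
    remains to compute with exponents: every g_j is such a root, up to a sign, and the
    exponents of the g_j generate all good vectors modulo M. *)

(** * Subrings and subfields *)

(** Nothing is known beforehand about the abelian part ks of an admissible L: its degree may be
    divisible by the characteristic or by primes other than l. Its exponent has to come out of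
    ramification, and over k it cannot, since constant extensions are unramified everywhere. Over
    Fbar(T) they are gone, and there a Kummer or Artin-Schreier extension without ramification is
    trivial by elementary means: every polynomial splits, so divisors are products of factors T - a
    and poles can be removed one by one. The constants come back only through the splitting at
    infinity, which also forces the constant in a Kummer generator to be an M-th power. Places are
    extended to valuation rings W of the whole of Om, so that E, L and Fbar(T) are compared under
    one and the same W. Unramified then means that a uniformizer of E remains a uniformizer, and
    residue degree one that the constants F represent all residues; these two statements take the
    place of inertia and decomposition groups. *)

Definition is_subring (R : comNzRingType) (K : R -> Prop) : Prop :=
  [/\ K 1, (forall x y, K x -> K y -> K (x - y))
         & (forall x y, K x -> K y -> K (x * y))].

Definition coefs_in (R : nzRingType) (K : R -> Prop) (p : {poly R}) : Prop :=
  forall i, K p`_i.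

Section Subring.
Variables (R : comNzRingType) (K : R -> Prop) (HK : is_subring K).

Lemma subring1 : K 1. Proof. by case: HK. Qed.
Lemma subringB x y : K x -> K y -> K (x - y). Proof. case: HK => _ + _; exact. Qed.
Lemma subringM x y : K x -> K y -> K (x * y). Proof. case: HK => _ _; exact. Qed.
Lemma subring0 : K 0. Proof. by rewrite -(subrr 1); apply: subringB; exact: subring1. Qed.
Lemma subringN x : K x -> K (- x).
Proof. by move=> Kx; rewrite -sub0r; apply: subringB => //; exact: subring0. Qed.
Lemma subringD x y : K x -> K y -> K (x + y).
Proof. by move=> Kx Ky; rewrite -[y]opprK; apply/subringB/subringN. Qed.
Lemma subringX x n : K x -> K (x ^+ n).
Proof.
move=> Kx; elim: n => [|n IH]; first by rewrite expr0; exact: subring1.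
by rewrite exprS; apply: subringM.
Qed.
Lemma subring_sum (I : Type) (r : seq I) (P : pred I) (f : I -> R) :
  (forall i, P i -> K (f i)) -> K (\sum_(i <- r | P i) f i).
Proof. by move=> Kf; apply: big_ind => //; [exact: subring0 | exact: subringD]. Qed.
Lemma subring_prod (I : Type) (r : seq I) (P : pred I) (f : I -> R) :
  (forall i, P i -> K (f i)) -> K (\prod_(i <- r | P i) f i).
Proof. by move=> Kf; apply: big_ind => //; [exact: subring1 | exact: subringM]. Qed.
Lemma subring_nat n : K n%:R.
Proof.
elim: n => [|n IH]; first exact: subring0.
by rewrite -natr1; apply: subringD => //; exact: subring1.
Qed.
Lemma subringMn x n : K x -> K (x *+ n).
Proof. by move=> Kx; rewrite -mulr_natr; apply: subringM => //; exact: subring_nat. Qed.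

End Subring.

Section Coefficients.
Variables (R : comNzRingType) (K : R -> Prop) (HK : is_subring K).

Lemma coefs_in0 : coefs_in K 0.
Proof. by move=> i; rewrite coef0; exact: (subring0 HK). Qed.
Lemma coefs_inC c : K c -> coefs_in K c%:P.
Proof. by move=> Kc i; rewrite coefC; case: eqP => // _; exact: (subring0 HK). Qed.
Lemma coefs_in1 : coefs_in K 1.
Proof. by rewrite -polyC1; apply: coefs_inC; exact: (subring1 HK). Qed.
Lemma coefs_inX : coefs_in K 'X.
Proof. by move=> i; rewrite coefX; exact: (subring_nat HK). Qed.
Lemma coefs_inD p q : coefs_in K p -> coefs_in K q -> coefs_in K (p + q).
Proof. by move=> Kp Kq i; rewrite coefD; apply: (subringD HK). Qed.
Lemma coefs_inB p q : coefs_in K p -> coefs_in K q -> coefs_in K (p - q).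
Proof. by move=> Kp Kq i; rewrite coefB; apply: (subringB HK). Qed.
Lemma coefs_inM p q : coefs_in K p -> coefs_in K q -> coefs_in K (p * q).
Proof.
by move=> Kp Kq i; rewrite coefM; apply: (subring_sum HK) => j _; apply: (subringM HK).
Qed.
Lemma coefs_subring : is_subring (coefs_in K : {poly R} -> Prop).
Proof. split; [exact: coefs_in1 | exact: coefs_inB | exact: coefs_inM]. Qed.
Lemma coefs_in_deriv p : coefs_in K p -> coefs_in K p^`().
Proof. by move=> Kp i; rewrite coef_deriv; apply: (subringMn HK). Qed.
Lemma coefs_in_horner p x : coefs_in K p -> K x -> K p.[x].
Proof.
move=> Kp Kx; rewrite horner_coef; apply: (subring_sum HK) => i _.
by apply: (subringM HK) => //; apply: (subringX HK).
Qed.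

(** The leading term of q is cancelled by a multiple of p, and no inverse is taken in K since p is
    monic. This matters because K is later a valuation ring, or a graph inside the product ring
    [Om * Om]. *)
Lemma monic_division p q : p \is monic -> coefs_in K p -> coefs_in K q ->
  exists a r, [/\ coefs_in K a, coefs_in K r, q = a * p + r & (size r < size p)%N].
Proof.
move=> mp Kp; have [n] := ubnP (size q); elim: n q => // n IH q; rewrite ltnS => sq Kq.
have [lt|le] := ltnP (size q) (size p).
  by exists 0, q; split; rewrite ?mul0r ?add0r //; exact: coefs_in0.
pose m := (lead_coef q)%:P * 'X^(size q - size p) : {poly R}.
have Km : coefs_in K m.
  apply: coefs_inM; first by apply: coefs_inC; exact: Kq.
  exact: (subringX coefs_subring _ coefs_inX).
have p0 : p != 0 by apply: monic_neq0.
have q0 : q != 0.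
  by rewrite -size_poly_gt0 (leq_trans _ le) // size_poly_gt0.
have pgt0 : (0 < size p)%N by rewrite size_poly_gt0.
have sm : (size (q - m * p)%R < size q)%N.
  have lt0 : (0 < size q)%N by rewrite size_poly_gt0.
  rewrite -(prednK lt0) ltnS; apply/leq_sizeP => j.
  rewrite leq_eqVlt => /orP[/eqP <-|lt].
    rewrite coefB /m -mulrA coefCM [_ * p]mulrC coefMXn ifF; last first.
      by apply/negbTE; rewrite -leqNgt; move: le lt0 pgt0; lia.
    have -> : ((size q).-1 - (size q - size p) = (size p).-1)%N.
      by move: le pgt0; lia.
    by rewrite -/(lead_coef p) (monicP mp) mulr1 -/(lead_coef q) subrr.
  have ltj : (size q <= j)%N by rewrite -(prednK lt0).
  rewrite coefB (nth_default _ ltj) /m -mulrA coefCM [_ * p]mulrC coefMXn.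
  case: ifP => _; first by rewrite mulr0 subr0.
  by rewrite nth_default ?mulr0 ?subr0 // -[leqLHS](subKn le) leq_sub2r.
have [a [r [Ka Kr e s]]] := IH _ (leq_trans sm sq) (coefs_inB Kq (coefs_inM Km Kp)).
exists (a + m), r; split => //; first exact: coefs_inD.
by rewrite mulrDl addrAC -e subrK.
Qed.

End Coefficients.

Section Subfield.
Variable Om : fieldType.
Implicit Types (K A : sset Om).

Lemma subfield_subring K : is_subfield K -> is_subring K.
Proof. by case. Qed.
Lemma subfieldV K x : is_subfield K -> K x -> K x^-1.
Proof. by case=> _ _ _ _; apply. Qed.
Lemma subfield_div K x y : is_subfield K -> K x -> K y -> K (x / y).
Proof. by move=> KK Kx Ky; apply: (subringM (subfield_subring KK)) => //; apply: subfieldV. Qed.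
Lemma subfieldXz K x (i : int) : is_subfield K -> K x -> K (x ^ i).
Proof.
move=> KK Kx; case: i => n; first exact: (subringX (subfield_subring KK)).
by rewrite NegzE -exprnN; apply: subfieldV => //; apply: (subringX (subfield_subring KK)).
Qed.

Lemma gen_subfield (S : sset Om) : is_subfield (gen S).
Proof.
split=> [M|M|x y Gx Gy M|x y Gx Gy M|x Gx M] KM SM.
- by case: KM.
- by case: KM.
- by apply: (subringB (subfield_subring KM)); [apply: Gx | apply: Gy].
- by apply: (subringM (subfield_subring KM)); [apply: Gx | apply: Gy].
- by apply: subfieldV => //; apply: Gx.
Qed.

Lemma gen_incl (S : sset Om) x : S x -> gen S x.
Proof. by move=> Sx M _; apply. Qed.

Lemma gen_min (S K : sset Om) : is_subfield K -> ssub S K -> ssub (gen S) K.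
Proof. by move=> KK SK x; apply. Qed.

Lemma gen_mono (S S' : sset Om) : ssub S S' -> ssub (gen S) (gen S').
Proof.
by move=> SS; apply: gen_min; [exact: gen_subfield | move=> x /SS; exact: gen_incl].
Qed.

Definition adjoin1 K (u : Om) : sset Om := gen (sunion K (fun x => x = u)).

Lemma sub_adjoin1 K u : ssub K (adjoin1 K u).
Proof. by move=> x Kx; apply: gen_incl; left. Qed.
Lemma mem_adjoin1 K u : adjoin1 K u u.
Proof. by apply: gen_incl; right. Qed.
Lemma adjoin1_min K u M : is_subfield M -> ssub K M -> M u -> ssub (adjoin1 K u) M.
Proof. by move=> MM KM Mu; apply: gen_min => // x [/KM|->]. Qed.

Definition algebraic_over K :=
  forall x : Om, exists p : {poly Om}, [/\ coefs_in K p, p != 0 & root p x].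

Lemma algebraic_overS K K' : ssub K K' -> algebraic_over K -> algebraic_over K'.
Proof.
move=> s aK x; have [p [Kp p0 px]] := aK x.
by exists p; split => // i; apply: s.
Qed.

(** Removing factors X from a polynomial relation for x makes its constant term c nonzero; then q(x)
    x = - c exhibits the inverse of x as a polynomial in x. *)
Lemma algebraic_inverse K x : is_subfield K -> algebraic_over K -> x != 0 ->
  exists2 p : {poly Om}, coefs_in K p & x * p.[x] = 1.
Proof.
move=> KK aK x0; have [p [Kp p0 px]] := aK x.
have KR := subfield_subring KK.
elim/poly_ind: p Kp p0 px => [|q c IH] Kp p0 px; first by rewrite eqxx in p0.
have Kq : coefs_in K q.
  by move=> i; have := Kp i.+1; rewrite coefD coefMX coefC /= addr0.
have Kc : K c by have := Kp 0%N; rewrite coefD coefMX coefC /= add0r.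
have e : q.[x] * x + c = 0 by move: px; rewrite /root hornerMXaddC => /eqP.
have [c0|c0] := eqVneq c 0.
  apply: IH => //; first by apply: contraNneq p0 => ->; rewrite c0 mul0r add0r.
  by move/eqP: e; rewrite c0 addr0 mulf_eq0 (negbTE x0) orbF.
exists ((- c^-1)%:P * q).
  apply: (coefs_inM KR) => //; apply: (coefs_inC KR).
  by apply: (subringN KR); apply: subfieldV.
have -> : c = - (q.[x] * x) by apply/eqP; rewrite -addr_eq0 addrC e.
rewrite hornerM hornerC; have : q.[x] * x != 0.
  by apply: contraNneq c0 => q0; move: e; rewrite q0 add0r => ->.
by move=> qx0; rewrite invrN opprK mulrCA [x * _]mulrC mulVf.
Qed.

(** Inverses are polynomials by [algebraic_inverse]. To see that all elements of a generated field
    have a certain shape, it is therefore enough that the elements of that shape form a ring. *)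
Lemma algebraic_subring K A : is_subfield K -> algebraic_over K ->
  is_subring A -> ssub K A -> is_subfield A.
Proof.
move=> KK aK AA KA; split; [exact: (subring0 AA)|by case: AA|by case: AA|by case: AA|].
move=> x Ax; have [->|x0] := eqVneq x 0; first by rewrite invr0; exact: (subring0 AA).
have [p Kp e] := algebraic_inverse KK aK x0.
suff -> : x^-1 = p.[x].
  by apply: (coefs_in_horner AA) => // i; apply: KA.
by rewrite -[RHS](mulKf x0) e mulr1.
Qed.

Definition poly_ring K (u : Om) : sset Om :=
  fun x => exists2 p : {poly Om}, coefs_in K p & x = p.[u].

Lemma poly_ring_subring K u : is_subring K -> is_subring (poly_ring K u).
Proof.
move=> KK; split.
- by exists 1; [exact: (coefs_in1 KK) | rewrite hornerE].
- move=> _ _ [p Kp ->] [q Kq ->]; exists (p - q); first exact: (coefs_inB KK).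
  by rewrite hornerD hornerN.
- move=> _ _ [p Kp ->] [q Kq ->]; exists (p * q); first exact: (coefs_inM KK).
  by rewrite hornerM.
Qed.
Lemma sub_poly_ring K u : is_subring K -> ssub K (poly_ring K u).
Proof. by move=> KK x Kx; exists x%:P; [exact: (coefs_inC KK) | rewrite hornerC]. Qed.
Lemma mem_poly_ring K u : is_subring K -> poly_ring K u u.
Proof. by move=> KK; exists 'X; [exact: (coefs_inX KK) | rewrite hornerX]. Qed.

Lemma adjoin1_poly K0 K u : is_subfield K0 -> algebraic_over K0 -> is_subfield K ->
  ssub K0 K -> ssub (adjoin1 K u) (poly_ring K u).
Proof.
move=> KK0 aK0 KK K0K; have KR := subfield_subring KK.
apply: adjoin1_min; [|exact: sub_poly_ring|exact: mem_poly_ring].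
apply: (algebraic_subring KK0 aK0); first exact: poly_ring_subring.
by move=> x /K0K; apply: sub_poly_ring.
Qed.

End Subfield.

(** * Extension of places and of homomorphisms *)

Section Chevalley.
Variable Om : fieldType.
Implicit Types (A B I J W : sset Om).

(** These are rings of the whole of Om, and Om itself is allowed; nontriviality is a separate
    hypothesis wherever it matters. *)
Definition valuation_ring W : Prop :=
  is_subring W /\ (forall x, x != 0 -> W x \/ W x^-1).

Definition ideal_span I B : sset Om := fun x => exists l : seq (Om * Om),
  (forall z, z \in l -> I z.1 /\ B z.2) /\ x = \sum_(z <- l) z.1 * z.2.

Lemma ideal_span0 I B : ideal_span I B 0.
Proof. by exists [::]; rewrite big_nil. Qed.
Lemma ideal_spanD I B x y :
  ideal_span I B x -> ideal_span I B y -> ideal_span I B (x + y).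
Proof.
move=> [l [Hl ->]] [l' [Hl' ->]]; exists (l ++ l'); rewrite big_cat; split => // z.
by rewrite mem_cat => /orP[/Hl|/Hl'].
Qed.
Lemma ideal_spanM I B x b :
  is_subring B -> ideal_span I B x -> B b -> ideal_span I B (b * x).
Proof.
move=> BB [l [Hl ->]] Bb; exists [seq (z.1, b * z.2) | z <- l]; split.
  by move=> _ /mapP[z /Hl[Iz Bz] ->]; split => //; apply: (subringM BB).
by rewrite big_map mulr_sumr; apply: eq_bigr => z _ /=; rewrite mulrCA.
Qed.
Lemma ideal_span_sub I B x : is_subring B -> I x -> ideal_span I B x.
Proof.
move=> BB Ix; exists [:: (x, 1)]; rewrite big_seq1 mulr1; split => // z.
by rewrite inE => /eqP -> ; split => //; exact: subring1.
Qed.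

(** For J the ideal spanned by I in a ring B, such a relation says that I generates 1 in B[x], with
    a bound n on the powers of x involved. *)
Definition unit_relation J x n := exists p : {poly Om},
  [/\ coefs_in J p, (size p <= n.+1)%N & p.[x] = 1].

(** The relation for the inverse, multiplied by x^(n+1), expresses (1 - q_0) x^(n+1) by lower powers
    of x with coefficients in J. Multiplying the relation for x by 1 - q_0 and replacing its top
    term lowers its degree. *)
Lemma unit_relation_reduce I B x n m : is_subring B -> ssub I B ->
  let J := ideal_span I B in x != 0 -> (m <= n.+1)%N ->
  unit_relation J x n.+1 -> unit_relation J x^-1 m -> unit_relation J x n.
Proof.
move=> BB IB J x0 le [p [Jp sp px]] [q [Jq sq qx]].
have JB y : J y -> B y.
  move=> [l [Hl ->]]; rewrite big_seq; apply: (subring_sum BB) => z /Hl[/IB Iz Bz].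
  exact: (subringM BB).
have JM b y : B b -> J y -> J (b * y) by move=> Bb Jy; apply: ideal_spanM.
have B1q : B (1 - q`_0) by apply: (subringB BB); [exact: subring1|exact/JB/Jq].
(* The first summand is the old relation times 1 - q_0, the second replaces its top term, and the
   third puts q_0 back into the constant term, so that the total is again 1. *)
pose f i := (1 - q`_0) * p`_i + p`_n.+1 * (if (n.+1 - i <= m)%N then q`_(n.+1 - i) else 0)
            + (if i == 0%N then q`_0 else 0).
exists (\poly_(i < n.+1) f i); split.
- move=> i; rewrite coef_poly; case: ltnP => _; last exact: ideal_span0.
  apply: ideal_spanD; last by case: eqP => _; [exact: Jq|exact: ideal_span0].
  apply: ideal_spanD; first exact: JM.
  by apply: JM; [exact/JB/Jp|case: ifP => _; [exact: Jq|exact: ideal_span0]].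
- exact: size_poly.
rewrite horner_poly.
have ep : p.[x] = \sum_(i < n.+2) p`_i * x ^+ i by apply: horner_coef_wide.
have eq1 : \sum_(i < m.+1) q`_i * x^-1 ^+ i = 1 by rewrite -(horner_coef_wide _ sq).
have key : \sum_(i < n.+1) (if (n.+1 - i <= m)%N then q`_(n.+1 - i) else 0) * x ^+ i =
           (1 - q`_0) * x ^+ n.+1.
  rewrite (_ : 1 - q`_0 = \sum_(i < m) q`_i.+1 * x^-1 ^+ i.+1); last first.
    by rewrite -eq1 big_ord_recl expr0 mulr1 addrAC subrr add0r.
  rewrite mulr_suml.
  have -> : \sum_(i < m) q`_i.+1 * x^-1 ^+ i.+1 * x ^+ n.+1 =
            \sum_(i < n.+1) (if (i.+1 <= m)%N then q`_i.+1 else 0) * x ^+ (n - i).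
    rewrite (big_ord_widen n.+1 (fun i => q`_i.+1 * x^-1 ^+ i.+1 * x ^+ n.+1)) //.
    rewrite big_mkcond; apply: eq_bigr => i _; case: ifP => _; last by rewrite mul0r.
    rewrite -mulrA; congr (_ * _); have := ltn_ord i; rewrite ltnS => lei.
    have -> : x ^+ n.+1 = x ^+ i.+1 * x ^+ (n - i) by rewrite -exprD addSn subnKC.
    by rewrite exprVn mulKf // expf_neq0.
  rewrite (reindex_inj rev_ord_inj); apply: eq_bigr => i _ /=.
  by congr ((if (_ <= m)%N then q`__ else 0) * x ^+ _); have := ltn_ord i; lia.
have -> : \sum_(i < n.+1) f i * x ^+ i =
  (1 - q`_0) * (\sum_(i < n.+1) p`_i * x ^+ i) + p`_n.+1 * ((1 - q`_0) * x ^+ n.+1) + q`_0.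
  rewrite -key !mulr_sumr -big_split /=.
  have e0 : \sum_(i < n.+1) (if i == 0%N :> nat then q`_0 else 0) * x ^+ i = q`_0.
    by rewrite big_ord_recl /= expr0 mulr1 big1 ?addr0 // => i _; rewrite mul0r.
  rewrite -[X in _ = _ + X]e0.
  by rewrite -big_split /=; apply: eq_bigr => i _; rewrite /f !mulrDl !mulrA.
move: px; rewrite ep big_ord_recr /=; set s := \sum_(i < n.+1) _ => px.
have -> : s = 1 - p`_n.+1 * x ^+ n.+1 by rewrite -px addrK.
by ring.
Qed.

(** A ring B maximal among those in which I does not generate 1 is a valuation ring: if neither x
    nor its inverse lies in B, adjoining either one yields a unit relation, and shortening the two
    relations against each other ends with 1 in the ideal. *)
Lemma chevalley A I : is_subring A -> ssub I A ->
  (forall x y, I x -> I y -> I (x + y)) -> (forall a x, A a -> I x -> I (a * x)) ->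
  ~ I 1 -> exists W, [/\ valuation_ring W, ssub A W & ssub I (mideal W)].
Proof.
move=> AA IA ID IM I1.
pose good B := [/\ is_subring B, ssub A B & ~ ideal_span I B 1].
have gA : good A.
  split => // -[[|z l] [Hl e]]; first by move/eqP: e; rewrite big_nil oner_eq0.
  have I0 : I 0.
    have [Iz _] := Hl z (mem_head _ _).
    by rewrite -(mul0r z.1); apply: IM => //; exact: subring0.
  apply: I1; rewrite e big_seq; apply: big_ind => // t /Hl[It At].
  by rewrite mulrC; exact: IM.
(* Zorn's lemma also has to bound the empty chain, whose union is empty; joining A to every set
   makes this case harmless. *)
pose P (X : set Om) := good (fun x => A x \/ X x).
have chain (C : set (set Om)) :
    (C `<=` P -> total_on C classical_sets.subset -> P (\bigcup_(X in C) X))%classic.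
  move=> CP tot; have [[X0 CX0]|none] := pselect (exists X, C X); last first.
    have e : (fun x => A x \/ (\bigcup_(X in C) X)%classic x) = A.
      apply/funext => x; apply/propext; split=> [[//|[X CX _]]|]; last by left.
      by case: none; exists X.
    by rewrite /P e.
  have dir (l : seq Om) : (forall x, x \in l -> A x \/ (\bigcup_(X in C) X)%classic x) ->
      exists2 X, C X & forall x, x \in l -> A x \/ X x.
    elim: l => [|x l IH] Hl; first by exists X0.
    have [X CX HX] := IH (fun y yl => Hl y (@mem_behead _ (x :: l) y yl)).
    have [Ax|[Y CY Yx]] := Hl x (mem_head _ _).
      by exists X => // y; rewrite inE => /orP[/eqP->|/HX]; [left|].
    have [XY|YX] := tot _ _ CX CY.
      exists Y => // y; rewrite inE => /orP[/eqP->|/HX[]]; [by right|by left|].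
      by move/XY; right.
    by exists X => // y; rewrite inE => /orP[/eqP->|/HX//]; right; apply: YX.
  have two x y (S := fun x => A x \/ (\bigcup_(X in C) X)%classic x) : S x -> S y ->
      exists2 X, C X & (A x \/ X x) /\ (A y \/ X y).
    move=> Sx Sy; have [] := dir [:: x; y].
      by move=> z; rewrite !inE => /orP[] /eqP ->.
    by move=> X CX H; exists X => //; split; apply: H; rewrite !inE eqxx ?orbT.
  split.
  - split; first by left; exact: subring1.
      move=> x y Sx Sy; have [X CX [Xx Xy]] := two x y Sx Sy.
      have [BB _ _] := CP _ CX; have [|Xs] := subringB BB Xx Xy; first by left.
      by right; exists X.
    move=> x y Sx Sy; have [X CX [Xx Xy]] := two x y Sx Sy.
    have [BB _ _] := CP _ CX; have [|Xs] := subringM BB Xx Xy; first by left.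
    by right; exists X.
  - by left.
  - move=> [l [Hl e]]; have [x|X CX HX] := dir [seq z.2 | z <- l].
      by move=> /mapP[z /Hl[_ Bz] ->].
    have [_ _ []] := CP _ CX; exists l; split => // z zl.
    by have [Iz _] := Hl _ zl; split => //; apply: HX; apply: map_f.
have [X [PX maxX]] := Zorn_bigcup chain.
set B := (fun x => A x \/ X x) in PX; have [BB AB B1] := PX.
have maxB B' : good B' -> ssub B B' -> ssub B' B.
  move=> gB' sB x B'x; have [//|nBx] := pselect (B x).
  have e : (fun x => A x \/ B' x) = B'.
    apply/funext => z; apply/propext; split=> [[Az|//]|]; last by right.
    by apply: sB; left.
  case: (maxX B'); last by rewrite /P e.
  split; last by move=> /(_ x B'x) Xx; apply: nBx; right.
  by move=> z Xz; apply: sB; right.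
have IB : ssub I B by move=> x /IA; left.
have rel x : ~ B x -> exists n, unit_relation (ideal_span I B) x n.
  move=> nBx; have [//|ng] := pselect (ideal_span I (poly_ring B x) 1); last first.
    case: nBx; apply: (maxB (poly_ring B x)); last exact: mem_poly_ring.
      split => //; first exact: poly_ring_subring.
      by move=> z Az; apply: sub_poly_ring => //; left.
    exact: sub_poly_ring.
  move=> [l [Hl e]].
  suff [p [Jp px]] : exists p : {poly Om}, coefs_in (ideal_span I B) p /\ p.[x] = 1.
    by exists (size p), p; split.
  rewrite e; elim: l Hl {e} => [|z l IH] Hl.
    exists 0; rewrite big_nil horner0; split => // i; rewrite coef0; exact: ideal_span0.
  have [p [Jp px]] := IH (fun y yl => Hl y (@mem_behead _ (z :: l) y yl)).
  have [Iz [q Bq eq]] := Hl z (mem_head _ _).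
  exists (z.1%:P * q + p); rewrite big_cons hornerD hornerM hornerC px eq; split => // i.
  rewrite coefD coefCM; apply: ideal_spanD => //; rewrite mulrC.
  by apply: ideal_spanM => //; apply: ideal_span_sub.
have norel N x n m : (n + m <= N)%N -> x != 0 -> unit_relation (ideal_span I B) x n ->
    unit_relation (ideal_span I B) x^-1 m -> False.
  elim: N x n m => [|N IH] x n m le x0 rx ry.
    have n0 : n = 0%N by lia.
    move: rx; rewrite n0 => -[p [Jp sp px]]; apply: B1.
    by rewrite -px (size1_polyC sp) hornerC.
  have H y k j : (j <= k)%N -> (k + j <= N.+1)%N -> y != 0 ->
      unit_relation (ideal_span I B) y k -> unit_relation (ideal_span I B) y^-1 j -> False.
    case: k => [|k] lej leN y0 r1 r2.
      move: r1 => [p [Jp sp px]]; apply: B1.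
      by rewrite -px (size1_polyC sp) hornerC.
    by apply: (IH y k j) => //; apply: (unit_relation_reduce BB IB y0 lej).
  have [le1|lt1] := leqP m n; first exact: (H x n m).
  apply: (H x^-1 m n) => //; [exact: ltnW|by rewrite addnC|by rewrite invr_eq0|by rewrite invrK].
exists B; split => //.
  split => // x x0; have [Bx|nBx] := pselect (B x); first by left.
  have [Bx'|nBx'] := pselect (B x^-1); first by right.
  have [n rn] := rel _ nBx; have [m rm] := rel _ nBx'.
  by case: (norel (n + m)%N x n m).
move=> x Ix; split; first by left; apply: IA.
move=> x0 Bx; apply: B1; rewrite -(mulVf x0); apply: ideal_spanM => //.
exact: ideal_span_sub.
Qed.

End Chevalley.

(** * Extension of homomorphisms *)

Section HomExtension.
Variables (Om : closedFieldType) (K : sset Om).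
Hypotheses (KK : is_subfield K) (aK : algebraic_over K).
Implicit Types (R : Om * Om -> Prop) (p q : {poly Om * Om}).

(* Graphs of ring homomorphisms from a subring of Om containing K to Om, identical on K;
   as Om is algebraic over K, such a subring is a field. *)
Definition hom_graph R : Prop :=
  [/\ is_subring R, forall c, K c -> R (c, c) & forall y, R (0, y) -> y = 0].

Lemma hom_graph_inverse R z w : hom_graph R -> R (z, w) -> z != 0 ->
  exists2 t, R t & t * (z, w) = 1.
Proof.
move=> [RR RK R0] Rzw z0; have [Q KQ e] := algebraic_inverse KK aK z0.
pose t := \sum_(i < size Q) (Q`_i, Q`_i) * (z, w) ^+ i : Om * Om.
have Rt : R t.
  apply: (subring_sum RR) => i _; apply: (subringM RR); first exact: RK.
  exact: (subringX RR).
have t1 : t.1 = Q.[z].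
  rewrite /t (raddf_sum fst) horner_coef; apply: eq_bigr => i _.
  rewrite /= ; congr (_ * _); elim: (nat_of_ord i) => [|k IH] //.
  by rewrite !exprS /= IH.
have Rtz := subringM RR Rt Rzw.
exists t => //; apply/eqP; rewrite -subr_eq0; apply/eqP.
have := subringB RR Rtz (subring1 RR).
have e1 : (t * (z, w) - 1).1 = 0 by rewrite /= t1 mulrC e subrr.
by case: (_ - _) e1 => a b /= -> /R0 ->.
Qed.

(** A polynomial over the graph R is a polynomial over the domain together with its image under the
    homomorphism. So p holds at once a minimal polynomial of x and its transport, whose roots are
    the possible images of x. *)
Lemma min_graph_poly R x : hom_graph R ->
  exists p, [/\ p \is monic, coefs_in R p, root (map_poly fst p) x &
    forall q, coefs_in R q -> root (map_poly fst q) x -> (size q < size p)%N -> q = 0].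
Proof.
move=> gR; have [RR RK R0] := gR.
pose P n := `[< exists p, [/\ p \is monic, coefs_in R p, root (map_poly fst p) x & size p = n] >].
have exP : exists n, P n.
  have [p [Kp p0 px]] := aK x; pose c := (lead_coef p)^-1.
  have lp0 : lead_coef p != 0 by rewrite lead_coef_eq0.
  pose D := \poly_(i < size p) (c * p`_i, c * p`_i) : {poly Om * Om}.
  exists (size D); apply/asboolP; exists D; split => //.
  - have l1 : (c * lead_coef p, c * lead_coef p) = 1 :> Om * Om by rewrite mulVf.
    have s0 : (0 < size p)%N by rewrite size_poly_gt0.
    have sD : size D = size p.
      by rewrite size_poly_eq // -/(lead_coef p) l1 oner_eq0.
    apply/monicP; rewrite /lead_coef sD coef_poly prednK // leqnn.
    exact: l1.
  - move=> i; rewrite coef_poly; case: ifP => _; last exact: (subring0 RR).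
    apply: RK; apply: (subringM (subfield_subring KK)) => //.
    by apply: (subfieldV KK); exact: Kp.
  - have -> : map_poly fst D = c%:P * p.
      apply/polyP => i; rewrite coef_map /= coefCM coef_poly.
      by case: ltnP => //= le; rewrite nth_default // mulr0.
    by rewrite rootM px orbT.
case: (ex_minnP exP) => n /asboolP[p [mp Rp px sp]] minp.
exists p; split => // q Rq qx ltq; apply: contrapT => /eqP q0.
have [[u v] elc] : {uv | lead_coef q = uv} by exists (lead_coef q).
have Ruv : R (u, v) by rewrite -elc; exact: Rq.
have u0 : u != 0.
  apply: contra_neq q0 => u0; apply/eqP; rewrite -lead_coef_eq0 elc.
  by move: Ruv; rewrite u0 => /R0 ->.
have [t Rt et] := hom_graph_inverse gR Ruv u0.
have q'm : t%:P * q \is monic.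
  by rewrite monicE lead_coef_proper_mul lead_coefC elc et ?oner_eq0.
have : P (size (t%:P * q)).
  apply/asboolP; exists (t%:P * q); split => //.
    by apply: (coefs_inM RR) => //; exact: coefs_inC.
  by rewrite rmorphM /= rootM qx orbT.
move=> /minp; rewrite leqNgt => /negP[]; rewrite -sp (leq_ltn_trans _ ltq) //.
by rewrite mul_polyC size_scale_leq.
Qed.

Definition graph_adjoin R x x' : Om * Om -> Prop := fun z => exists2 q, coefs_in R q &
  z = ((map_poly fst q).[x], (map_poly snd q).[x']).

(** The map is well defined: if the first component of q vanishes at x, then the remainder of q
    modulo p is 0 by minimality, so the second component of q vanishes at x' together with that of
    p. *)
Lemma graph_adjoinP R p x x' : hom_graph R -> p \is monic -> coefs_in R p ->
  root (map_poly fst p) x -> 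
  (forall q, coefs_in R q -> root (map_poly fst q) x -> (size q < size p)%N -> q = 0) ->
  root (map_poly snd p) x' ->
  [/\ hom_graph (graph_adjoin R x x'), (forall z, R z -> graph_adjoin R x x' z)
     & graph_adjoin R x x' (x, x')].
Proof.
move=> [RR RK R0] mp Rp px minp px'.
have inc z : R z -> graph_adjoin R x x' z.
  move=> Rz; exists z%:P; first exact: (coefs_inC RR).
  by rewrite !map_polyC /= !hornerC; case: z Rz.
split => //; last first.
  by exists 'X; [exact: (coefs_inX RR) | rewrite !map_polyX !hornerX].
split; last 1 first.
- move=> y [q Rq [e0 ->]].
  have [a [r [Ra Rr eq sr]]] := monic_division RR mp Rp Rq.
  have rx : root (map_poly fst r) x.
    by apply/rootP; move: e0; rewrite eq rmorphD rmorphM /= hornerD hornerM (rootP px) mulr0 add0r.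
  rewrite eq (minp r Rr rx sr) addr0 rmorphM /= hornerM (rootP px') mulr0 //.
- split.
  + by apply: inc; exact: subring1.
  + move=> _ _ [q Rq ->] [r Rr ->]; exists (q - r); first exact: (coefs_inB RR).
    by rewrite !rmorphB /= !hornerD !hornerN.
  + move=> _ _ [q Rq ->] [r Rr ->]; exists (q * r); first exact: (coefs_inM RR).
    by rewrite !rmorphM /= !hornerM.
- by move=> c /RK; apply: inc.
Qed.

(** A maximal graph is defined everywhere, because the transported minimal polynomial of any x has a
    root in the algebraically closed Om. The map obtained is a ring endomorphism of Om, as used in
    [abelian_ext]. *)
Lemma hom_graph_extend R : hom_graph R ->
  exists s : {rmorphism Om -> Om}, forall z, R z -> s z.1 = z.2.
Proof.
move=> gR; pose P (X : set (Om * Om)) := hom_graph (fun z => R z \/ X z).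
have chain (C : set (set (Om * Om))) :
    (C `<=` P -> total_on C classical_sets.subset -> P (\bigcup_(X in C) X))%classic.
  move=> CP tot; have [[X0 CX0]|none] := pselect (exists X, C X); last first.
    have e : (fun z => R z \/ (\bigcup_(X in C) X)%classic z) = R.
      apply/funext => x; apply/propext; split=> [[//|[X CX _]]|]; last by left.
      by case: none; exists X.
    by rewrite /P e.
  have two x y (S := fun x => R x \/ (\bigcup_(X in C) X)%classic x) : S x -> S y ->
      exists2 X, C X & (R x \/ X x) /\ (R y \/ X y).
    move=> [Rx|[X CX Xx]] [Ry|[Y CY Yy]].
    - by exists X0 => //; split; left.
    - by exists Y => //; split; [left|right].
    - by exists X => //; split; [right|left].
    - have [XY|YX] := tot _ _ CX CY; first by exists Y => //; split; right => //; apply: XY.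
      by exists X => //; split; right => //; apply: YX.
  have [RR RK R0] := gR; split.
  - split; first by left; exact: subring1.
      move=> x y Sx Sy; have [X CX [Xx Xy]] := two x y Sx Sy.
      have [BB _ _] := CP _ CX; have [|Xs] := subringB BB Xx Xy; first by left.
      by right; exists X.
    move=> x y Sx Sy; have [X CX [Xx Xy]] := two x y Sx Sy.
    have [BB _ _] := CP _ CX; have [|Xs] := subringM BB Xx Xy; first by left.
    by right; exists X.
  - by move=> c /RK; left.
  - move=> y [/R0//|[X CX Xy]]; have [_ _] := CP _ CX; apply; by right.
have [X [PX maxX]] := Zorn_bigcup chain.
set B := (fun z => R z \/ X z) in PX.
have tot x : exists y, B (x, y).
  have [p [mp Bp px minp]] := min_graph_poly x PX.
  have sp : size (map_poly snd p) = size p.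
    by rewrite size_map_poly_id0 ?(monicP mp) ?oner_eq0.
  have sp1 : size (map_poly fst p) = size p.
    by rewrite size_map_poly_id0 ?(monicP mp) ?oner_eq0.
  have [x' px'] : exists x', root (map_poly snd p) x'.
    apply/closed_rootP; rewrite sp; apply: contraL px => /eqP s1.
    have := mp; rewrite [p](size1_polyC _) ?s1 // monicE lead_coefC => /eqP ->.
    by rewrite rmorph1 (root1 _).
  have [gB' incB Bx] := graph_adjoinP PX mp Bp px minp px'.
  exists x'; apply: contrapT => nB.
  have e : (fun z => R z \/ graph_adjoin B x x' z) = graph_adjoin B x x'.
    apply/funext => z; apply/propext; split=> [[Rz|//]|]; last by right.
    by apply: incB; left.
  apply: (maxX (graph_adjoin B x x')); last by rewrite /P e.
  split; first by move=> z Xz; apply: incB; right.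
  by move=> /(_ _ Bx) Xx; apply: nB; right.
have [BB BK B0] := PX.
have uniqB x y y' : B (x, y) -> B (x, y') -> y = y'.
  move=> b1 b2; have := subringB BB b1 b2.
  have -> : (x, y) - (x, y') = (0, y - y') by congr pair; rewrite /= subrr.
  by move/B0/eqP; rewrite subr_eq0 => /eqP.
pose s x := sval (cid (tot x)).
have sP x : B (x, s x) := svalP (cid (tot x)).
have sB : zmod_morphism s.
  by move=> x y; apply: (uniqB (x - y)) => //; exact: (subringB BB (sP x) (sP y)).
have sM : monoid_morphism s.
  split; first by apply: (uniqB 1) => //; exact: (subring1 BB).
  by move=> x y; apply: (uniqB (x * y)) => //; exact: (subringM BB (sP x) (sP y)).
pose sA := GRing.isZmodMorphism.Build Om Om s sB.
pose sMM := GRing.isMonoidMorphism.Build Om Om s sM.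
pose sR : {rmorphism Om -> Om} := HB.pack s sA sMM.
exists sR => -[a b] Rab; apply: (uniqB a) => /=; [exact: sP|by left].
Qed.

End HomExtension.

(** * Elements fixed by all endomorphisms over a subfield *)

Section FixedElements.
Variables (Om : closedFieldType) (K : sset Om).
Hypotheses (KK : is_subfield K) (aK : algebraic_over K).

(* If s x = x for every s over K, the only root of the minimal polynomial of x is x. *)
Lemma fixed_min_poly x :
  (forall s : {rmorphism Om -> Om}, (forall c, K c -> s c = c) -> s x = x) ->
  exists d, [/\ (0 < d)%N, coefs_in K (('X - x%:P) ^+ d) &
    forall q : {poly Om}, coefs_in K q -> root q x -> ('X - x%:P) ^+ d %| q].
Proof.
move=> fx; pose R (z : Om * Om) := K z.1 /\ z.2 = z.1.
have KR := subfield_subring KK.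
have gR : hom_graph K R.
  split => // [|y []//].
  split; first by split => //; exact: (subring1 KR).
    by move=> [a b] [a' b'] [/= Ka ->] [/= Ka' ->]; split => //; apply: (subringB KR).
  by move=> [a b] [a' b'] [/= Ka ->] [/= Ka' ->]; split => //; apply: (subringM KR).
have [p [mp Rp px minp]] := min_graph_poly KK aK x gR.
have e12 : map_poly snd p = map_poly fst p.
  by apply/polyP => i; rewrite !coef_map /=; case: (Rp i).
have allx x' : root (map_poly fst p) x' -> x' = x.
  rewrite -e12 => px'; have [gR' incR Rx] := graph_adjoinP gR mp Rp px minp px'.
  have [s Hs] := hom_graph_extend KK aK gR'.
  have <- : s x = x' := Hs _ Rx.
  by apply: fx => c Kc; apply: (Hs (c, c)); apply: incR.
have mp1 : map_poly fst p \is monic by rewrite monic_map.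
have sp1 : size (map_poly fst p) = size p.
  by rewrite size_map_poly_id0 ?(monicP mp) ?oner_eq0.
have [rs ers] := closed_field_poly_normal (map_poly fst p).
rewrite (eqP mp1) scale1r in ers.
have ep : map_poly fst p = ('X - x%:P) ^+ size rs.
  rewrite ers big_seq (eq_bigr (fun=> 'X - x%:P)).
    by rewrite -big_seq big_const_seq count_predT iter_mulr_1.
  move=> z zr; congr ('X - _%:P); apply: allx.
  by rewrite ers root_prod_XsubC.
exists (size rs); split.
- move: px; rewrite ers; case: rs {ers ep} => //.
  by rewrite big_nil (negbTE (root1 _)).
- by rewrite -ep => i; rewrite coef_map /=; case: (Rp i).
- move=> q Kq qx.
  have Kp1 : coefs_in K (map_poly fst p) by move=> i; rewrite coef_map /=; case: (Rp i).
  have [a [r [Ka Kr e sr]]] := monic_division KR mp1 Kp1 Kq.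
  have rx : root r x.
    by apply/rootP; move: (rootP qx); rewrite e hornerD hornerM (rootP px) mulr0 add0r.
  suff r0 : r = 0 by rewrite e r0 addr0 -ep dvdp_mull.
  pose D := \poly_(i < size r) (r`_i, r`_i) : {poly Om * Om}.
  have eD : map_poly fst D = r.
    apply/polyP => i; rewrite coef_map /= coef_poly.
    by case: ltnP => //= le; rewrite nth_default.
  have D0 : D = 0.
    apply: minp.
    + move=> i; rewrite coef_poly; case: ifP => _; first by split => //=; exact: Kr.
      by split => //=; exact: (subring0 KR).
    + by rewrite eD.
    + by rewrite (leq_ltn_trans (size_poly _ _)) // -sp1.
  by rewrite -eD D0 rmorph0.
Qed.

(** A power of X - x with exponent at least 2 cannot divide a separable polynomial, so the minimal
    polynomial is X - x. *)
Lemma fixed_separable x (q : {poly Om}) :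
  (forall s : {rmorphism Om -> Om}, (forall c, K c -> s c = c) -> s x = x) ->
  coefs_in K q -> separable_poly q -> root q x -> K x.
Proof.
move=> fx Kq sq qx; have [d [d0 Kd dq]] := fixed_min_poly fx.
have KR := subfield_subring KK.
have d1 : d = 1%N.
  case: d d0 Kd dq => [|[|d]] // _ _ /(_ q Kq qx) dq.
  have : ('X - x%:P) * ('X - x%:P) %| q.
    by apply: dvdp_trans dq; rewrite exprS exprS mulrA dvdp_mulr.
  move/dvdp_separable => /(_ sq); rewrite separable_mul => /and3P[_ _].
  by rewrite coprimepp size_XsubC.
move: Kd; rewrite d1 expr1 => /(_ 0%N); rewrite coefB coefX coefC /= sub0r => Kx.
by rewrite -[x]opprK; apply: (subringN KR).
Qed.

(** If p does not divide d, the coefficient - d x of (X - x)^d yields x. Otherwise (X - x)^d is a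
    polynomial in X^p, and x^p takes the place of x with d divided by p. The power of p accounts for
    inseparability, as Fbar(T) is not perfect. *)
Lemma fixed_pchar x p : p \in [pchar Om] ->
  (forall s : {rmorphism Om -> Om}, (forall c, K c -> s c = c) -> s x = x) ->
  exists e, K (x ^+ (p ^ e)).
Proof.
move=> pch fx; have [d [d0 Kd _]] := fixed_min_poly fx.
have KR := subfield_subring KK.
have pp := pcharf_prime pch.
elim/ltn_ind: d x {fx} d0 Kd => d IH x d0 Kd.
have [pd|npd] := boolP (p %| d)%N; last first.
  exists 0%N; rewrite expn0 expr1.
  have e : ('X - x%:P) ^+ d = \prod_(z <- nseq d x) ('X - z%:P).
    by rewrite big_nseq iter_mulr_1.
  have sd : size (nseq d x) = d by rewrite size_nseq.
  have : K (('X - x%:P) ^+ d)`_(d.-1) by [].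
  rewrite e -{2}sd coefPn_prod_XsubC ?sd -?lt0n // big_nseq iter_addr_0 => Kdx.
  have d0' : d%:R != 0 :> Om by rewrite -(dvdn_pcharf pch).
  have -> : x = - (- (x *+ d)) / d%:R by rewrite opprK -mulr_natr mulfK.
  by apply: subfield_div => //; [exact: (subringN KR)|exact: (subring_nat KR)].
have [d' ed] := dvdnP pd; have d'0 : (0 < d')%N by move: d0; rewrite ed muln_gt0 => /andP[].
have p1 := prime_gt1 pp.
have [|//||e Ke] := IH d' _ (x ^+ p).
- by rewrite ed -{1}[d']muln1 ltn_pmul2l.
- move=> i; have := Kd (p * i)%N.
  have pchP : p \in [pchar {poly Om}] by rewrite pchar_poly.
  have -> : ('X - x%:P) ^+ d = (('X - (x ^+ p)%:P) ^+ d') \Po 'X^p.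
    rewrite ed mulnC exprM rmorphXn /= comp_polyB comp_polyX comp_polyC.
    by rewrite -!(pFrobenius_autE pchP) pFrobenius_autB_comm ?pFrobenius_autE ?polyC_exp //; exact: mulrC.
  by rewrite coef_comp_poly_Xn ?prime_gt0 // dvdn_mulr // mulKn ?prime_gt0.
by exists e.+1; rewrite expnS exprM.
Qed.

End FixedElements.

(** * Valuations and uniformizers *)

Section Valuation.
Variables (Om : fieldType) (W : sset Om).
Hypothesis (HW : valuation_ring W).
Let WW : is_subring W := HW.1.
Implicit Types (x y z : Om) (K : sset Om).

Definition vunit x : Prop := [/\ x != 0, W x & W x^-1].

Lemma valP x : x != 0 -> W x \/ W x^-1. Proof. exact: HW.2. Qed.

Lemma mideal_val x : mideal W x -> W x. Proof. by case. Qed.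
Lemma mideal0 : mideal W 0.
Proof. by split; [exact: (subring0 WW) | rewrite eqxx]. Qed.
Lemma mideal_nunit x : mideal W x -> ~ vunit x.
Proof. by move=> [_ H] [x0 _ /H]; apply. Qed.
Lemma val_cases x : W x -> vunit x \/ mideal W x.
Proof.
move=> Wx; have [[x0 Wx']|n] := pselect (x != 0 /\ W x^-1); first by left; split.
by right; split => // x0 Wx'; apply: n.
Qed.
Lemma nval_mideal x : ~ W x -> x != 0 /\ mideal W x^-1.
Proof.
move=> nW; have x0 : x != 0 by apply/eqP => e; apply: nW; rewrite e; exact: (subring0 WW).
split => //; split; first by case: (valP x0).
by rewrite invrK.
Qed.
Lemma vunit1 : vunit 1.
Proof. by split; rewrite ?oner_neq0 ?invr1 //; exact: (subring1 WW). Qed.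
Lemma vunitM x y : vunit x -> vunit y -> vunit (x * y).
Proof.
move=> [x0 Wx Wx'] [y0 Wy Wy']; split; rewrite ?mulf_neq0 ?invfM //; exact: (subringM WW).
Qed.
Lemma vunitV x : vunit x -> vunit x^-1.
Proof. by move=> [x0 Wx Wx']; split; rewrite ?invr_eq0 ?invrK. Qed.
Lemma vunitV' x : vunit x^-1 -> vunit x.
Proof. by move/vunitV; rewrite invrK. Qed.
Lemma vunit_div x y : vunit x -> vunit y -> vunit (x / y).
Proof. by move=> ux uy; apply: vunitM => //; apply: vunitV. Qed.
Lemma vunitN x : vunit x -> vunit (- x).
Proof.
by move=> [x0 Wx Wx']; split; rewrite ?oppr_eq0 ?invrN //; exact: (subringN WW).
Qed.
Lemma vunitX x n : vunit x -> vunit (x ^+ n).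
Proof.
by move=> ux; elim: n => [|n IH]; rewrite ?expr0 ?exprS; [exact: vunit1|exact: vunitM].
Qed.
Lemma vunitXz x (i : int) : vunit x -> vunit (x ^ i).
Proof.
by move=> ux; case: i => n; rewrite ?NegzE -?exprnN -?exprnP; [|apply: vunitV]; apply: vunitX.
Qed.
Lemma vunit_prod (I : Type) (r : seq I) (P : pred I) (f : I -> Om) :
  (forall i, P i -> vunit (f i)) -> vunit (\prod_(i <- r | P i) f i).
Proof. by move=> uf; apply: big_ind => //; [exact: vunit1|exact: vunitM]. Qed.
Lemma vunit_neq0 x : vunit x -> x != 0. Proof. by case. Qed.
Lemma vunit_val x : vunit x -> W x. Proof. by case. Qed.
Lemma vunit_nmideal x : vunit x -> ~ mideal W x.
Proof. by move=> ux /mideal_nunit. Qed.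

Lemma midealM x y : mideal W x -> W y -> mideal W (x * y).
Proof.
move=> [Wx nx] Wy; split; first exact: (subringM WW).
rewrite mulf_eq0 negb_or => /andP[x0 y0] H; apply: (nx x0).
have -> : x^-1 = y * (x * y)^-1 by rewrite invfM mulrCA mulfV ?mulr1.
exact: (subringM WW).
Qed.
Lemma midealMl x y : mideal W x -> W y -> mideal W (y * x).
Proof. by rewrite mulrC; exact: midealM. Qed.
Lemma midealN x : mideal W x -> mideal W (- x).
Proof. by move=> mx; rewrite -mulrN1; apply: midealM => //; apply/(subringN WW)/(subring1 WW). Qed.
Lemma midealD x y : mideal W x -> mideal W y -> mideal W (x + y).
Proof.
move=> mx my; have [->|x0] := eqVneq x 0; first by rewrite add0r.
have [->|y0] := eqVneq y 0; first by rewrite addr0.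
have H a b : a != 0 -> mideal W a -> W (b / a) -> mideal W (a + b).
  move=> a0 ma Wb; have -> : a + b = a * (1 + b / a) by rewrite mulrDr mulr1 mulrC divfK.
  by apply: midealM => //; apply: (subringD WW) => //; exact: (subring1 WW).
have [Wyx|] := valP (x := y / x) (mulf_neq0 y0 (invr_neq0 x0)); first exact: H.
by rewrite invfM invrK mulrC => Wxy; rewrite addrC; apply: H => //.
Qed.
Lemma midealB x y : mideal W x -> mideal W y -> mideal W (x - y).
Proof. by move=> mx my; apply: midealD => //; apply: midealN. Qed.
Lemma mideal_sum (I : Type) (r : seq I) (P : pred I) (f : I -> Om) :
  (forall i, P i -> mideal W (f i)) -> mideal W (\sum_(i <- r | P i) f i).
Proof. by move=> mf; apply: big_ind => //; [exact: mideal0|exact: midealD]. Qed.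
Lemma vunitD x y : vunit x -> mideal W y -> vunit (x + y).
Proof.
move=> ux my; case: (val_cases (subringD WW (vunit_val ux) (mideal_val my))) => // m.
by case: (vunit_nmideal ux); rewrite -(addrK y x); apply: midealB.
Qed.
Lemma vunit_cong x y : vunit x -> mideal W (x - y) -> vunit y.
Proof. by move=> ux m; rewrite -[y](subKr x); apply: vunitD ux (midealN m). Qed.
Lemma mideal_mul x y : W x -> W y -> mideal W (x * y) -> mideal W x \/ mideal W y.
Proof.
move=> /val_cases[ux|]; last by left.
move=> /val_cases[uy|]; last by right.
by move/mideal_nunit; case; apply: vunitM.
Qed.
Lemma mideal_prod (s : seq Om) : (forall x, x \in s -> W x) ->
  mideal W (\prod_(x <- s) x) -> exists2 x, x \in s & mideal W x.
Proof.
elim: s => [|x s IH] Ws; first by rewrite big_nil => /mideal_nunit[]; exact: vunit1.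
rewrite big_cons => /mideal_mul[].
- by apply: Ws; rewrite mem_head.
- rewrite big_seq; apply: (subring_prod WW) => y ys; apply: Ws.
  by rewrite inE ys orbT.
- by exists x; rewrite ?mem_head.
- by move/IH => [y ys|y ys my]; [apply: Ws; rewrite inE ys orbT|exists y; rewrite ?inE ?ys ?orbT].
Qed.
Lemma val_root x n : (0 < n)%N -> W (x ^+ n) -> W x.
Proof.
case: n => // n _ Wx; apply: contrapT => /nval_mideal[x0 m].
have : mideal W (x^-1 * (x^-1 ^+ n * x ^+ n.+1)).
  apply: midealM => //; apply: (subringM WW) => //.
  exact/(subringX WW)/mideal_val.
rewrite mulrA -exprS exprVn mulVf ?expf_neq0 // => /mideal_nunit; apply; exact: vunit1.
Qed.
Lemma vunit_root x n : (0 < n)%N -> vunit (x ^+ n) -> vunit x.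
Proof.
move=> n0 [x0 Wx Wx']; rewrite expf_eq0 n0 /= in x0; split => //; first exact: val_root Wx.
by apply: (val_root n0); rewrite exprVn.
Qed.
Lemma vunit_mull x y : vunit x -> vunit (x * y) -> vunit y.
Proof.
move=> ux uxy; have -> : y = x^-1 * (x * y) by rewrite mulKf //; exact: vunit_neq0.
by apply: vunitM => //; apply: vunitV.
Qed.
Lemma vunit_mulr x y : vunit y -> vunit (x * y) -> vunit x.
Proof. by rewrite mulrC; exact: vunit_mull. Qed.

Lemma mideal_congM x x' y y' : W x -> W y' -> mideal W (x - x') -> mideal W (y - y') ->
  mideal W (x * y - x' * y').
Proof.
move=> Wx Wy' m m'; have -> : x * y - x' * y' = (y - y') * x + (x - x') * y' by ring.
by apply: midealD; apply: midealM.
Qed.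
Lemma mideal_congV x y : vunit x -> vunit y -> mideal W (x - y) -> mideal W (x^-1 - y^-1).
Proof.
move=> ux uy m.
have -> : x^-1 - y^-1 = - (x - y) * (x^-1 * y^-1).
  by field; rewrite (vunit_neq0 ux) (vunit_neq0 uy).
apply: midealM; first exact: midealN.
by apply: vunit_val; apply: vunitM; apply: vunitV.
Qed.
Lemma mideal_congX x y n : W x -> W y -> mideal W (x - y) -> mideal W (x ^+ n - y ^+ n).
Proof.
move=> Wx Wy m; elim: n => [|n IH]; first by rewrite !expr0 subrr; exact: mideal0.
by rewrite !exprS; apply: mideal_congM => //; exact: (subringX WW).
Qed.
Lemma mideal_congH p x y : coefs_in W p -> W x -> W y -> mideal W (x - y) ->
  mideal W (p.[x] - p.[y]).
Proof.
move=> Wp Wx Wy m; rewrite !horner_coef -sumrB; apply: mideal_sum => i _.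
by rewrite -mulrBr; apply: midealMl => //; apply: mideal_congX.
Qed.

Definition vone x : Prop := mideal W (x - 1).
Lemma vone_unit x : vone x -> vunit x.
Proof. by move=> /(vunitD vunit1); rewrite addrC subrK. Qed.
Lemma vone1 : vone 1. Proof. by rewrite /vone subrr; exact: mideal0. Qed.
Lemma voneM x y : vone x -> vone y -> vone (x * y).
Proof.
move=> ox oy; rewrite /vone -[X in _ - X](mul1r 1); apply: mideal_congM => //.
  by apply: vunit_val; apply: vone_unit.
exact: (subring1 WW).
Qed.
Lemma voneV x : vone x -> vone x^-1.
Proof.
move=> ox; rewrite /vone -[X in _ - X]invr1; apply: mideal_congV => //; last exact: vunit1.
exact: vone_unit.
Qed.
Lemma voneX x n : vone x -> vone (x ^+ n).
Proof. by move=> ox; elim: n => [|n IH]; rewrite ?expr0 ?exprS; [exact: vone1|exact: voneM]. Qed.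
Lemma voneXz x (i : int) : vone x -> vone (x ^ i).
Proof.
by move=> ox; case: i => n; rewrite ?NegzE -?exprnN -?exprnP; [|apply: voneV]; apply: voneX.
Qed.
Lemma vone_prod (I : Type) (r : seq I) (P : pred I) (f : I -> Om) :
  (forall i, P i -> vone (f i)) -> vone (\prod_(i <- r | P i) f i).
Proof. by move=> uf; apply: big_ind => //; [exact: vone1|exact: voneM]. Qed.

(* A generator of the value group of K, which is thereby infinite cyclic. *)
Definition uniformizer K (pi : Om) : Prop :=
  [/\ K pi, pi != 0, mideal W pi & forall x, K x -> x != 0 -> exists i : int, vunit (x / pi ^ i)].

Lemma mideal_Xz pi (i : int) : mideal W pi -> 0 < i -> mideal W (pi ^ i).
Proof.
move=> m; case: i => // -[//|n] _; rewrite -exprnP exprS; apply: midealM => //.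
exact/(subringX WW)/mideal_val.
Qed.

Lemma val_Xz pi (i : int) : pi != 0 -> mideal W pi -> W (pi ^ i) -> 0 <= i.
Proof.
move=> pi0 m Wi; rewrite leNgt; apply/negP => lt.
have : mideal W (pi ^ (- i)) by apply: mideal_Xz => //; rewrite oppr_gt0.
move=> [_]; rewrite -invr_expz invrK; apply => //.
by rewrite invr_eq0 expfz_neq0.
Qed.

Lemma mideal_Xz_gt0 pi (i : int) : pi != 0 -> mideal W pi -> mideal W (pi ^ i) -> 0 < i.
Proof.
move=> pi0 m mi; rewrite lt_neqAle (val_Xz pi0 m (mideal_val mi)) andbT.
by apply/negP => /eqP e; apply: (mideal_nunit mi); rewrite -e; exact: vunit1.
Qed.

Lemma vunit_Xz pi (i : int) : pi != 0 -> mideal W pi -> vunit (pi ^ i) -> i = 0.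
Proof.
move=> pi0 m [_ Wi Wi']; apply/eqP; rewrite eq_le (val_Xz pi0 m Wi) andbT.
by rewrite -oppr_ge0; apply: (val_Xz pi0 m); rewrite -invr_expz.
Qed.

Lemma vunit_Xz_inj pi x (i j : int) : pi != 0 -> mideal W pi ->
  vunit (x / pi ^ i) -> vunit (x / pi ^ j) -> i = j.
Proof.
move=> pi0 m ui uj; apply/eqP; rewrite -subr_eq0; apply/eqP/(vunit_Xz pi0 m).
have x0 : x != 0 by apply: contraTneq (vunit_neq0 ui) => ->; rewrite mul0r eqxx.
have := vunit_div uj ui.
have -> : x / pi ^ j / (x / pi ^ i) = pi ^ i / pi ^ j by field; rewrite ?expfz_neq0 ?x0.
by rewrite invr_expz -expfzDr.
Qed.

Lemma uniformizer_val K pi x : uniformizer K pi -> K x -> mideal W x -> W (x / pi).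
Proof.
move=> [Kpi pi0 m H] Kx mx; have [->|x0] := eqVneq x 0; first by rewrite mul0r; exact: (subring0 WW).
have [i ui] := H _ Kx x0.
have ei : x = (x / pi ^ i) * pi ^ i by rewrite divfK // expfz_neq0.
have mi : mideal W (pi ^ i).
  have -> : pi ^ i = x * (x / pi ^ i)^-1 by rewrite invfM invrK mulrA mulfV ?mul1r.
  by apply: midealM => //; apply: vunit_val; apply: vunitV.
have i0 := mideal_Xz_gt0 pi0 m mi.
rewrite ei -mulrA; apply: (subringM WW); first exact: vunit_val.
have -> : pi ^ i / pi = pi ^ (i - 1) by rewrite expfzDr // exprN1.
have : 0 <= i - 1 by lia.
by case: (i - 1) => // n _; apply/(subringX WW)/mideal_val.
Qed.

Lemma uniformizer_clear K pi p : is_subfield K -> uniformizer K pi -> coefs_in K p ->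
  exists N : nat, coefs_in (fun x => K x /\ W x) ((pi ^+ N)%:P * p).
Proof.
move=> KK [Kpi pi0 m H]; elim/poly_ind: p => [|p c IH] Kp.
  exists 0%N => i; rewrite mulr0 coef0; split; first exact: (subring0 (subfield_subring KK)).
  exact: (subring0 WW).
have [N HN] : exists N : nat, coefs_in (fun x => K x /\ W x) ((pi ^+ N)%:P * p).
  by apply: IH => i; have := Kp i.+1; rewrite coefD coefMX coefC /= addr0.
have Kc : K c by have := Kp 0%N; rewrite coefD coefMX coefC /= add0r.
have [N' HN'] : exists N' : nat, W (pi ^+ N' * c).
  have [->|c0] := eqVneq c 0; first by exists 0%N; rewrite mulr0; exact: (subring0 WW).
  have [i ui] := H _ Kc c0; exists `|i|%N.
  have -> : pi ^+ `|i|%N * c = pi ^ (`|i|%N%:Z + i) * (c / pi ^ i).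
    by rewrite expfzDr // -exprnP mulrCA -!mulrA mulfV ?expfz_neq0 // mulr1 mulrC.
  apply: (subringM WW); last exact: vunit_val.
  have : 0 <= `|i|%N%:Z + i by lia.
  by case: (_ + _) => // n _; apply/(subringX WW)/mideal_val.
exists (N + N')%N => i; rewrite coefCM coefD coefMX coefC; split.
  apply: (subringM (subfield_subring KK)); first exact: (subringX (subfield_subring KK)).
  by have := Kp i; rewrite coefD coefMX coefC.
case: i => [|i] /=.
  rewrite add0r exprD -mulrA; apply: (subringM WW) => //.
  exact/(subringX WW)/mideal_val.
rewrite addr0 exprD mulrAC mulrC; apply: (subringM WW); first exact/(subringX WW)/mideal_val.
by have [_] := HN i; rewrite coefCM.
Qed.

(** The inverse of x is a polynomial in x over K, and a power of pi makes its coefficients integral.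
    No nonzero element of Om is thus smaller than all powers of pi, and this is what makes repeated
    divisions by pi stop. *)
Lemma archimedean K pi x : is_subfield K -> algebraic_over K -> uniformizer K pi ->
  x != 0 -> exists N : nat, W (pi ^+ N / x).
Proof.
move=> KK aK uK x0; have [Wx|nWx] := pselect (W x); last first.
  have [_ /mideal_val Wx'] := nval_mideal nWx; exists 0%N.
  by rewrite expr0 mul1r.
have [p Kp e] := algebraic_inverse KK aK x0.
have [N HN] := uniformizer_clear KK uK Kp; exists N.
have -> : pi ^+ N / x = ((pi ^+ N)%:P * p).[x].
  by rewrite hornerM hornerC -[p.[x]](mulKf x0) e mulr1.
by apply: (coefs_in_horner WW) => // i; case: (HN i).
Qed.

Lemma eq_of_deep_cong K pi x : is_subfield K -> algebraic_over K -> uniformizer K pi ->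
  (forall N : nat, W (x / pi ^+ N)) -> x = 0.
Proof.
move=> KK aK uK H; apply/eqP/negP => /negP x0.
have [N WN] := archimedean KK aK uK x0; have [_ pi0 m _] := uK.
have : mideal W (pi * (x / pi ^+ N.+1 * (pi ^+ N / x))).
  by apply: midealM => //; apply: (subringM WW).
have -> : pi * (x / pi ^+ N.+1 * (pi ^+ N / x)) = 1.
  by rewrite exprS; field; rewrite x0 pi0 expf_neq0.
by move/mideal_nunit; apply; exact: vunit1.
Qed.

End Valuation.

(** * Unramified and totally ramified extensions *)

Section Adjoin.
Variables (Om : fieldType) (W : sset Om).
Hypothesis (HW : valuation_ring W).
Let WW : is_subring W := HW.1.
Variables (K0 K : sset Om).
Hypotheses (KK0 : is_subfield K0) (aK0 : algebraic_over K0).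
Hypotheses (KK : is_subfield K) (K0K : ssub K0 K).
Let KR := subfield_subring KK.
Let aK : algebraic_over K := algebraic_overS K0K aK0.
Variable pi : Om.
Hypothesis (uK : uniformizer W K pi).
Let pi0 : pi != 0. Proof. by case: uK. Qed.
Let mpi : mideal W pi. Proof. by case: uK. Qed.
Let Kpi : K pi. Proof. by case: uK. Qed.

Local Notation OK := (fun x => K x /\ W x).

Lemma val_subring : is_subring (OK : Om -> Prop).
Proof.
split; first by split; [exact: (subring1 KR)|exact: (subring1 WW)].
  by move=> x y [Kx Wx] [Ky Wy]; split; [exact: (subringB KR)|exact: (subringB WW)].
by move=> x y [Kx Wx] [Ky Wy]; split; [exact: (subringM KR)|exact: (subringM WW)].
Qed.

Let OKR := val_subring.

Lemma val_horner p u : coefs_in OK p -> W u -> W p.[u].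
Proof. by move=> Op Wu; apply: (coefs_in_horner WW) => // i; case: (Op i). Qed.

Lemma adjoin1_frac u x : W u -> adjoin1 K u x -> exists (A : {poly Om}) (N : nat),
  coefs_in OK A /\ x = A.[u] / pi ^+ N.
Proof.
move=> Wu /(adjoin1_poly KK0 aK0 KK K0K)[p Kp ->].
have [N HN] := uniformizer_clear HW KK uK Kp.
exists ((pi ^+ N)%:P * p), N; split => //.
by rewrite hornerM hornerC mulrC mulKf // expf_neq0.
Qed.

(* With h1 a lift of the minimal polynomial of the residue of u, h = Q h1 + pi R1 and
   Q(u) is a unit, so that Q(u) times any non-unit of O_K[u] lies in pi O_K[u]. *)
Lemma etale_adjoin (h : {poly Om}) u : W u -> coefs_in OK h -> h \is monic ->
  h.[u] = 0 -> vunit W h^`().[u] ->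
  forall x, adjoin1 K u x -> x != 0 -> exists z (A B : {poly Om}),
    [/\ K z, coefs_in OK A /\ coefs_in OK B, vunit W A.[u], vunit W B.[u] & x = z * A.[u] / B.[u]].
Proof.
move=> Wu Oh mh hu uh'.
pose P n := `[< exists h1 : {poly Om}, [/\ h1 \is monic, coefs_in OK h1, mideal W h1.[u] & size h1 = n] >].
have exP : exists n, P n.
  by exists (size h); apply/asboolP; exists h; split => //; rewrite hu; exact: mideal0.
case: (ex_minnP exP) => n /asboolP[h1 [mh1 Oh1 mu1 sh1]] minn.
have cl1 R : coefs_in OK R -> (size R < size h1)%N -> mideal W R.[u] -> forall i, mideal W R`_i.
  have [k] := ubnP (size R); elim: k R => // k IH R; rewrite ltnS => sk OR sR mR.
  have [R0|R0] := eqVneq R 0; first by move=> i; rewrite R0 coef0; exact: mideal0.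
  have [Kc Wc] := OR (size R).-1; rewrite -/(lead_coef R) in Kc Wc.
  have [uc|mc] := val_cases Wc.
    have Oc : OK (lead_coef R)^-1.
      by split; [exact: subfieldV|apply: vunit_val; exact: vunitV].
    have : P (size R).
      apply/asboolP; exists ((lead_coef R)^-1%:P * R); split.
      - by rewrite monicE lead_coefM lead_coefC mulVf // lead_coef_eq0.
      - by apply: (coefs_inM OKR) => //; apply: (coefs_inC OKR).
      - by rewrite hornerM hornerC; apply: midealMl => //; case: Oc.
      - by rewrite size_Cmul // invr_eq0 lead_coef_eq0.
    by move=> /minn; rewrite -sh1 leqNgt sR.
  have s0 : (0 < size R)%N by rewrite size_poly_gt0.
  pose m := (lead_coef R)%:P * 'X^((size R).-1) : {poly Om}.
  have sRm : (size (R - m)%R <= (size R).-1)%N.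
    apply/leq_sizeP => j; rewrite leq_eqVlt coefB coefCM coefXn => /orP[/eqP<-|lt].
      by rewrite eqxx mulr1 -/(lead_coef R) subrr.
    rewrite gtn_eqF // mulr0 subr0 nth_default //.
    by rewrite -(prednK s0).
  have ORm : coefs_in OK (R - m).
    apply: (coefs_inB OKR) => //; apply: (coefs_inM OKR); first exact: (coefs_inC OKR).
    exact: (subringX (coefs_subring OKR) _ (coefs_inX OKR)).
  have sk' : (size (R - m)%R < k)%N by apply: leq_ltn_trans sRm _; rewrite prednK.
  have lt : (size (R - m)%R < size h1)%N.
    by apply: leq_ltn_trans sRm _; apply: leq_ltn_trans sR; exact: leq_pred.
  have mu : mideal W (R - m).[u].
    rewrite hornerD hornerN; apply: midealB => //; rewrite hornerM hornerC hornerXn.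
    by apply: midealM => //; apply: (subringX WW).
  move=> i; have := IH _ sk' ORm lt mu i; rewrite coefB coefCM coefXn => mi.
  rewrite -(subrK (lead_coef R * (i == (size R).-1)%:R) R`_i); apply: midealD => //.
  by apply: midealM => //; exact: (subring_nat WW).
have cl2 R : coefs_in OK R -> (forall i, mideal W R`_i) ->
    exists2 R', coefs_in OK R' & R = pi%:P * R'.
  move=> OR mR; exists (pi^-1%:P * R); last by rewrite mulrA -polyCM mulfV // mul1r.
  move=> i; rewrite coefCM; split; first by apply: (subringM KR); [exact: subfieldV|case: (OR i)].
  by rewrite mulrC; apply: (uniformizer_val HW uK) => //; case: (OR i).
have [Q [R [OQ OR eh sR]]] := monic_division OKR mh1 Oh1 Oh.
have Q1u : W Q.[u] by apply: val_horner.
have [R1 OR1 eR] : exists2 R1, coefs_in OK R1 & R = pi%:P * R1.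
  apply: cl2 => //; apply: cl1 => //.
  have -> : R.[u] = - (Q.[u] * h1.[u]).
    by apply/eqP; rewrite -addr_eq0 addrC -hornerM -hornerD -eh hu.
  by apply: midealN => //; apply: midealMl.
have uQ : vunit W Q.[u].
  have H : vunit W (Q.[u] * h1^`().[u] + (Q^`().[u] * h1.[u] + pi * R1^`().[u])).
    rewrite (_ : _ + _ = h^`().[u]) // eh eR derivD !derivM derivC.
    by rewrite !(hornerD, hornerM, hornerC); ring.
  have Wd p : coefs_in OK p -> W p^`().[u].
    by move=> Op; apply: val_horner => //; apply: (coefs_in_deriv OKR).
  have m : mideal W (Q^`().[u] * h1.[u] + pi * R1^`().[u]).
    by apply: midealD => //; [apply: midealMl => //; exact: Wd|apply: midealM => //; exact: Wd].
  have {}H := vunitD HW H (midealN HW m); rewrite addrK in H.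
  case: (val_cases Q1u) => // mQ; case: (vunit_nmideal H); apply: midealM => //; exact: Wd.
have eQ : h1.[u] * Q.[u] = - (pi * R1.[u]).
  by apply/eqP; rewrite -addr_eq0 mulrC -hornerM -[pi](hornerC pi u) -hornerM -eR -hornerD -eh hu.
(* Modulo h1 the polynomial A reduces to pi r', and Q(u) h1(u) = - pi R1(u) turns the rest into a
   multiple of pi. *)
have cl3 A : coefs_in OK A -> mideal W A.[u] ->
    exists2 A', coefs_in OK A' & A.[u] * Q.[u] = pi * A'.[u].
  move=> OA mA; have [a [r [Oa Or eA sr]]] := monic_division OKR mh1 Oh1 OA.
  have [r' Or' er] : exists2 r', coefs_in OK r' & r = pi%:P * r'.
    apply: cl2 => //; apply: cl1 => //.
    have -> : r.[u] = A.[u] - a.[u] * h1.[u] by rewrite eA hornerD hornerM addrAC subrr add0r.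
    by apply: midealB => //; apply: midealMl => //; apply: val_horner.
  exists (r' * Q - a * R1).
    by apply: (coefs_inB OKR); apply: (coefs_inM OKR).
  rewrite eA er !(hornerD, hornerN, hornerM, hornerC) mulrDl -[X in X + _]mulrA eQ.
  by ring.
(* Each non-unit A(u) gives off a factor pi at the price of a factor Q(u); the bound N, provided by
   [archimedean], makes this stop. *)
have cl4 N A : coefs_in OK A -> A.[u] != 0 -> W (pi ^+ N / A.[u]) ->
    exists (j : nat) A', [/\ coefs_in OK A', vunit W A'.[u] & A.[u] * Q.[u] ^+ j = pi ^+ j * A'.[u]].
  elim: N A => [|N IH] A OA A0 WA.
    exists 0%N, A; rewrite !expr0 mulr1 mul1r; split => //.
    by rewrite expr0 mul1r in WA; split => //; apply: val_horner.
  have [uA|mA] := val_cases (val_horner OA Wu).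
    by exists 0%N, A; rewrite !expr0 mulr1 mul1r; split.
  have [A' OA' eA'] := cl3 A OA mA.
  have A'0 : A'.[u] != 0.
    have := mulf_neq0 A0 (vunit_neq0 uQ).
    by rewrite eA' mulf_eq0 negb_or => /andP[].
  have [|j [A'' [OA'' uA'' e]]] := IH A' OA' A'0.
    have -> : pi ^+ N / A'.[u] = pi ^+ N.+1 / A.[u] * (Q.[u])^-1.
      by rewrite -mulrA -invfM eA' exprS invfM mulrA [pi * _]mulrC mulfK.
    by apply: (subringM WW) => //; exact: (vunit_val (vunitV uQ)).
  exists j.+1, A''; split => //.
  by rewrite !exprS [LHS]mulrA eA' -[LHS]mulrA e mulrA.
move=> x Kx x0; have [A [N [OA ex]]] := adjoin1_frac Wu Kx.
have A0 : A.[u] != 0 by apply: contraNneq x0 => A0; rewrite ex A0 mul0r.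
have [M WM] := archimedean HW KK aK uK A0.
have [j [A' [OA' uA' e]]] := cl4 M A OA A0 WM.
exists (pi ^+ j / pi ^+ N), A', (Q ^+ j); split => //.
- by apply: subfield_div => //; apply: (subringX KR).
- by split => //; apply: (subringX (coefs_subring OKR)).
- by rewrite horner_exp; apply: vunitX.
- rewrite ex horner_exp; apply: (mulIf (expf_neq0 j (vunit_neq0 uQ))).
  rewrite divfK ?expf_neq0 ?(vunit_neq0 uQ) //.
  by rewrite mulrAC e mulrAC.
Qed.

(** For a field C inside L and W this says that C is mapped onto the residue field of L; elements of
    the maximal ideal have residue 0 anyway. *)
Definition residues_in (C : sset Om) (L : sset Om) : Prop :=
  forall x, L x -> vunit W x -> exists2 c, C c & mideal W (x - c).

Section Etale.
Variables (h : {poly Om}) (u : Om).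
Hypotheses (Wu : W u) (Oh : coefs_in OK h) (mh : h \is monic) (hu : h.[u] = 0)
  (uh' : vunit W h^`().[u]).

Lemma uniformizer_etale : uniformizer W (adjoin1 K u) pi.
Proof.
split => //; first exact: sub_adjoin1.
move=> x Kx x0; have [z [A [B [Kz _ uA uB ex]]]] := etale_adjoin Wu Oh mh hu uh' Kx x0.
have z0 : z != 0 by apply: contraNneq x0 => z0; rewrite ex z0 !mul0r.
have [_ _ _ /(_ z Kz z0)[i ui]] := uK; exists i.
have -> : x / pi ^ i = z / pi ^ i * (A.[u] / B.[u]) by rewrite ex -!mulrA; congr (_ * _); rewrite [RHS]mulrC -!mulrA.
by apply: vunitM => //; apply: vunit_div.
Qed.

(** In the form z A(u) / B(u) of an element, u may be replaced by c modulo the maximal ideal, and z,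
    A(c), B(c) are elements of K. *)
Lemma residues_etale C c : is_subfield C -> ssub C W -> ssub C K -> C c ->
  mideal W (u - c) -> residues_in C K -> residues_in C (adjoin1 K u).
Proof.
move=> CC CW CK Cc muc rK x Kx ux.
have [z [A [B [Kz [OA OB] uA uB ex]]]] := etale_adjoin Wu Oh mh hu uh' Kx (vunit_neq0 ux).
have CR := subfield_subring CC.
have res D : coefs_in OK D -> vunit W D.[u] -> exists2 d, C d & mideal W (D.[u] - d).
  move=> OD uD; have m : mideal W (D.[u] - D.[c]).
    by apply: mideal_congH => //; [move=> i; case: (OD i)|exact: CW].
  have uDc := vunit_cong HW uD m.
  have [|d Cd md] := rK D.[c] _ uDc.
    by apply: (coefs_in_horner KR); [move=> i; case: (OD i)|exact: CK].
  by exists d => //; rewrite -(subrKA D.[c]); apply: midealD.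
have [a Ca ma] := res A OA uA; have [b Cb mb] := res B OB uB.
have uz : vunit W z.
  have : vunit W (z * (A.[u] / B.[u])) by rewrite mulrA -ex.
  by apply: vunit_mulr => //; apply: vunit_div.
have [d Cd md] := rK z Kz uz.
exists (d * a / b).
  by apply: subfield_div => //; apply: (subringM CR).
have ub := vunit_cong HW uB mb.
rewrite ex; apply: mideal_congM => //.
- exact: (vunit_val (vunitM HW uz uA)).
- exact: (vunit_val (vunitV ub)).
- by apply: mideal_congM => //; [exact: vunit_val|exact: CW].
- exact: mideal_congV.
Qed.

End Etale.

Section Kummer.
Variables (u : Om) (M : nat).
Hypotheses (uu : vunit W u) (KuM : K (u ^+ M)) (uM : vunit W M%:R).

Let M0 : (0 < M)%N. Proof. by case: (posnP M) (vunit_neq0 uM) => // ->; rewrite eqxx. Qed.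
Let h := 'X^M - (u ^+ M)%:P : {poly Om}.
Let Oh : coefs_in OK h.
Proof.
apply: (coefs_inB OKR); first exact: (subringX (coefs_subring OKR) _ (coefs_inX OKR)).
by apply: (coefs_inC OKR); split => //; apply: (subringX WW); exact: vunit_val.
Qed.
Let mh : h \is monic. Proof. exact: monicXnsubC. Qed.
Let hu : h.[u] = 0. Proof. by rewrite /h hornerD hornerN hornerXn hornerC subrr. Qed.
Let uh' : vunit W h^`().[u].
Proof.
rewrite /h derivB derivXn derivC subr0 hornerMn hornerXn -mulr_natr.
by apply: vunitM => //; apply: vunitX.
Qed.

Lemma uniformizer_kummer : uniformizer W (adjoin1 K u) pi.
Proof. exact: uniformizer_etale (vunit_val uu) Oh mh hu uh'. Qed.

Lemma residues_kummer C c : is_subfield C -> ssub C W -> ssub C K -> C c ->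
  mideal W (u - c) -> residues_in C K -> residues_in C (adjoin1 K u).
Proof.
by move=> CC CW CK Cc m; apply: (residues_etale (vunit_val uu) Oh mh hu uh' CC CW CK Cc m).
Qed.

End Kummer.

Section TotallyRamified.
Variables (w : Om) (N : nat).
Hypotheses (N0 : (0 < N)%N) (ew : w ^+ N = pi).

Let w0 : w != 0.
Proof. by apply: contraNneq pi0 => w0; rewrite -ew w0 expr0n gtn_eqF. Qed.
Let mw : mideal W w.
Proof.
have Ww : W w by apply: (val_root HW N0); rewrite ew; exact: mideal_val.
case: (val_cases Ww) => // uw; case: (mideal_nunit mpi); rewrite -ew; exact: vunitX.
Qed.

Let wNe (e : int) : w ^ (N%:Z * e) = pi ^ e.
Proof. by rewrite -exprz_exp -exprnP ew. Qed.

(** Measured in w, the nonzero terms p_j w^j have orders N e + j, which differ modulo N; a unique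
    term of smallest order therefore dominates the sum. The first alternative is that all
    coefficients vanish. *)
Lemma dominant_term (p : {poly Om}) n : coefs_in K p -> (n <= N)%N ->
  (forall i, (i < n)%N -> p`_i = 0) \/
  exists (i : nat) (e : int), [/\ (i < n)%N,
    vunit W ((\sum_(j < n) p`_j * w ^+ j) / w ^ (N%:Z * e + i%:Z)) &
    forall j, (j < n)%N -> W (p`_j * w ^+ j / w ^ (N%:Z * e + i%:Z))].
Proof.
move=> Kp; elim: n => [|n IH] le; first by left.
have term : p`_n != 0 -> exists e : int, vunit W (p`_n * w ^+ n / w ^ (N%:Z * e + n%:Z)).
  move=> pn0; have [_ _ _ /(_ _ (Kp n) pn0)[e ue]] := uK; exists e.
  by rewrite expfzDr // wNe invfM -exprnP mulrACA mulfV ?expf_neq0 // mulr1.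
have [pn0|pn0] := eqVneq p`_n 0.
  case: (IH (ltnW le)) => [z|[i [e [lt u H]]]].
    by left=> i; rewrite ltnS leq_eqVlt => /orP[/eqP->|/z].
  right; exists i, e; split; first exact: ltnW.
    by rewrite big_ord_recr /= pn0 mul0r addr0.
  move=> j; rewrite ltnS leq_eqVlt => /orP[/eqP->|/H//].
  by rewrite pn0 !mul0r; exact: (subring0 WW).
right; have [e' ue'] := term pn0.
case: (IH (ltnW le)) => [z|[i [e [lt u H]]]].
  exists n, e'; split => //.
    by rewrite big_ord_recr /= big1 ?add0r // => j _; rewrite z ?mul0r.
  move=> j; rewrite ltnS leq_eqVlt => /orP[/eqP->|/z->]; first exact: vunit_val.
  by rewrite !mul0r; exact: (subring0 WW).
set a := N%:Z * e + i%:Z in u H; set b := N%:Z * e' + n%:Z in ue'.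
have neq : a != b.
  apply/eqP => eab; have : (a %% N%:Z)%Z = (b %% N%:Z)%Z by rewrite eab.
  rewrite /a /b !(mulrC N%:Z) !modzMDl !modz_nat !modn_small //; last exact: ltn_trans lt le.
  by move=> [ein]; move: lt; rewrite ein ltnn.
have shift x c d : x / w ^ c = (x / w ^ d) * w ^ (d - c).
  rewrite expfzDr // mulrA divfK ?expfz_neq0 //.
  by rewrite -invr_expz.
case: (ltrgtP a b) neq => // [lt_ab|lt_ba] _.
  have mb : mideal W (p`_n * w ^+ n / w ^ a).
    rewrite (shift _ a b); apply: midealMl => //; last exact: vunit_val.
    by apply: mideal_Xz => //; rewrite subr_gt0.
  exists i, e; rewrite -/a; split; first exact: ltnW.
    by rewrite big_ord_recr /= mulrDl; apply: vunitD.
  by move=> j; rewrite ltnS leq_eqVlt => /orP[/eqP->|/H//]; exact: mideal_val.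
have mS x : W (x / w ^ a) -> mideal W (x / w ^ b).
  move=> Wx; rewrite (shift _ b a); apply: midealMl => //.
  by apply: mideal_Xz => //; rewrite subr_gt0.
exists n, e'; rewrite -/b; split => //.
  rewrite big_ord_recr /= mulrDl addrC; apply: vunitD => //; apply: mS; exact: vunit_val.
move=> j; rewrite ltnS leq_eqVlt => /orP[/eqP->|/H/mS/mideal_val//]; exact: vunit_val.
Qed.

Let adjoin_poly x : adjoin1 K w x -> exists2 p : {poly Om}, coefs_in K p &
  x = \sum_(j < N) p`_j * w ^+ j.
Proof.
move=> /(adjoin1_poly KK0 aK0 KK K0K)[q Kq ->].
have Kg : coefs_in K ('X^N - pi%:P).
  apply: (coefs_inB KR); last exact: (coefs_inC KR).
  exact: (subringX (coefs_subring KR) _ (coefs_inX KR)).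
have [a [r [Ka Kr e sr]]] := monic_division KR (monicXnsubC pi N0) Kg Kq.
exists r => //; rewrite e !(hornerD, hornerM, hornerN, hornerXn, hornerC) ew subrr mulr0 add0r.
by apply: horner_coef_wide; move: sr; rewrite size_XnsubC.
Qed.

Lemma uniformizer_ramified : uniformizer W (adjoin1 K w) w.
Proof.
split => //; first exact: mem_adjoin1.
move=> x /adjoin_poly[p Kp ->] x0.
case: (dominant_term Kp (leqnn N)) => [z|[i [e [lt u _]]]]; last by exists (N%:Z * e + i%:Z).
by move: x0; rewrite big1 ?eqxx // => j _; rewrite z ?mul0r.
Qed.

(** A unit has order 0, and an order N e + j with 0 < j < N is never 0; so all terms but the
    constant one are small, and the residue is that of an element of K. *)
Lemma residues_ramified C : residues_in C K -> residues_in C (adjoin1 K w).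
Proof.
move=> rK x /adjoin_poly[p Kp ->] ux.
case: (dominant_term Kp (leqnn N)) => [z|[i [e [lt u H]]]].
  by move: (vunit_neq0 ux); rewrite big1 ?eqxx // => j _; rewrite z ?mul0r.
have e0 : N%:Z * e + i%:Z = 0.
  by apply: (vunit_Xz_inj HW w0 mw u); rewrite expr0z divr1.
have {}H j : (j < N)%N -> W (p`_j * w ^+ j) by move=> /H; rewrite e0 expr0z divr1.
have mterm j : (0 < j < N)%N -> mideal W (p`_j * w ^+ j).
  move=> /andP[j0 jN]; case: (val_cases (H j jN)) => // uj.
  have pj0 : p`_j != 0 by move: (vunit_neq0 uj); rewrite mulf_eq0 negb_or => /andP[].
  have [_ _ _ /(_ _ (Kp j) pj0)[f uf]] := uK.
  have : vunit W (w ^ (N%:Z * f + j%:Z)).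
    have -> : w ^ (N%:Z * f + j%:Z) = (p`_j * w ^+ j) / (p`_j / pi ^ f).
      by rewrite expfzDr // wNe -exprnP invfM invrK mulrACA mulfV // mul1r mulrC.
    exact: vunit_div.
  move/(vunit_Xz HW w0 mw) => ef; exfalso.
  have : (N%:Z %| j%:Z)%Z by apply/dvdzP; exists (- f); rewrite mulNr mulrC; apply/eqP; rewrite -addr_eq0 addrC ef.
  by rewrite /dvdz /= => /(dvdn_leq j0); rewrite leqNgt jN.
have mx : mideal W ((\sum_(j < N) p`_j * w ^+ j) - p`_0).
  have -> : \sum_(j < N) p`_j * w ^+ j = p`_0 + \sum_(j < N | j != 0%N :> nat) p`_j * w ^+ j.
    by rewrite (bigD1 (Ordinal N0)) //= expr0 mulr1.
  rewrite addrAC subrr add0r; apply: mideal_sum => // j j0; apply: mterm.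
  by rewrite lt0n j0 ltn_ord.
have [c Cc mc] := rK _ (Kp 0%N) (vunit_cong HW ux mx).
by exists c => //; rewrite -(subrKA p`_0); apply: midealD.
Qed.

End TotallyRamified.

(** An element of the maximal ideal of L is a multiple of a small element of K, hence of pi, so pi
    can be divided out again and again; [archimedean] bounds the number of divisions. *)
Lemma uniformizer_unramified L : ssub K L ->
  (forall y, L y -> mideal W y -> exists x v, [/\ K x, mideal W x, L v /\ W v & y = x * v]) ->
  is_subfield L -> uniformizer W L pi.
Proof.
move=> KL un LL; split => //; first exact: KL.
have main N : forall y, L y -> W y -> y != 0 -> W (pi ^+ N / y) -> exists i : int, vunit W (y / pi ^ i).
  elim: N => [|N IH] y Ly Wy y0 WN.
    by exists 0; rewrite expr0z divr1; split => //; rewrite expr0 mul1r in WN.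
  have [uy|my] := val_cases Wy; first by exists 0; rewrite expr0z divr1.
  have [x [v [Kx mx [Lv Wv] e]]] := un y Ly my.
  have Wyp : W (y / pi).
    by rewrite e mulrAC; apply: (subringM WW) => //; apply: (uniformizer_val HW uK).
  have [||||i ui] := IH (y / pi) => //.
  - by apply: subfield_div => //; apply: KL.
  - by rewrite mulf_neq0 ?invr_eq0.
  - by rewrite invfM invrK mulrCA -exprSr mulrC.
  exists (1 + i); rewrite expfzDr // expr1z invfM mulrA //.
move=> y Ly y0; have [N WN] := archimedean HW KK aK uK y0.
have [Wy|nWy] := pselect (W y); first exact: main WN.
have [_ /mideal_val Wy'] := nval_mideal HW nWy.
have y'0 : y^-1 != 0 by rewrite invr_eq0.
have [N' WN'] := archimedean HW KK aK uK y'0.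
have [i ui] := main N' _ (subfieldV LL Ly) Wy' y'0 WN'.
exists (- i); rewrite -invr_expz invrK; apply: vunitV' => //.
by rewrite invfM.
Qed.

End Adjoin.

(** * Rational functions and their places *)

Lemma fraction_numden (R : idomainType) (x : {fraction R}) :
  exists n d : R, d != 0 /\ x = FracField.tofrac n / FracField.tofrac d.
Proof.
elim/quotW: x => r; exists (frac r).1, (frac r).2.
have d0 := denom_ratioP r; split => //.
apply: (canRL (mulfK _)); first by rewrite tofrac_eq0.
rewrite -[_ * _]/(FracField.mul _ _) !piE; apply/eqmodP.
by rewrite /= FracField.equivfE /FracField.mulf !numden_Ratio ?mulr1 ?mul1r ?oner_neq0 // mulrC.
Qed.

Section Constants.
Variables (F : finFieldType) (Om : closedFieldType) (iota : {rmorphism ratfun F -> Om}).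

Local Notation q := #|F|.
Local Notation k := (kimg iota).

Definition ev : {poly F} -> Om := iota \o @FracField.tofrac {poly F}.
HB.instance Definition _ := GRing.RMorphism.on ev.
Definition cF : F -> Om := ev \o polyC.
HB.instance Definition _ := GRing.RMorphism.on cF.
Definition TT : Om := ev 'X.

Lemma ev_eq0 p : (ev p == 0) = (p == 0).
Proof. by rewrite /ev /= fmorph_eq0 tofrac_eq0. Qed.

Lemma ev_inj : injective ev.
Proof. by move=> p p' /eqP; rewrite -subr_eq0 -rmorphB ev_eq0 subr_eq0 => /eqP. Qed.

Lemma cF_eq0 c : (cF c == 0) = (c == 0).
Proof. by rewrite (fmorph_eq0 cF). Qed.

Lemma ev_horner p : ev p = (map_poly cF p).[TT].
Proof.
elim/poly_ind: p => [|p c IH]; first by rewrite !rmorph0 horner0.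
rewrite rmorphD rmorphM /= rmorphD rmorphM /= map_polyX map_polyC /= hornerMXaddC.
by rewrite IH.
Qed.

Lemma kimg_subfield : is_subfield k.
Proof.
split; [by exists 0; rewrite rmorph0|by exists 1; rewrite rmorph1| | |].
- by move=> _ _ [a ->] [b ->]; exists (a - b); rewrite rmorphB.
- by move=> _ _ [a ->] [b ->]; exists (a * b); rewrite rmorphM.
- by move=> _ [a ->]; exists a^-1; rewrite fmorphV.
Qed.

Lemma kimg_ev p : k (ev p). Proof. by exists (FracField.tofrac p). Qed.
Lemma kimg_cF c : k (cF c). Proof. exact: kimg_ev. Qed.
Lemma kimgP x : k x -> exists n d : {poly F}, d != 0 /\ x = ev n / ev d.
Proof.
move=> [c ->]; have [n [d [d0 ->]]] := fraction_numden c.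
by exists n, d; rewrite fmorph_div.
Qed.

Lemma kimg_algebraic :
  (forall x : Om, exists p : {poly ratfun F}, p != 0 /\ root (map_poly iota p) x) ->
  algebraic_over k.
Proof.
move=> H x; have [p [p0 px]] := H x; exists (map_poly iota p); split => //.
  by move=> i; rewrite coef_map; exists p`_i.
by rewrite map_poly_eq0.
Qed.

Lemma card_pchar : exists2 p, prime p & p \in [pchar Om] /\ exists2 e, (0 < e)%N & q = (p ^ e)%N.
Proof.
have [p pp pF] := finPcharP F; exists p => //; split; first by rewrite (fmorph_pchar cF).
have := finNzRing_gt1 F.
move: (card_pprimeChar pF); case: (logn _ _) => [|e] e1; first by rewrite e1.
by exists e.+1.
Qed.

Lemma card_pnat m : [pchar Om].-nat (q ^ m)%N.
Proof.
have [p pp [pF [e _ ->]]] := card_pchar.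
rewrite -expnM pnatX; apply/orP; left.
by rewrite (eq_pnat _ (pcharf_eq pF)) pnat_id.
Qed.

Lemma frobeniusD m (x y : Om) : (x + y) ^+ (q ^ m) = x ^+ (q ^ m) + y ^+ (q ^ m).
Proof. exact: exprDn_pchar (card_pnat m). Qed.
Lemma frobeniusN m (x : Om) : (- x) ^+ (q ^ m) = - x ^+ (q ^ m).
Proof. exact: exprNn_pchar (card_pnat m). Qed.
Lemma frobeniusB m (x y : Om) : (x - y) ^+ (q ^ m) = x ^+ (q ^ m) - y ^+ (q ^ m).
Proof. by rewrite frobeniusD frobeniusN. Qed.

Lemma card_exp_gt0 m : (0 < q ^ m)%N.
Proof. by rewrite expn_gt0 (ltnW (finNzRing_gt1 F)). Qed.

Lemma frobenius_inj m : injective (fun x : Om => x ^+ (q ^ m)).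
Proof.
move=> x y /eqP; rewrite -subr_eq0 -frobeniusB expf_eq0 card_exp_gt0 subr_eq0.
by move/eqP.
Qed.

Lemma frobenius_horner m (p : {poly Om}) x : (forall i, p`_i ^+ (q ^ m) = p`_i) ->
  p.[x] ^+ (q ^ m) = p.[x ^+ (q ^ m)].
Proof.
move=> Hp; rewrite !horner_coef.
rewrite (big_morph (fun x => x ^+ (q ^ m)) (frobeniusD m) (id1 := 0)); last first.
  by rewrite expr0n gtn_eqF ?card_exp_gt0.
by apply: eq_bigr => i _; rewrite exprMn Hp -!exprM mulnC.
Qed.

(** The algebraic closure of F in Om, by [Fbar_root]. Describing it by powers of Frobenius gives
    finitely many elements a common exponent m. *)
Definition Fbar : sset Om := fun x => exists2 m, (0 < m)%N & x ^+ (q ^ m) = x.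

Lemma Fbar_iter m j (x : Om) : x ^+ (q ^ m) = x -> x ^+ (q ^ (m * j)) = x.
Proof.
move=> e; elim: j => [|j IH]; first by rewrite muln0 expn0 expr1.
by rewrite mulnS expnD exprM e.
Qed.

Lemma Fbar_common (s : seq Om) : (forall x, x \in s -> Fbar x) ->
  exists2 m, (0 < m)%N & forall x, x \in s -> x ^+ (q ^ m) = x.
Proof.
elim: s => [|x s IH] H; first by exists 1%N.
have [m m0 Hm] := IH (fun y ys => H y (mem_behead (s := x :: s) ys)).
have [m' m'0 Hm'] := H x (mem_head _ _).
exists (m * m')%N; first by rewrite muln_gt0 m0.
move=> y; rewrite inE => /orP[/eqP->|/Hm e]; last exact: Fbar_iter.
by rewrite mulnC; exact: Fbar_iter.
Qed.

Lemma Fbar_subfield : is_subfield Fbar.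
Proof.
split.
- by exists 1%N => //; rewrite expr0n gtn_eqF // card_exp_gt0.
- by exists 1%N => //; rewrite expr1n.
- move=> x y Fx Fy; have [|m m0 H] := @Fbar_common [:: x; y].
    by move=> z; rewrite !inE => /orP[] /eqP ->.
  by exists m => //; rewrite frobeniusB !H ?inE ?eqxx ?orbT.
- move=> x y Fx Fy; have [|m m0 H] := @Fbar_common [:: x; y].
    by move=> z; rewrite !inE => /orP[] /eqP ->.
  by exists m => //; rewrite exprMn !H ?inE ?eqxx ?orbT.
- by move=> x [m m0 e]; exists m => //; rewrite exprVn e.
Qed.
Let FR := subfield_subring Fbar_subfield.

Lemma Fbar_cF c : Fbar (cF c).
Proof. by exists 1%N => //; rewrite expn1 -rmorphXn expf_card. Qed.

Lemma cF_fixed (x : Om) : x ^+ q = x -> exists c, x = cF c.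
Proof.
move=> e; have : root (map_poly cF ('X^q - 'X)) x.
  by rewrite rmorphB /= map_polyXn map_polyX rootE hornerD hornerN hornerXn hornerX e subrr.
rewrite finField_genPoly rmorph_prod /=.
have -> : \prod_(c : F) map_poly cF ('X - c%:P) = \prod_(z <- [seq cF c | c <- enum F]) ('X - z%:P).
  by rewrite big_map big_enum; apply: eq_bigr => c _; rewrite rmorphB /= map_polyX map_polyC.
by rewrite root_prod_XsubC => /mapP[c _ ->]; exists c.
Qed.

(** If the q^m-th power map fixes the coefficients of p, it maps roots of p to roots of p. Two of
    its iterates then agree at x, and injectivity cancels the earlier one. *)
Lemma Fbar_root (p : {poly Om}) x : coefs_in Fbar p -> p != 0 -> root p x -> Fbar x.
Proof.
move=> Fp p0 px; have [|m m0 Hm] := @Fbar_common p.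
  by move=> c /(nthP 0)[i _ <-]; exact: Fp.
have Hp i : p`_i ^+ (q ^ m) = p`_i.
  have [lt|le] := ltnP i (size p); first by apply: Hm; exact: mem_nth.
  by rewrite nth_default // expr0n gtn_eqF // card_exp_gt0.
pose f i := x ^+ (q ^ (m * i)).
have rf i : root p (f i).
  have Hp' j : p`_j ^+ (q ^ (m * i)) = p`_j by exact: Fbar_iter.
  by rewrite rootE /f -frobenius_horner // (rootP px) expr0n gtn_eqF // card_exp_gt0.
have /(uniqPn 0)[i [j [lt ltj e]]] : ~~ uniq (mkseq f (size p)).
  apply/negP => u; have : all (root p) (mkseq f (size p)) by apply/allP => _ /mapP[i _ ->].
  by move=> /max_poly_roots => /(_ p0 u); rewrite size_mkseq ltnn.
rewrite size_mkseq in ltj; rewrite !nth_mkseq // in e; last exact: ltn_trans ltj.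
exists (m * (j - i))%N; first by rewrite muln_gt0 m0 subn_gt0.
apply: (@frobenius_inj (m * i)); rewrite -exprM -expnD -mulnDr subnK ?(ltnW lt) //.
Qed.


Lemma TT_notin_Fbar : ~ Fbar TT.
Proof.
move=> [m m0]; rewrite -rmorphXn /= => /ev_inj /(congr1 (fun p : {poly F} => size p)).
rewrite size_polyXn size_polyX => -[e].
have := finNzRing_gt1 F; have : (q ^ 1 <= q ^ m)%N by rewrite leq_exp2l ?finNzRing_gt1.
by rewrite expn1 e; case: q => [|[]].
Qed.

Lemma horner_TT_neq0 (p : {poly Om}) : coefs_in Fbar p -> p != 0 -> p.[TT] != 0.
Proof. by move=> Fp p0; apply/negP => px; apply: TT_notin_Fbar; apply: (Fbar_root Fp). Qed.

Lemma coefs_cF (p : {poly F}) : coefs_in Fbar (map_poly cF p).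
Proof. by move=> i; rewrite coef_map; exact: Fbar_cF. Qed.

Definition kbar : sset Om := fun x => exists p d : {poly Om},
  [/\ coefs_in Fbar p, coefs_in Fbar d, d != 0 & x = p.[TT] / d.[TT]].

Lemma kbar_poly (p : {poly Om}) : coefs_in Fbar p -> kbar p.[TT].
Proof.
by move=> Fp; exists p, 1; split; rewrite ?oner_neq0 // ?hornerC ?divr1 //; exact: (coefs_in1 FR).
Qed.
Lemma kbar_Fbar : ssub Fbar kbar.
Proof. by move=> c Fc; rewrite -(hornerC c TT); apply/kbar_poly/(coefs_inC FR). Qed.
Lemma kbar_TT : kbar TT.
Proof. by rewrite -(hornerX TT); apply/kbar_poly/(coefs_inX FR). Qed.

Lemma kbar_subfield : is_subfield kbar.
Proof.
have M := coefs_inM FR; have B := coefs_inB FR; have H := horner_TT_neq0.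
split; [exact/kbar_Fbar/(subring0 FR)|exact/kbar_Fbar/(subring1 FR)| | |].
- move=> _ _ [p [d [Fp Fd d0 ->]]] [p' [d' [Fp' Fd' d'0 ->]]].
  exists (p * d' - p' * d), (d * d'); split; [exact/B/M/Fd/Fp'/M|exact: M|exact: mulf_neq0|].
  by rewrite hornerD hornerN !hornerM; field; rewrite !H.
- move=> _ _ [p [d [Fp Fd d0 ->]]] [p' [d' [Fp' Fd' d'0 ->]]].
  exists (p * p'), (d * d'); split; [exact: M|exact: M|exact: mulf_neq0|].
  by rewrite !hornerM; field; rewrite !H.
- move=> _ [p [d [Fp Fd d0 ->]]]; have [->|p0] := eqVneq p 0.
    by rewrite horner0 mul0r invr0; exact/kbar_Fbar/(subring0 FR).
  by exists d, p; split => //; rewrite invfM invrK mulrC.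
Qed.

Lemma kbar_kimg : ssub k kbar.
Proof.
move=> x /kimgP[n [d [d0 ->]]]; rewrite !ev_horner.
by exists (map_poly cF n), (map_poly cF d); split; rewrite ?map_poly_eq0 //; exact: coefs_cF.
Qed.

Lemma Fbar_factor (p : {poly Om}) : coefs_in Fbar p -> p != 0 -> exists rs : seq Om,
  (forall z, z \in rs -> Fbar z) /\ p = lead_coef p *: \prod_(z <- rs) ('X - z%:P).
Proof.
move=> Fp p0; have [rs e] := closed_field_poly_normal p; exists rs; split => // z zr.
apply: (Fbar_root Fp p0); rewrite e rootZ ?lead_coef_eq0 //.
by rewrite root_prod_XsubC.
Qed.

(** * Places over finite primes and over infinity *)

Section Places.
Variables (W : sset Om).
Hypothesis (HW : valuation_ring W).
Let WW : is_subring W := HW.1.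

Lemma Fbar_vunit c : Fbar c -> c != 0 -> vunit W c.
Proof.
move=> [m m0 e] c0; have gt : (1 < q ^ m)%N.
  by rewrite (leq_trans (finNzRing_gt1 F)) // -{1}(expn1 q) leq_exp2l ?finNzRing_gt1.
apply: (@vunit_root _ _ HW _ (q ^ m).-1); first by rewrite -subn1 subn_gt0.
suff -> : c ^+ (q ^ m).-1 = 1 by exact: vunit1.
by apply: (mulfI c0); rewrite -exprS prednK ?mulr1 // ltnW.
Qed.

Lemma Fbar_val : ssub Fbar W.
Proof.
move=> c Fc; have [->|c0] := eqVneq c 0; first exact: (subring0 WW).
by apply: vunit_val; apply: Fbar_vunit.
Qed.

Lemma Fbar_mideal c : Fbar c -> mideal W c -> c = 0.
Proof. by move=> Fc m; apply/eqP/negP => /negP c0; apply: (mideal_nunit m); exact: Fbar_vunit. Qed.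

(** Were the inverse y of some x in the maximal ideal, then y p(y) = 1 with p over K would put 1
    there. A nontrivial W is therefore nontrivial on k already. *)
Lemma subfield_val_trivial K : is_subfield K -> algebraic_over K -> ssub K W -> forall x, W x.
Proof.
move=> KK aK KW x; apply: contrapT => /(nval_mideal HW)[x0 mx].
have y0 : x^-1 != 0 by rewrite invr_eq0.
have [p Kp e] := algebraic_inverse KK aK y0.
have : mideal W 1.
  rewrite -e; apply: midealM => //; apply: (coefs_in_horner WW); last exact: mideal_val.
  by move=> i; apply: KW.
by move/mideal_nunit; apply; exact: vunit1.
Qed.

Lemma uniformizer_finite a : Fbar a -> mideal W (TT - a) -> uniformizer W kbar (TT - a).
Proof.
move=> Fa ma; have t0 : TT - a != 0.
  by rewrite subr_eq0; apply/eqP => e; apply: TT_notin_Fbar; rewrite e.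
split => //; first exact: (subringB (subfield_subring kbar_subfield) kbar_TT (kbar_Fbar Fa)).
have main p : coefs_in Fbar p -> p != 0 -> exists i : nat, vunit W (p.[TT] / (TT - a) ^+ i).
  move=> Fp p0; have [rs [Frs e]] := Fbar_factor Fp p0.
  have [i ui] : exists i : nat, vunit W ((\prod_(z <- rs) (TT - z)) / (TT - a) ^+ i).
    elim: rs Frs {e} => [|z rs IH] Frs; first by exists 0%N; rewrite big_nil expr0 divr1; exact: vunit1.
    have [i ui] := IH (fun y ys => Frs y (mem_behead (s := z :: rs) ys)).
    rewrite big_cons; have [->|az] := eqVneq z a.
      by exists i.+1; rewrite exprS invfM mulrACA mulfV // mul1r.
    exists i; rewrite -mulrA; apply: vunitM => //.
    have -> : TT - z = (a - z) + (TT - a) by ring.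
    apply: vunitD => //; apply: Fbar_vunit; last by rewrite subr_eq0 eq_sym.
    by apply: (subringB FR) => //; apply: Frs; exact: mem_head.
  exists i; rewrite e hornerZ horner_prod (eq_bigr (fun z => TT - z)); last first.
    by move=> z _; rewrite hornerXsubC.
  by rewrite -mulrA; apply: vunitM => //; apply: Fbar_vunit; [exact: Fp|rewrite lead_coef_eq0].
move=> _ [p [d [Fp Fd d0 ->]]] x0.
have p0 : p != 0 by apply: contraNneq x0 => ->; rewrite horner0 mul0r.
have [i ui] := main p Fp p0; have [j uj] := main d Fd d0.
exists (i%:Z - j%:Z); have := vunit_div HW ui uj; congr (vunit W _).
rewrite expfzDr // -invr_expz -!exprnP; field.
by rewrite !expf_neq0 // horner_TT_neq0.
Qed.

(** Over Fbar the polynomial is its leading coefficient times factors T - z, and each of these is T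
    times a one-unit because 1/T is small. *)
Lemma vone_inf (p : {poly Om}) : mideal W TT^-1 -> coefs_in Fbar p -> p != 0 ->
  vone W (p.[TT] / (lead_coef p * TT ^+ (size p).-1)).
Proof.
move=> mT Fp p0; have [rs [Frs e]] := Fbar_factor Fp p0.
have TT0 : TT != 0.
  by apply/eqP => e0; apply: TT_notin_Fbar; rewrite e0; exact: (subring0 FR).
have lp0 : lead_coef p != 0 by rewrite lead_coef_eq0.
have -> : (size p).-1 = size rs by rewrite e size_scale // size_prod_XsubC.
rewrite {1}e hornerZ horner_prod (eq_bigr (fun z => TT - z)); last first.
  by move=> z _; rewrite hornerXsubC.
rewrite invfM mulrACA mulfV // mul1r.
elim: rs Frs {e} => [|z rs IH] Frs; first by rewrite big_nil expr0 divr1; exact: vone1.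
rewrite big_cons /= exprS invfM mulrACA; apply: voneM => //; last first.
  by apply: IH => y ys; apply: Frs; rewrite inE ys orbT.
have -> : (TT - z) / TT = 1 - z / TT by field.
rewrite /vone addrAC subrr add0r; apply: midealN => //; apply: midealMl => //.
by apply: Fbar_val; apply: Frs; exact: mem_head.
Qed.

(** The sign absorbs the factor (-1)^deg P of P^*, so that P^* times [pinf]^deg P is a one-unit for
    monic P, with no constant left over. *)
Definition pinf : Om := - TT^-1.

Lemma TT_neq0 : TT != 0.
Proof. by apply/eqP => e0; apply: TT_notin_Fbar; rewrite e0; exact: (subring0 FR). Qed.

Lemma uniformizer_inf : mideal W TT^-1 -> uniformizer W kbar pinf.
Proof.
move=> mT; have TT0 := TT_neq0.
split; rewrite ?oppr_eq0 ?invr_eq0 //.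
- apply: (subringN (subfield_subring kbar_subfield)); apply: (subfieldV kbar_subfield).
  exact: kbar_TT.
- exact: midealN.
move=> _ [p [d [Fp Fd d0 ->]]] x0.
have p0 : p != 0 by apply: contraNneq x0 => ->; rewrite horner0 mul0r.
have H r : coefs_in Fbar r -> r != 0 -> vunit W (r.[TT] / TT ^+ (size r).-1).
  move=> Fr r0; have lr0 : lead_coef r != 0 by rewrite lead_coef_eq0.
  apply: (@vunit_mulr _ _ HW _ (lead_coef r)^-1).
    by apply: vunitV; apply: Fbar_vunit => //; exact: Fr.
  by rewrite -mulrA -invfM mulrC [_ * lead_coef r]mulrC mulrC; apply/vone_unit/vone_inf.
exists ((size d).-1%:Z - (size p).-1%:Z).
have := vunit_div HW (H p Fp p0) (H d Fd d0).
have N1 n : (-1) ^+ n != 0 :> Om by rewrite expf_neq0 // oppr_eq0 oner_eq0.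
have uN n : vunit W ((-1) ^+ n) by apply: vunitX => //; apply/(vunitN HW)/vunit1.
move=> /(vunitM HW)/(_ (vunit_div HW (uN (size p).-1) (uN (size d).-1))).
congr (vunit W _); rewrite expfzDr ?oppr_eq0 ?invr_eq0 // -invr_expz -!exprnP /pinf.
rewrite ![(- TT^-1) ^+ _]exprNn !exprVn.
set a := (-1) ^+ _; set b := (-1) ^+ _; set X := TT ^+ _; set Y := TT ^+ _.
by field; rewrite /a /b !N1 /X /Y !expf_neq0 // horner_TT_neq0.
Qed.

Lemma pstar_vone f : mideal W TT^-1 -> f \is monic -> vone W (ev (pstar f) * pinf ^+ pdeg f).
Proof.
move=> mT mf; have f0 : map_poly cF f != 0 by rewrite map_poly_eq0 monic_neq0.
have := vone_inf mT (coefs_cF f) f0.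
rewrite lead_coef_map (monicP mf) rmorph1 mul1r size_map_poly -/(pdeg f) -ev_horner.
congr (vone W _); rewrite /pstar rmorphM rmorphXn rmorphN1 /pinf [(- TT^-1) ^+ _]exprNn exprVn.
by rewrite mulrACA -exprMn mulN1r opprK expr1n mul1r.
Qed.


Lemma ev_val p : W TT -> W (ev p).
Proof.
move=> WT; rewrite ev_horner; apply: (coefs_in_horner WW) => // i.
by apply: Fbar_val; exact: coefs_cF.
Qed.

Section FinitePrime.
Variable P : {poly F}.
Hypotheses (WT : W TT) (irrP : irreducible_poly P) (mP : mideal W (ev P)).

Lemma ev_vunit f : ~~ (P %| f) -> vunit W (ev f).
Proof.
move=> nPf; case: (val_cases (ev_val f WT)) => // mf.
have : coprimep P f by rewrite irreducible_poly_coprime.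
move=> /Bezout_eq1_coprimepP[[u v] /= e].
have : mideal W (ev 1).
  rewrite -e rmorphD !rmorphM /=; apply: midealD => //; apply: midealMl => //; exact: ev_val.
by rewrite rmorph1 => /mideal_nunit; case; exact: vunit1.
Qed.

Lemma ev_vunit_pow f : f != 0 -> exists2 i : nat, P ^+ i %| f & vunit W (ev f / ev P ^+ i).
Proof.
have [n] := ubnP (size f); elim: n f => // n IH f; rewrite ltnS => sf f0.
have [/dvdpP[g eg]|nd] := boolP (P %| f); last first.
  by exists 0%N; rewrite ?expr0 ?dvd1p // divr1; exact: ev_vunit.
have g0 : g != 0 by apply: contraNneq f0 => g0; rewrite eg g0 mul0r.
have P0 : P != 0 by apply: contraNneq f0 => P0; rewrite eg P0 mulr0.
have [|//|i di ui] := IH g.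
  apply: leq_trans sf; rewrite eg size_mul //; case: irrP => sP _.
  by move: sP; case: (size P) => [|[|m]] // _; rewrite !addnS /= ltnS leq_addr.
exists i.+1; first by rewrite eg exprSr dvdp_mul.
by rewrite eg rmorphM /= exprSr invfM mulrACA [X in _ * X]mulrC mulVf ?mulr1 // ev_eq0.
Qed.

Lemma uniformizer_prime : uniformizer W k (ev P).
Proof.
have P0 : P != 0.
  by case: irrP => sP _; rewrite -size_poly_gt0 ltnW.
split; rewrite ?ev_eq0 //; first exact: kimg_ev.
move=> _ /kimgP[n [d [d0 ->]]] x0.
have n0 : n != 0 by apply: contraNneq x0 => ->; rewrite rmorph0 mul0r.
have [i _ ui] := ev_vunit_pow n0; have [j _ uj] := ev_vunit_pow d0.
exists (i%:Z - j%:Z); have := vunit_div HW ui uj; congr (vunit W _).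
rewrite expfzDr ?ev_eq0 // -invr_expz -!exprnP; field.
by rewrite !expf_neq0 ?ev_eq0.
Qed.
End FinitePrime.

(** The prime is a nonzero polynomial of least degree in the maximal ideal, made monic. Such
    polynomials exist because W is nontrivial on k, and least degree makes it irreducible because
    the ideal is prime. *)
Lemma prime_below : algebraic_over k -> (exists x, ~ W x) -> W TT ->
  exists P, [/\ P \is monic, irreducible_poly P & mideal W (ev P)].
Proof.
move=> ak [x0 nW] WT.
pose Q n := `[< exists f : {poly F}, [/\ f != 0, mideal W (ev f) & size f = n] >].
have exQ : exists n, Q n.
  have [//|H] := pselect (exists n, Q n); case: nW.
  apply: (subfield_val_trivial kimg_subfield ak) => _ /kimgP[n [d [d0 ->]]].
  apply: (subringM WW); first exact: ev_val.
  have [/vunitV/vunit_val//|md] := val_cases (ev_val d WT).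
  by case: H; exists (size d); apply/asboolP; exists d.
case: (ex_minnP exQ) => n /asboolP[f [f0 mf sf]] minf.
have minf' g : g != 0 -> mideal W (ev g) -> (size f <= size g)%N.
  by move=> g0 mg; rewrite sf; apply: minf; apply/asboolP; exists g.
have sf1 : (1 < size f)%N.
  rewrite ltnNge; apply/negP => le1; have e := size1_polyC le1.
  apply: (mideal_nunit mf); rewrite e; apply: Fbar_vunit; first exact: Fbar_cF.
  by rewrite cF_eq0; apply: contra_neq f0 => f00; rewrite e f00.
have irrf : irreducible_poly f.
  split => // g sg /dvdpP[h eh].
  have h0 : h != 0 by apply: contraNneq f0 => h0; rewrite eh h0 mul0r.
  have g0 : g != 0 by apply: contraNneq f0 => g0; rewrite eh g0 mulr0.
  have sfe : (size f = (size h + size g).-1)%N by rewrite eh size_mul.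
  have [sh sg0] : (0 < size h /\ 0 < size g)%N by rewrite !size_poly_gt0.
  have : mideal W (ev h * ev g) by rewrite -rmorphM -eh.
  case/(mideal_mul HW (ev_val h WT) (ev_val g WT)) => [/(minf' _ h0)|/(minf' _ g0)] le.
    by exfalso; move/eqP: sg; apply; move: le sh sg0; rewrite sfe; case: (size h) => // a; case: (size g) => // b; lia.
  have dg : g %| f by rewrite eh dvdp_mull.
  by rewrite -(dvdp_size_eqp dg) eqn_leq le andbT sfe; move: le sh sg0; rewrite sfe; case: (size h) => // a; case: (size g) => // b; lia.
have lf0 : (lead_coef f)^-1 != 0 by rewrite invr_eq0 lead_coef_eq0.
exists ((lead_coef f)^-1 *: f); split.
- by rewrite monicE lead_coefZ mulVf // lead_coef_eq0.
- case: irrf => _ irrf; split; first by rewrite size_scale.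
  by move=> g sg; rewrite dvdpZr // => /(irrf g sg) e; rewrite (eqp_trans e) // eqp_sym eqp_scale.
- by rewrite -mul_polyC rmorphM; apply: midealMl => //; exact: ev_val.
Qed.

Lemma uniformizer_inf_kimg : mideal W TT^-1 -> uniformizer W k pinf.
Proof.
move=> mT; have [_ p0 mp H] := uniformizer_inf mT; split => //.
  apply: (subringN (subfield_subring kimg_subfield)); apply: (subfieldV kimg_subfield).
  exact: kimg_ev.
by move=> x /kbar_kimg; apply: H.
Qed.

End Places.

(** Chevalley's theorem for the ideal (t) of Fbar[t]: a relation t p(t) = 1 would make t algebraic
    over Fbar. *)
Lemma place_of_transcendental t : ~ Fbar t -> exists W, valuation_ring W /\ mideal W t.
Proof.
move=> nt; have PR : is_subring (poly_ring Fbar t) := poly_ring_subring t FR.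
have [||||W [HW sW mW]] := @chevalley Om (poly_ring Fbar t)
    (fun x => exists2 y, poly_ring Fbar t y & x = t * y) PR.
- move=> _ [y Py ->]; apply: (subringM PR) => //; exact: mem_poly_ring.
- move=> _ _ [y Py ->] [z Pz ->]; exists (y + z); last by rewrite mulrDr.
  exact: (subringD PR).
- by move=> a _ Pa [y Py ->]; exists (a * y); [exact: (subringM PR)|rewrite mulrCA].
- move=> [_ [p Fp ->] e]; apply: nt.
  apply: (@Fbar_root ('X * p - 1)).
  + apply: (coefs_inB FR); last exact: (coefs_in1 FR).
    by apply: (coefs_inM FR) => //; exact: (coefs_inX FR).
  + apply/eqP => /(congr1 (fun r : {poly Om} => r.[0])).
    rewrite hornerD hornerN hornerM hornerX mul0r hornerC sub0r horner0.
    by move=> /eqP; rewrite oppr_eq0 oner_eq0.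
  + by rewrite rootE hornerD hornerN hornerM hornerX hornerC -e subrr.
exists W; split => //; apply: mW; exists 1; rewrite ?mulr1 //; exact: (subring1 PR).
Qed.

Lemma place_finite a : Fbar a ->
  exists W, [/\ valuation_ring W, mideal W (TT - a) & W TT].
Proof.
move=> Fa; have [|W [HW mW]] := @place_of_transcendental (TT - a).
  by move=> Ft; apply: TT_notin_Fbar; rewrite -(subrK a TT); apply: (subringD FR).
exists W; split => //; rewrite -(subrK a TT); apply: (subringD HW.1); first exact: mideal_val.
exact: Fbar_val.
Qed.

Lemma place_inf : exists W, valuation_ring W /\ mideal W TT^-1.
Proof.
apply: place_of_transcendental => /(subfieldV Fbar_subfield).
by rewrite invrK; exact: TT_notin_Fbar.
Qed.

Lemma place_prime P : irreducible_poly P ->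
  exists W, [/\ valuation_ring W, W TT & mideal W (ev P)].
Proof.
move=> [sP _]; have P0 : map_poly cF P != 0.
  by rewrite map_poly_eq0 -size_poly_gt0 ltnW.
have /closed_rootP[a pa] : size (map_poly cF P) != 1%N by rewrite size_map_poly gtn_eqF.
have Fa := Fbar_root (coefs_cF P) P0 pa.
have [W [HW ma WT]] := place_finite Fa; exists W; split => //.
have WR := HW.1; rewrite ev_horner -[_.[TT]]subr0 -(rootP pa); apply: (mideal_congH HW) => //; last exact: Fbar_val.
by move=> i; apply: (Fbar_val HW); exact: coefs_cF.
Qed.

End Constants.

(** * Kummer and Artin-Schreier descent *)

Lemma prod_count (R : comNzRingType) (I : eqType) (S s : seq I) (g : I -> R) :
  uniq S -> {subset s <= S} -> \prod_(z <- s) g z = \prod_(a <- S) g a ^+ count_mem a s.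
Proof.
move=> uS; elim: s => [|z s IH] sS; first by rewrite big_nil big1.
rewrite big_cons IH; last by move=> y ys; apply: sS; rewrite inE ys orbT.
rewrite [RHS](eq_bigr (fun a => g a ^+ (z == a) * g a ^+ count_mem a s)); last first.
  by move=> a _; rewrite -exprD.
rewrite big_split; congr (_ * _) => /=.
rewrite (bigD1_seq z) //=; last by apply: sS; rewrite mem_head.
rewrite eqxx expr1 big1 ?mulr1 // => a za.
by rewrite eq_sym (negbTE za) expr0.
Qed.

Lemma monic_quotient (R : comNzRingType) (K : R -> Prop) (p d g : {poly R}) :
  is_subring K -> d \is monic -> coefs_in K d -> coefs_in K p -> p = g * d -> coefs_in K g.
Proof.
move=> KK md Kd Kp e; have [a [r [Ka Kr e' sr]]] := monic_division KK md Kd Kp.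
have e2 : (g - a) * d = r by rewrite mulrBl -e e' addrAC subrr add0r.
have [/eqP|ga] := eqVneq (g - a) 0; first by rewrite subr_eq0 => /eqP ->.
move: sr; rewrite -e2 size_Mmonic // ltnNge -subn1 leq_subRL.
  by rewrite add1n -[X in (X < _)%N]add0n ltn_add2r size_poly_gt0 ga.
by rewrite addn_gt0 size_poly_gt0 ga.
Qed.

Section Descent.
Variables (F : finFieldType) (Om : closedFieldType) (iota : {rmorphism ratfun F -> Om}).
Local Notation Fb := (@Fbar F Om).
Local Notation kb := (kbar iota).
Local Notation T := (TT iota).
Let FF : is_subfield Fb := Fbar_subfield iota.
Let FR := subfield_subring FF.
Let kk : is_subfield kb := kbar_subfield iota.
Let kR := subfield_subring kk.

Variables (M : nat).
(** The exponent M kills the ramification of y over Fbar(T): at each place y^M has the order of some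
    element c of [kbar], and c may vary with the place. *)
Definition kbar_val (y : Om) : Prop := forall W, valuation_ring W -> (exists x, ~ W x) ->
  exists2 c, kb c & vunit W (y ^+ M / c).

Let nontrivial (W : sset Om) t : mideal W t -> t != 0 -> exists x, ~ W x.
Proof. by move=> [_ H] /H; exists t^-1. Qed.

Lemma kbar_val_pow W t y : valuation_ring W -> uniformizer W kb t -> y != 0 -> kbar_val y ->
  exists z : int, vunit W (y ^+ M / t ^ z).
Proof.
move=> HW uk y0 vy; have [_ t0 mt H] := uk.
have [c kc uc] := vy W HW (nontrivial mt t0).
have c0 : c != 0 by apply: contraTneq (vunit_neq0 uc) => ->; rewrite invr0 mulr0 eqxx.
have [z uz] := H c kc c0; exists z.
have := vunitM HW uc uz; rewrite mulrA divfK //.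
Qed.

(* The divisor of y^M over Fbar(T) is that of an element c of Fbar(T), so a power of y^M / c,
   which lies in Fbar(T) and has no zero or pole, is constant, and so is y^M / c. *)
Lemma kummer_descent y N : (0 < N)%N -> y != 0 -> kb (y ^+ N) -> kbar_val y -> kb (y ^+ M).
Proof.
move=> N0 y0 [p [d [Fp Fd d0 e]]] vy.
have p0 : p != 0.
  by apply: contraNneq (expf_neq0 N y0) => p0; rewrite e p0 horner0 mul0r.
have [rs [Frs ep]] := Fbar_factor iota Fp p0; have [ts [Fts ed]] := Fbar_factor iota Fd d0.
pose S := undup (rs ++ ts); have uS : uniq S := undup_uniq _.
have FS a : a \in S -> Fb a by rewrite mem_undup mem_cat => /orP[/Frs|/Fts].
pose c := lead_coef p / lead_coef d.
have Fc : Fb c by apply: subfield_div => //; [exact: Fp|exact: Fd].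
have c0 : c != 0 by rewrite mulf_neq0 ?invr_eq0 ?lead_coef_eq0.
have Ta a : a \in S -> T - a != 0.
  by move=> /FS Fa; rewrite subr_eq0; apply/eqP => e0; apply: (TT_notin_Fbar (iota := iota)); rewrite e0.
pose m a : int := (count_mem a rs)%:Z - (count_mem a ts)%:Z.
have ef : y ^+ N = c * \prod_(a <- S) (T - a) ^ m a.
  have hp (s : seq Om) : (\prod_(z <- s) ('X - z%:P)).[T] = \prod_(z <- s) (T - z).
    by rewrite horner_prod; apply: eq_bigr => z _; rewrite hornerXsubC.
  rewrite e {1}ep {1}ed !hornerZ !hp.
  rewrite (prod_count _ uS) => [|z zr]; last by rewrite mem_undup mem_cat zr.
  rewrite (prod_count (s := ts) _ uS) => [|z zt]; last by rewrite mem_undup mem_cat zt orbT.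
  rewrite invfM mulrACA -prodfV -big_split /=; congr (_ * _).
  rewrite !big_seq; apply: eq_bigr => a aS.
  by rewrite expfzDr ?Ta // -invr_expz -!exprnP.
(* Computing the order of y^(MN) at T = a from y^M and from y^N gives M m_a = z N, where z is the
   order of y^M. The quantifier stands before the membership so that z can be chosen as a function
   of a. *)
have main a : exists z : int, a \in S -> M%:Z * m a = z * N%:Z.
  have [aS|naS] := boolP (a \in S); last by exists 0.
  have [W [HW ma WT]] := place_finite iota (FS a aS).
  have uk := uniformizer_finite HW (FS a aS) ma.
  have [z uz] := kbar_val_pow HW uk y0 vy; exists z => _.
  have um : vunit W (y ^+ N / (T - a) ^ m a).
    rewrite ef (bigD1_seq a) //=; set t := (T - a) ^ m a; set Q := \prod_(_ <- _ | _) _.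
    have t0 : t != 0 by rewrite expfz_neq0 ?Ta.
    have -> : c * (t * Q) / t = c * Q by field.
    rewrite {}/Q.
    apply: vunitM => //; first exact: (Fbar_vunit HW Fc c0).
    rewrite big_seq_cond; apply: vunit_prod => // b /andP[bS ba]; apply: vunitXz => //.
    have -> : T - b = (a - b) + (T - a) by ring.
    apply: vunitD => //; apply: (Fbar_vunit HW); last by rewrite subr_eq0 eq_sym.
    by apply: (subringB FR); exact: FS.
  apply: (vunit_Xz_inj HW (Ta a aS) ma (x := y ^+ (M * N))).
    have := vunitX HW M um; rewrite expr_div_n -exprM mulnC.
    by rewrite [X in _ / X]exprnP exprz_exp [m a * _]mulrC.
  have := vunitX HW N uz; rewrite expr_div_n -exprM.
  by rewrite [X in _ / X]exprnP exprz_exp.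
pose z a := sval (cid (main a)).
have zP a : a \in S -> M%:Z * m a = z a * N%:Z := svalP (cid (main a)).
pose h := \prod_(a <- S) (T - a) ^ z a.
have kh : kb h.
  rewrite /h big_seq; apply: (subring_prod kR) => a /FS Fa; apply: subfieldXz => //.
  by apply: (subringB kR); [exact: kbar_TT|exact: kbar_Fbar].
have h0 : h != 0.
  by rewrite /h big_seq prodf_seq_neq0; apply/allP => a aS; apply/implyP => _; rewrite expfz_neq0 ?Ta.
have eh : (y ^+ M / h) ^+ N = c ^+ M.
  rewrite expr_div_n exprAC ef exprMn.
  have -> : h ^+ N = (\prod_(a <- S) (T - a) ^ m a) ^+ M.
    rewrite /h -!prodrXl !big_seq; apply: eq_bigr => a aS.
    rewrite [LHS]exprnP [RHS]exprnP !exprz_exp -zP // mulrC //.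
  rewrite mulfK // expf_neq0 // big_seq prodf_seq_neq0; apply/allP => a aS; apply/implyP => _.
  by rewrite expfz_neq0 ?Ta.
have Fyh : Fb (y ^+ M / h).
  apply: (Fbar_root iota (p := 'X^N - (c ^+ M)%:P)).
  - apply: (coefs_inB FR); first exact: (subringX (coefs_subring FR) _ (coefs_inX FR)).
    by apply: (coefs_inC FR); apply: (subringX FR).
  - by apply: monic_neq0; apply: monicXnsubC.
  - by rewrite rootE hornerD hornerN hornerXn hornerC eh subrr.
by rewrite -(divfK h0 (y ^+ M)); apply: (subringM kR) => //; exact: kbar_Fbar.
Qed.

(** * Artin-Schreier descent to Fbar(T) *)

Section ArtinSchreier.
Variables (V : sset Om) (p : nat).
Hypotheses (VV : is_subfield V) (kV : ssub kb V) (vV : forall y, V y -> y != 0 -> kbar_val y).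
Hypotheses (chp : p \in [pchar Om]) (pM : ~~ (p %| M)%N).
Let pp : prime p. Proof. exact: pcharf_prime chp. Qed.
Let VR := subfield_subring VV.

(** At a pole the term y^p dominates, so p times the order of y is - m. By [kbar_val], M times that
    order is an integer z; hence p z = - M m, and p does not divide M. *)
Lemma artin_schreier_pole W t f y (m : nat) : valuation_ring W -> uniformizer W kb t ->
  V y -> y ^+ p - y = f -> vunit W (f * t ^+ m) -> (0 < m)%N -> (p %| m)%N.
Proof.
move=> HW uk Vy ef uf m0; have WW := HW.1; have [_ t0 mt _] := uk.
have nWy : ~ W y.
  move=> Wy; apply: (vunit_nmideal uf); apply: midealMl => //.
    by rewrite -(prednK m0) exprS; apply: midealM => //; exact: (subringX WW _ (mideal_val mt)).
  by rewrite -ef; apply: (subringB WW) => //; apply: (subringX WW).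
have [y0 my] := nval_mideal HW nWy.
have p1 := prime_gt1 pp.
have o : vone W (1 - y^-1 ^+ p.-1).
  rewrite /vone addrAC subrr add0r; apply: midealN => //.
  have -> : p.-1 = p.-2.+1 by case: p p1 => [|[]].
  by rewrite exprS; apply: midealM => //; exact: (subringX WW _ (mideal_val my)).
have ef' : f = y ^+ p * (1 - y^-1 ^+ p.-1).
  rewrite mulrBr mulr1 -ef; congr (_ - _).
  have -> : y ^+ p = y * y ^+ p.-1 by rewrite -exprS prednK // prime_gt0.
  by rewrite exprVn mulfK // expf_neq0.
have uy : vunit W (y ^+ p * t ^+ m).
  by apply: (vunit_mulr HW (vone_unit HW o)); rewrite mulrAC -ef'.
have [z uz] := kbar_val_pow HW uk y0 (vV Vy y0).
have e : p%:Z * z = - (M%:Z * m%:Z).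
  apply: (vunit_Xz_inj HW t0 mt (x := y ^+ (p * M))).
    have := vunitX HW p uz; rewrite expr_div_n -exprM mulnC.
    by rewrite [X in _ / X]exprnP exprz_exp [z * _]mulrC.
  have := vunitX HW M uy; rewrite exprMn -exprM -invr_expz invrK -PoszM -exprnP.
  by rewrite -[t ^+ m ^+ M]exprM [(m * M)%N]mulnC.
have : (p %| M * m)%N.
  have -> : (M * m)%N = `|(p%:Z * z)%R|%N by rewrite e abszN -PoszM.
  by rewrite abszM absz_nat dvdn_mulr.
by rewrite Euclid_dvdM // (negbTE pM).
Qed.

Let frobD (x y : Om) : (x - y) ^+ p = x ^+ p - y ^+ p.
Proof. by rewrite -!(pFrobenius_autE chp) pFrobenius_autB_comm //; exact: mulrC. Qed.

Lemma Fbar_pth_root c : Fb c -> exists2 c1, Fb c1 & c1 ^+ p = c.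
Proof.
move=> Fc; have p0 := prime_gt0 pp.
have /closed_rootP[c1 r1] : size ('X^p - c%:P) != 1%N.
  by rewrite size_XnsubC // eqSS -lt0n.
exists c1; last by move: r1; rewrite rootE hornerD hornerN hornerXn hornerC subr_eq0 => /eqP.
apply: (Fbar_root iota _ _ r1); last by apply/monic_neq0/monicXnsubC.
apply: (coefs_inB FR); first exact: (subringX (coefs_subring FR) _ (coefs_inX FR)).
exact: (coefs_inC FR).
Qed.

(** The only pole of A(T) is at infinity, and its order m is a multiple j p. Subtracting u^p - u
    with u = c1 T^j trades the leading term for one of degree j; c1 exists because Fbar is perfect.
    Without a pole, y is a root of X^p - X - a over Fbar. *)
Lemma artin_schreier_poly (A : {poly Om}) y : coefs_in Fb A -> V y -> y ^+ p - y = A.[T] -> kb y.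
Proof.
have [n] := ubnP (size A); elim: n A y => // n IH A y; rewrite ltnS => sA FA Vy e.
have [s1|s1] := leqP (size A) 1.
  apply: kbar_Fbar; have eA := size1_polyC s1.
  have sz : (size (- ('X + (A`_0)%:P))%R < size ('X^p : {poly Om}))%N.
    by rewrite size_polyXn size_polyN size_XaddC ltnS; exact: prime_gt1.
  apply: (Fbar_root iota (p := 'X^p - ('X + (A`_0)%:P))).
  - apply: (coefs_inB FR); first exact: (subringX (coefs_subring FR) _ (coefs_inX FR)).
    by apply: (coefs_inD FR); [exact: (coefs_inX FR)|exact: (coefs_inC FR (FA 0%N))].
  - by rewrite -size_poly_gt0 size_polyDl // size_polyXn.
  - rewrite rootE !(hornerD, hornerN, hornerXn, hornerX, hornerC) opprD addrA e eA.
    by rewrite hornerC coefC subrr.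
pose m := (size A).-1; have m0 : (0 < m)%N by rewrite /m -ltnS prednK // ltnW.
have A0 : A != 0 by rewrite -size_poly_gt0 ltnW.
have lA0 : lead_coef A != 0 by rewrite lead_coef_eq0.
have T0 : T != 0 := TT_neq0 iota.
have [W [HW mT]] := place_inf iota.
have /dvdnP[j em] : (p %| m)%N.
  apply: (artin_schreier_pole HW (uniformizer_inf HW mT) Vy e) => //.
  have o := vone_inf HW mT FA A0; have uN : vunit W (-1) by apply/(vunitN HW)/vunit1.
  rewrite /pinf -mulN1r exprMn exprVn.
  have -> : A.[T] * ((-1) ^+ m / T ^+ m) =
    A.[T] / (lead_coef A * T ^+ m) * (lead_coef A * (-1) ^+ m).
    by field; rewrite lA0 expf_neq0.
  apply: vunitM => //; first exact: vone_unit.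
  by apply: vunitM => //; [exact: (Fbar_vunit HW (FA _))|exact: vunitX].
have [c1 Fc1 ec1] := Fbar_pth_root (FA m).
have j0 : (0 < j)%N by move: m0; rewrite em muln_gt0 => /andP[].
have jm : (j < m)%N by rewrite em -{1}[j]muln1 ltn_pmul2l // prime_gt1.
pose u := c1 * T ^+ j.
have ku : kb u.
  by apply: (subringM kR); [exact: kbar_Fbar|exact: (subringX kR _ (kbar_TT iota))].
pose A' := A - (A`_m)%:P * 'X^m + c1%:P * 'X^j.
have FA' : coefs_in Fb A'.
  have FXn i : coefs_in Fb 'X^i := subringX (coefs_subring FR) i (coefs_inX FR).
  apply: (coefs_inD FR); last by apply: (coefs_inM FR) => //; exact: (coefs_inC FR).
  by apply: (coefs_inB FR) => //; apply: (coefs_inM FR) => //; exact: (coefs_inC FR (FA m)).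
have sA' : (size A' < n)%N.
  apply: leq_trans sA; rewrite -(prednK (ltnW s1)) ltnS; apply/leq_sizeP => i.
  rewrite -/m leq_eqVlt !coefD coefN !coefCM !coefXn => /orP[/eqP<-|lt].
    by rewrite eqxx mulr1 subrr add0r gtn_eqF // mulr0.
  rewrite nth_default; last by rewrite -(prednK (ltnW s1)).
  by rewrite !gtn_eqF ?mulr0 ?subr0 ?addr0 // (ltn_trans jm).
suff : kb (y - u) by move=> kyu; rewrite -(subrK u y); apply: (subringD kR).
apply: (IH A') => //; first by apply: (subringB VR) => //; apply: kV.
rewrite frobD opprB addrACA [- _ + _]addrC -[RHS]/(A'.[T]) /A' !(hornerD, hornerN, hornerM, hornerXn, hornerC).
have -> : u ^+ p = A`_m * T ^+ m by rewrite /u exprMn ec1 -exprM -em.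
by rewrite -e /u; ring.
Qed.

(* Poles are removed one at a time: their order m is divisible by p since y has no
   ramification, and subtracting u^p - u for a suitable u in Fbar(T) lowers m. *)
Lemma artin_schreier_descent y : V y -> kb (y ^+ p - y) -> kb y.
Proof.
move=> Vy [A [B [FA FB B0 e]]]; have [n] := ubnP (size B).
elim: n A B y FA FB B0 Vy e => // n IH A B y FA FB B0 Vy e; rewrite ltnS => sB.
have [s1|s1] := leqP (size B) 1.
  apply: (artin_schreier_poly (A := (B`_0)^-1%:P * A)) => //.
    apply: (coefs_inM FR) => //; apply: (coefs_inC FR); apply: (subfieldV FF); exact: FB.
  by rewrite e hornerM hornerC mulrC; congr (_^-1 * _); rewrite (size1_polyC s1) hornerC coefC.
have /closed_rootP[a ra] : size B != 1%N by rewrite gtn_eqF.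
have Fa : Fb a := Fbar_root iota FB B0 ra.
have Fx : coefs_in Fb ('X - a%:P) by apply: (coefs_inB FR); [exact: (coefs_inX FR)|exact: (coefs_inC FR)].
have mx := monicXsubC a.
have Ta : T - a != 0.
  by rewrite subr_eq0; apply/eqP => e0; apply: (TT_notin_Fbar (iota := iota)); rewrite e0.
have [m' [B1 nB1 eB]] := multiplicity_XsubC B a.
rewrite B0 /= in nB1.
have [m em] : exists m, m' = m.+1.
  case: m' eB => [|m'] eB; last by exists m'.
  by case/negP: nB1; move: ra; rewrite eB expr0 mulr1.
rewrite em in eB => {m' em}.
have FXm i : coefs_in Fb (('X - a%:P) ^+ i) := subringX (coefs_subring FR) i Fx.
have FB1 : coefs_in Fb B1 by apply: (monic_quotient FR _ (FXm m.+1) FB eB); exact: monic_exp.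
have B10 : B1 != 0 by apply: contraNneq B0 => B10; rewrite eB B10 mul0r.
pose B' := B1 * ('X - a%:P) ^+ m.
have eB' : B = B' * ('X - a%:P) by rewrite eB /B' exprSr mulrA.
have FB' : coefs_in Fb B' by apply: (coefs_inM FR).
have B'0 : B' != 0 by apply: contraNneq B0 => B'0; rewrite eB' B'0 mul0r.
have sB' : (size B' < n)%N.
  by apply: leq_trans sB; rewrite eB' (size_Mmonic B'0 mx) size_XsubC addnC.
have B'T := horner_TT_neq0 iota FB' B'0.
have B1T := horner_TT_neq0 iota FB1 B10.
have eBT : B.[T] = B'.[T] * (T - a) by rewrite eB' hornerM hornerXsubC.
have cancel A1 A' z : coefs_in Fb A1 -> A1 = A' * ('X - a%:P) -> V z ->
    z ^+ p - z = A1.[T] / B.[T] -> kb z.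
  move=> FA1 eA1 Vz ez; apply: (IH A' B') => //; first exact: (monic_quotient FR mx Fx FA1 eA1).
  by rewrite ez eA1 eBT hornerM hornerXsubC invfM mulrACA mulfV // mulr1.
have [/factor_theorem[A' eA]|nrA] := boolP (root A a); first exact: (cancel A A').
have [W [HW ma WT]] := place_finite iota Fa; have WW := HW.1.
have Wa : W a := Fbar_val HW Fa.
have unit_at (C : {poly Om}) : coefs_in Fb C -> ~~ root C a -> vunit W C.[T].
  move=> FC nC; have uC : vunit W C.[a].
    by apply: (Fbar_vunit HW) => //; apply: (coefs_in_horner FR).
  apply: (vunit_cong HW uC); rewrite -opprB; apply: midealN => //; apply: mideal_congH => // i.
  exact: (Fbar_val HW (FC i)).
have uk := uniformizer_finite HW Fa ma.
have ef : y ^+ p - y = A.[T] / B1.[T] / (T - a) ^+ m.+1.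
  by rewrite e eB hornerM horner_exp hornerXsubC invfM mulrA.
have /dvdnP[j ej] : (p %| m.+1)%N.
  apply: (artin_schreier_pole HW uk Vy ef) => //; rewrite divfK ?expf_neq0 //.
  by apply: vunit_div => //; apply: unit_at.
have j0 : (0 < j)%N by case: j ej.
have jm : (j <= m)%N by rewrite -ltnS ej -{1}[j]muln1 ltn_pmul2l // prime_gt1.
have Fc : Fb (A.[a] / B1.[a]) by apply: subfield_div => //; apply: (coefs_in_horner FR).
have [c1 Fc1 ec1] := Fbar_pth_root Fc.
have B1a : B1.[a] != 0 by [].
(* u^p has the same leading coefficient A(a) / B1(a) at its pole in a as y^p - y. *)
pose u := c1 / (T - a) ^+ j.
have ku : kb u.
  apply: (subfield_div kk); [exact: kbar_Fbar|apply: (subringX kR)].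
  by apply: (subringB kR); [exact: kbar_TT|exact: kbar_Fbar].
(* A1 is the numerator of y^p - y - (u^p - u) over the old denominator B. It vanishes at a, because
   j <= m leaves a factor T - a in its last term, so the denominator loses a factor. *)
pose A1 := A - (A.[a] / B1.[a])%:P * B1 + c1%:P * ('X - a%:P) ^+ (m.+1 - j) * B1.
have FA1 : coefs_in Fb A1.
  apply: (coefs_inD FR); last by apply: (coefs_inM FR) => //; apply: (coefs_inM FR) => //; exact: (coefs_inC FR).
  by apply: (coefs_inB FR) => //; apply: (coefs_inM FR) => //; exact: (coefs_inC FR).
have rA1 : root A1 a.
  rewrite rootE !(hornerD, hornerN, hornerM, hornerC, horner_exp, hornerX) divfK // subrr add0r.
  by rewrite subrr expr0n subn_eq0 leqNgt ltnS jm mulr0 mul0r.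
have [A' eA'] := factor_theorem _ _ rA1.
suff : kb (y - u) by move=> kyu; rewrite -(subrK u y); apply: (subringD kR).
have Vyu : V (y - u) by apply: (subringB VR) => //; apply: kV.
apply: (cancel A1 A') => //.
have eup : u ^+ p = A.[a] / B1.[a] / (T - a) ^+ m.+1.
  by rewrite /u expr_div_n ec1 -exprM -ej.
rewrite frobD (_ : _ - _ = (y ^+ p - y) - u ^+ p + u); last by ring.
rewrite ef eup.
rewrite eB /A1 !(hornerD, hornerN, hornerM, hornerC, horner_exp, hornerX) /u.
have -> : (T - a) ^+ m.+1 = (T - a) ^+ (m.+1 - j) * (T - a) ^+ j.
  by rewrite -exprD subnK // ltnW.
have Tm i : (T - a) ^+ i != 0 by rewrite expf_neq0.
by field; rewrite !Tm B1a B1T.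
Qed.

End ArtinSchreier.
End Descent.

(** * Characters and eigenspaces *)

(** Characters have complex values. Only the exponent of a fixed primitive root of unity of order
    #|A| is kept: it is additive modulo #|A| and can be used over any field. *)
Lemma abelian_separating (gT : finGroupType) (A : {group gT}) (g : gT) :
  abelian A -> g \in A -> g != 1%g -> exists chi : gT -> nat,
  {in A &, forall x y, chi (x * y)%g = chi x + chi y %[mod #|A|]} /\ chi g <> 0 %[mod #|A|].
Proof.
move=> abA gA g1.
have [i gi] : exists i : Iirr A, g \notin cfker 'chi_i.
  apply/existsP; rewrite -negb_forall; apply/negP => /forallP H.
  have : g \in \bigcap_i cfker 'chi[A]_i by apply/bigcapP => i _; exact: H.
  by rewrite TI_cfker_irr inE (negbTE g1).
have lin : 'chi_i \is a linear_char := char_abelianP A abA i.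
have [w wP] := C_prim_root_exists (cardG_gt0 A).
have ex x : exists j : nat, x \in A -> 'chi_i x = w ^+ j.
  have [xA|nA] := boolP (x \in A); last by exists 0%N.
  have e1 : 'chi_i x ^+ #|A| = 1.
    by rewrite -lin_charX // expg_cardG // lin_char1.
  by have [j ej] := prim_rootP wP e1; exists j.
pose chi x := sval (cid (ex x)).
have chiP x : x \in A -> 'chi_i x = w ^+ chi x := svalP (cid (ex x)).
exists chi; split.
  move=> x y xA yA; apply/eqP; rewrite -(eq_prim_root_expr wP) exprD -!chiP ?groupM //.
  by rewrite lin_charM.
move=> /eqP; rewrite -(eq_prim_root_expr wP) -chiP // expr0 => /eqP e.
by move/negP: gi; apply; rewrite cfkerEirr inE e lin_char1.
Qed.

(** At an element g of order p, a character nontrivial on g has an exponent not divisible by the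
    full power of p in the group order. Dividing all exponents by their largest common power of p
    leaves a nonzero additive map modulo p. *)
Lemma abelian_hom_mod (gT : finGroupType) (A : {group gT}) p :
  abelian A -> prime p -> (p %| #|A|)%N -> exists chi : gT -> nat,
  {in A &, forall x y, chi (x * y)%g = chi x + chi y %[mod p]} /\
  exists2 g, g \in A & ~~ (p %| chi g)%N.
Proof.
move=> abA pp pA; have [g gA og] := Cauchy pp pA.
have g1 : g != 1%g by rewrite -order_gt1 og prime_gt1.
have [chi [chiM chig]] := abelian_separating abA gA g1.
set N := #|A| in chiM chig pA; have N0 : (0 < N)%N by apply: cardG_gt0.
have chi1 : chi 1%g = 0 %[mod N].
  have := chiM _ _ (group1 A) (group1 A); rewrite mulg1 -[X in X = _ %[mod N]]addn0 => /eqP.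
  by rewrite eqn_modDl eq_sym => /eqP.
have chiX j : chi (g ^+ j)%g = (j * chi g)%N %[mod N].
  elim: j => [|j IH]; first by rewrite expg0 mul0n.
  by rewrite expgS chiM ?groupX // mulSn -modnDmr IH modnDmr.
have Npchi : (N %| p * chi g)%N by rewrite /dvdn -chiX -og expg_order chi1 mod0n.
have [m cop eN] := pfactor_coprime pp N0; set a := logn p N in eN.
(* Since p chi(g) vanishes modulo N, the part m of N prime to p divides chi(g); as chi(g) is nonzero
   modulo N, the p-part of N does not divide it. *)
have mchi : (m %| chi g)%N.
  have : (m %| p * chi g)%N by apply: dvdn_trans Npchi; rewrite eN dvdn_mulr.
  by rewrite Gauss_dvdr // coprime_sym.
have npa : ~~ (p ^ a %| chi g)%N.
  apply/negP => pa; apply: chig; apply/eqP; rewrite mod0n -/(dvdn _ _) eN Gauss_dvd ?mchi //.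
  by rewrite coprime_sym coprimeXl.
pose P b := [forall (x | x \in A), (p ^ b %| chi x)%N].
have P0 : exists b, P b by exists 0%N; apply/forall_inP => x _; rewrite expn0 dvd1n.
have bound b : P b -> (b <= a)%N.
  move=> /forall_inP/(_ g gA) Pb; rewrite leqNgt; apply/negP => lt; move/negP: npa; apply.
  by apply: dvdn_trans Pb; rewrite dvdn_exp2l // ltnW.
case: (ex_maxnP P0 bound) => b /forall_inP Pb maxb.
have ba : (b < a)%N.
  rewrite ltn_neqAle bound; last by apply/forall_inP.
  by rewrite andbT; apply: contraNneq npa => <-; exact: Pb.
have pb0 : (0 < p ^ b)%N by rewrite expn_gt0 prime_gt0.
exists (fun x => chi x %/ p ^ b)%N; split.
  move=> x y xA yA; apply/eqP.
  have := chiM _ _ xA yA => /(congr1 (fun i => i %% (p ^ b * p))%N) /=.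
  have d : (p ^ b * p %| N)%N by rewrite -expnSr eN dvdn_mull // dvdn_exp2l.
  rewrite !modn_dvdm // -{1}(divnK (Pb _ (groupM xA yA))) -{1}(divnK (Pb _ xA)) -{1}(divnK (Pb _ yA)).
  rewrite -mulnDl ![(_ * p ^ b)%N]mulnC -!muln_modr => /eqP.
  by rewrite eqn_pmul2l.
apply/exists_inP; rewrite -negb_forall_in; apply/negP => /forall_inP H.
have : P b.+1.
  apply/forall_inP => x xA; rewrite -(divnK (Pb _ xA)) expnS dvdn_pmul2r //.
  exact: H.
by move=> /maxb; rewrite ltnn.
Qed.

(** Taking the relation at a x and subtracting f_i0(a) times the relation at x removes the
    coefficient at i0 and multiplies the one at j by a nonzero factor; induction on the support then
    makes the latter vanish. *)
Lemma dedekind_independence (Om : fieldType) (I : finType) (f : I -> {rmorphism Om -> Om})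
    (K : Om -> Prop) (A : {set I}) (c : I -> Om) :
  is_subring K ->
  (forall i j, i \in A -> j \in A -> i != j -> exists2 a, K a & f i a != f j a) ->
  (forall x, K x -> \sum_(i in A) c i * f i x = 0) -> forall i, i \in A -> c i = 0.
Proof.
move=> KK dist; pose supp (c : I -> Om) := [set i in A | c i != 0].
have [n] := ubnP #|supp c|; elim: n c => // n IH c; rewrite ltnS => sc Hc.
have [/set0Pn[i0]|/negPn/eqP s0] := boolP (supp c != set0); last first.
  move=> i iA; apply/eqP/negPn/negP => ci.
  by have := in_set0 i; rewrite -s0 inE iA ci.
rewrite inE => /andP[i0A ci0].
have zero j : j \in A -> j != i0 -> c j = 0.
  move=> jA jn; have [a Ka neq] := dist _ _ jA i0A jn.
  pose c' i := c i * (f i a - f i0 a).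
  have : c' j = 0.
    apply: (IH c') => //.
      apply: leq_trans sc; apply: proper_card; apply/properP; split.
        by apply/subsetP => i; rewrite !inE /c' mulf_eq0 negb_or => /and3P[-> -> _].
      by exists i0; rewrite !inE ?i0A ?ci0 // /c' subrr mulr0 eqxx.
    move=> x Kx; have e1 := Hc _ (subringM KK Ka Kx); have e2 := Hc _ Kx.
    transitivity (\sum_(i in A) c i * f i (a * x) - f i0 a * \sum_(i in A) c i * f i x).
      rewrite mulr_sumr -sumrB.
      by apply: eq_bigr => i _; rewrite /c' rmorphM; ring.
    by rewrite e1 e2 mulr0 subrr.
  by move/eqP; rewrite mulf_eq0 subr_eq0 (negbTE neq) orbF => /eqP.
have := Hc _ (subring1 KK); rewrite (bigD1 i0) //= rmorph1 mulr1 big1 ?addr0 => [ci00|i /andP[iA ni]].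
  by move: ci0; rewrite ci00 eqxx.
by rewrite zero ?mul0r.
Qed.

Lemma primitive_root_exists (Om : closedFieldType) N : N%:R != 0 :> Om ->
  exists z : Om, N.-primitive_root z.
Proof.
move=> N0; have Ngt0 : (0 < N)%N by case: N N0 => //; rewrite eqxx.
have [rs ers] := closed_field_poly_normal ('X^N - 1 : {poly Om}).
have m1 : 'X^N - 1 \is @monic Om by rewrite -polyC1 monicXnsubC.
rewrite (monicP m1) scale1r in ers.
have sep : separable_poly ('X^N - 1 : {poly Om}) by apply: separable_Xn_sub_1.
have urs : uniq rs by rewrite -separable_prod_XsubC -ers.
have srs : size rs = N.
  apply: succn_inj; rewrite -(size_prod_XsubC rs id) /= -ers.
  by rewrite -polyC1 size_XnsubC.
have := @has_prim_root Om N rs Ngt0 _ urs; rewrite srs => /(_ _ (leqnn N)) H.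
have /hasP[z _ zP] : has N.-primitive_root rs; last by exists z.
apply: H; apply/allP => z zr; rewrite unity_rootE -subr_eq0.
have : root ('X^N - 1) z by rewrite ers root_prod_XsubC.
by rewrite rootE hornerD hornerN hornerXn hornerC.
Qed.

(** * Lagrange resolvents *)

Section Eigen.
Variables (Om : fieldType) (s : {rmorphism Om -> Om}) (M : nat) (eta : Om).
Hypotheses (etaP : M.-primitive_root eta) (seta : s eta = eta) (M0 : M%:R != 0 :> Om).

(** If s^M fixes y, this is M times the component of y in the eigenspace of s for the eigenvalue
    eta^i. *)
Definition eigenpart (y : Om) (i : nat) : Om :=
  \sum_(j < M) (eta ^+ (i * j))^-1 * iter j s y.

Let Mgt0 : (0 < M)%N. Proof. exact: prim_order_gt0 etaP. Qed.
Let eta0 : eta != 0.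
Proof.
apply/eqP => e0; have /eqP := prim_expr_order etaP.
by rewrite e0 expr0n gtn_eqF // eq_sym oner_eq0.
Qed.

Lemma eigenpart_eigen y i : iter M s y = y -> s (eigenpart y i) = eta ^+ i * eigenpart y i.
Proof.
move=> sM; rewrite rmorph_sum mulr_sumr /=.
pose g j := eta ^+ i * ((eta ^+ (i * j))^-1 * iter j s y).
have gM : g M = g 0%N.
  by rewrite /g sM mulnC exprM (prim_expr_order etaP) expr1n muln0 expr0.
transitivity (\sum_(j < M) g j.+1).
  apply: eq_bigr => j _; rewrite /g rmorphM fmorphV rmorphXn seta iterS.
  by rewrite mulnS exprD invfM mulrA mulrA mulfV ?mul1r // expf_neq0.
rewrite -[RHS](big_mkord xpredT g) -(big_mkord xpredT (fun j => g j.+1)).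
by rewrite -(big_add1 _ _ 0 M.+1 xpredT g) -(prednK Mgt0) [LHS]big_nat_recr //= [RHS]big_ltn // addrC prednK // gM.
Qed.

Lemma sum_eigenpart y : \sum_(i < M) eigenpart y i = M%:R * y.
Proof.
rewrite exchange_big /= (bigD1 (Ordinal Mgt0)) //= [X in _ + X]big1 ?addr0.
  rewrite (eq_bigr (fun=> y)) => [|i _]; last by rewrite muln0 expr0 invr1 mul1r.
  by rewrite sumr_const card_ord mulr_natl.
move=> j j0; rewrite -mulr_suml.
suff -> : \sum_(i < M) (eta ^+ (i * j))^-1 = 0 by rewrite mul0r.
pose w := (eta ^+ j)^-1.
have w1 : w != 1.
  by rewrite invr_eq1 -(prim_order_dvd etaP) gtnNdvd // lt0n.
have wM : w ^+ M = 1 by rewrite exprVn -exprM mulnC exprM (prim_expr_order etaP) expr1n invr1.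
rewrite (eq_bigr (fun i : 'I_M => w ^+ i)); last first.
  by move=> i _; rewrite mulnC exprM exprVn.
apply/eqP; have /eqP : (w - 1) * \sum_(i < M) w ^+ i = 0 by rewrite -subrX1 wM subrr.
by rewrite mulf_eq0 subr_eq0 (negbTE w1).
Qed.

End Eigen.

(** * Abelian extensions with trivial residue extension at infinity *)

Lemma uniformizer_sub (Om : fieldType) (W K K' : sset Om) pi :
  uniformizer W K' pi -> ssub K K' -> K pi -> uniformizer W K pi.
Proof. by move=> [_ p0 mp H] KK' Kpi; split => // x /KK'; apply: H. Qed.

Section Galois.
Variables (F : finFieldType) (Om : closedFieldType) (iota : {rmorphism ratfun F -> Om}).
Local Notation q := #|F|.
Local Notation k := (kimg iota).
Local Notation Fb := (@Fbar F Om).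
Local Notation kb := (kbar iota).
Local Notation T := (TT iota).
Hypothesis ak : algebraic_over k.
Let kk : is_subfield k := kimg_subfield iota.
Let kR := subfield_subring kk.
Let kbk : is_subfield kb := kbar_subfield iota.
Let kbR := subfield_subring kbk.
Let akb : algebraic_over kb := algebraic_overS (@kbar_kimg _ _ iota) ak.
Let FF : is_subfield Fb := Fbar_subfield iota.

Lemma card_natr0 m : (0 < m)%N -> (q ^ m)%:R = 0 :> Om.
Proof.
move=> m0; have [p pp [pO [e e0 ->]]] := card_pchar iota.
apply/eqP; rewrite -(dvdn_pcharf pO) -expnM; case: (e * m)%N (muln_gt0 e m) => [|j _].
  by rewrite e0 m0.
by rewrite expnS dvdn_mulr.
Qed.

(** A single element of L Fbar involves finitely many constants. A nonzero constant is a root of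
    unity of order dividing q^m - 1, which is prime to the characteristic, so adjoining it is an
    unramified Kummer step. *)
Lemma uniformizer_constants (W L : sset Om) pi : valuation_ring W -> is_subfield L ->
  ssub k L -> uniformizer W L pi -> uniformizer W (gen (sunion L Fb)) pi.
Proof.
move=> HW LL kL uL; have [Lpi pi0 mpi _] := uL.
split => //; first by apply: gen_incl; left.
suff H x : gen (sunion L Fb) x ->
    exists K, [/\ is_subfield K, ssub L K, uniformizer W K pi & K x].
  by move=> x /H[K [_ _ [_ _ _ HK] Kx]]; exact: HK.
pose P x := exists s : seq Om, (forall c, c \in s -> Fb c) /\ gen (sunion L (fun c => c \in s)) x.
have cat (s s' : seq Om) (y : Om) : gen (sunion L (fun c => c \in s)) y -> gen (sunion L (fun c => c \in s ++ s')) y.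
  by apply: gen_mono => z [|zs]; [left|right; rewrite mem_cat zs].
have cat' (s s' : seq Om) (y : Om) : gen (sunion L (fun c => c \in s')) y -> gen (sunion L (fun c => c \in s ++ s')) y.
  by apply: gen_mono => z [|zs]; [left|right; rewrite mem_cat zs orbT].
have GG (s : seq Om) := subfield_subring (gen_subfield (sunion L (fun c => c \in s))).
have PP : is_subfield P.
  split.
  - by exists [::]; split => //; exact: (subring0 (GG _)).
  - by exists [::]; split => //; exact: (subring1 (GG _)).
  - move=> y z [s [Fs Gy]] [s' [Fs' Gz]]; exists (s ++ s'); split.
      by move=> c; rewrite mem_cat => /orP[/Fs|/Fs'].
    by apply: (subringB (GG _)); [exact: cat|exact: cat'].
  - move=> y z [s [Fs Gy]] [s' [Fs' Gz]]; exists (s ++ s'); split.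
      by move=> c; rewrite mem_cat => /orP[/Fs|/Fs'].
    by apply: (subringM (GG _)); [exact: cat|exact: cat'].
  - move=> y [s [Fs Gy]]; exists s; split => //; exact: (subfieldV (gen_subfield _) Gy).
have LFP : ssub (sunion L Fb) P.
  move=> y [Ly|Fy]; first by exists [::]; split => //; apply: gen_incl; left.
  exists [:: y]; split; first by move=> c; rewrite inE => /eqP ->.
  by apply: gen_incl; right; rewrite mem_head.
move=> /(gen_min PP LFP)[s [Fs Gx]].
have [K [KK LK uK sK]] : exists K, [/\ is_subfield K, ssub L K, uniformizer W K pi &
    forall c, c \in s -> K c].
  elim: s Fs {Gx} => [|c s IH] Fs; first by exists L; split.
  have [K [KK LK uK sK]] := IH (fun y ys => Fs y (mem_behead (s := c :: s) ys)).
  have [c0|c0] := eqVneq c 0.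
    exists K; split => // y; rewrite inE => /orP[/eqP->|/sK//].
    by rewrite c0; exact: (subring0 (subfield_subring KK)).
  have Fc := Fs c (mem_head _ _); have [m m0 em] := Fc.
  have kK : ssub k K by move=> y /kL/LK.
  exists (adjoin1 K c); split.
  - exact: gen_subfield.
  - by move=> y /LK; exact: sub_adjoin1.
  - have gt0 := card_exp_gt0 F m.
    apply: (uniformizer_kummer HW kk ak KK kK uK (u := c) (M := (q ^ m).-1)).
    + exact: (Fbar_vunit HW Fc c0).
    + suff -> : c ^+ (q ^ m).-1 = 1 by exact: (subring1 (subfield_subring KK)).
      by apply: (mulfI c0); rewrite -exprS prednK // em mulr1.
    + rewrite -subn1 natrB // card_natr0 // sub0r; exact/(vunitN HW)/vunit1.
  - move=> y; rewrite inE => /orP[/eqP->|/sK]; [exact: mem_adjoin1|exact: sub_adjoin1].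
exists K; split => //; apply: (gen_min KK _ Gx) => y [/LK//|/sK//].
Qed.

Lemma kbar_sub_gen (L : sset Om) : ssub k L -> ssub kb (gen (sunion L Fb)).
Proof.
move=> kL _ [p [d [Fp Fd d0 ->]]].
have GG := gen_subfield (sunion L Fb).
have GT : gen (sunion L Fb) T by apply: gen_incl; left; apply: kL; exact: kimg_ev.
by apply: (subfield_div GG); apply: (coefs_in_horner (subfield_subring GG)) => // i;
  apply: gen_incl; right.
Qed.

Definition constF : sset Om := fun x => exists c : F, x = cF iota c.

Lemma constF_subfield : is_subfield constF.
Proof.
split; [by exists 0; rewrite rmorph0|by exists 1; rewrite rmorph1| | |].
- by move=> _ _ [a ->] [b ->]; exists (a - b); rewrite rmorphB.
- by move=> _ _ [a ->] [b ->]; exists (a * b); rewrite rmorphM.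
- by move=> _ [a ->]; exists a^-1; rewrite fmorphV.
Qed.

Lemma constF_kimg : ssub constF k. Proof. by move=> _ [c ->]; exact: kimg_cF. Qed.
Lemma constF_Fbar : ssub constF Fb. Proof. by move=> _ [c ->]; exact: Fbar_cF. Qed.

Implicit Types (s t : {rmorphism Om -> Om}).

Lemma fixes_kP s : fixes_k iota s <-> forall c, k c -> s c = c.
Proof. by split=> [H _ [c ->]//|H c]; apply: H; exists c. Qed.

Lemma rmorph_Fbar s c : Fb c -> Fb (s c).
Proof. by move=> [m m0 e]; exists m => //; rewrite -rmorphXn e. Qed.

(** s fixes T and maps Fbar into itself, so it preserves the degrees of numerator and denominator
    and with them the order at infinity. Nothing is claimed about the image of W under s. *)
Lemma galois_inf (W : sset Om) s x : valuation_ring W -> mideal W T^-1 -> fixes_k iota s ->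
  kb x -> x != 0 -> vunit W (s x / x).
Proof.
move=> HW mT /fixes_kP fs [p [d [Fp Fd d0 ->]]] x0.
have p0 : p != 0 by apply: contraNneq x0 => ->; rewrite horner0 mul0r.
have sT : s T = T by apply: fs; exact: kimg_ev.
have main (r : {poly Om}) : coefs_in Fb r -> r != 0 -> vunit W (s r.[T] / r.[T]).
  move=> Fr r0; have T0 := TT_neq0 iota.
  have Fsr : coefs_in Fb (map_poly s r) by move=> i; rewrite coef_map; exact: rmorph_Fbar.
  have sr0 : map_poly s r != 0 by rewrite map_poly_eq0.
  have lr0 : lead_coef r != 0 by rewrite lead_coef_eq0.
  have uc : vunit W (s (lead_coef r) / lead_coef r).
    apply: vunit_div => //; apply: (Fbar_vunit HW) => //; try exact: (Fr (size r).-1).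
      by apply: rmorph_Fbar; exact: (Fr (size r).-1).
    by rewrite fmorph_eq0.
  have o1 := vone_inf HW mT Fr r0; have o2 := vone_inf HW mT Fsr sr0.
  have := vunitM HW (vunit_div HW (vone_unit HW o2) (vone_unit HW o1)) uc.
  rewrite size_map_poly lead_coef_map -horner_map sT; congr (vunit W _).
  field; rewrite lr0 expf_neq0 // fmorph_eq0 lr0 /=.
  by rewrite (horner_TT_neq0 iota Fr r0).
rewrite fmorph_div.
have -> : s p.[T] / s d.[T] / (p.[T] / d.[T]) = (s p.[T] / p.[T]) / (s d.[T] / d.[T]).
  by field; rewrite fmorph_eq0 !(horner_TT_neq0 iota).
by apply: vunit_div => //; apply: main.
Qed.

(** * Splitting at infinity excludes new constants *)

Section Split.
Variable L : sset Om.
Hypotheses (LL : is_subfield L) (kL : ssub k L).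
Hypothesis resL : forall W, valuation_ring W -> mideal W T^-1 -> residues_in W constF L.

(* Every element of L has an expansion in 1/T with coefficients in F; an element of the
   constant extension kb and its conjugates therefore have the same expansion. *)
Lemma split_kbar_fixed s x : fixes_k iota s -> L x -> kb x -> s x = x.
Proof.
move=> fs; have [W [HW mT]] := place_inf iota; have WW := HW.1.
have fs' := (fixes_kP s).1 fs; have LR := subfield_subring LL.
have uk := uniformizer_inf HW mT; have [kbp p0 mp _] := uk.
have kp : k (pinf iota) by case: (uniformizer_inf_kimg HW mT).
(* Induction on the precision N: write y = c + pinf z with c in F. As s fixes c and [pinf], the
   difference s y - y equals pinf (s z - z). *)
have main N : forall x, L x -> kb x -> W x -> W ((s x - x) / pinf iota ^+ N).
  elim: N => [|N IH] y Ly ky Wy.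
    rewrite expr0 divr1; apply: (subringB WW) => //.
    have [->|y0] := eqVneq y 0; first by rewrite rmorph0; exact: (subring0 WW).
    rewrite -(divfK y0 (s y)); apply: (subringM WW) => //; apply: vunit_val.
    exact: galois_inf.
  have [c Fc mc] : exists2 c, constF c & mideal W (y - c).
    have [uy|my] := val_cases Wy; first exact: (resL HW mT Ly uy).
    by exists 0; [exact: (subring0 (subfield_subring constF_subfield))|rewrite subr0].
  pose z := (y - c) / pinf iota.
  have kc := constF_kimg Fc.
  have kbyc : kb (y - c) by apply: (subringB kbR) => //; apply: kbar_kimg.
  have Lz : L z by apply: subfield_div => //; [apply: (subringB LR) => //; exact: kL|exact: kL].
  have kbz : kb z by apply: subfield_div.
  have Wz : W z by apply: (uniformizer_val HW uk).
  have := IH z Lz kbz Wz; congr (W _).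
  rewrite /z fmorph_div rmorphB /= (fs' _ kc) (fs' _ kp) exprS; field.
  by rewrite p0 expf_neq0.
have int y : L y -> kb y -> W y -> s y = y.
  move=> Ly ky Wy; apply/eqP; rewrite -subr_eq0; apply/eqP.
  apply: (eq_of_deep_cong HW kbk akb uk) => N; exact: main.
move=> Lx kx; have [Wx|nWx] := pselect (W x); first exact: int.
have [x0 _] := nval_mideal HW nWx.
have x'0 : x^-1 != 0 by rewrite invr_eq0.
have [N WN] := archimedean HW kbk akb uk x'0; rewrite invrK in WN.
have e : s (pinf iota ^+ N * x) = pinf iota ^+ N * x.
  apply: int => //.
    by apply: (subringM LR) => //; apply: (subringX LR); exact: kL.
  by apply: (subringM kbR) => //; apply: (subringX kbR).
by apply: (mulfI (expf_neq0 N p0)); rewrite -e rmorphM rmorphXn /= (fs' _ kp).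
Qed.

End Split.
End Galois.

Lemma natr_mod_pchar (R : nzRingType) p m n : p \in [pchar R] -> m = n %[mod p] ->
  m%:R = n%:R :> R.
Proof.
move=> pR e; rewrite (divn_eq m p) (divn_eq n p) e !natrD !natrM.
by rewrite (pcharf0 pR) !mulr0.
Qed.

Section AbelianExtension.
Variables (F : finFieldType) (Om : closedFieldType) (iota : {rmorphism ratfun F -> Om}).
Local Notation q := #|F|.
Local Notation k := (kimg iota).
Local Notation Fb := (@Fbar F Om).
Local Notation kb := (kbar iota).
Local Notation T := (TT iota).
Hypothesis ak : algebraic_over k.
Let kk : is_subfield k := kimg_subfield iota.
Let kR := subfield_subring kk.
Let kbk : is_subfield kb := kbar_subfield iota.
Let kbR := subfield_subring kbk.
Let akb : algebraic_over kb := algebraic_overS (@kbar_kimg _ _ iota) ak.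

Variable ks : sset Om.
Hypothesis Hks : abelian_ext iota ks.
Let ksf : is_subfield ks. Proof. by case: Hks => [[]]. Qed.
Let ksR := subfield_subring ksf.
Let kks : ssub k ks. Proof. by case: Hks => [[]]. Qed.
Let stab : forall s : {rmorphism Om -> Om}, fixes_k iota s -> forall x, ks x -> ks (s x).
Proof. by case: Hks. Qed.
Let comm : forall s t : {rmorphism Om -> Om}, fixes_k iota s -> fixes_k iota t ->
  forall x, ks x -> s (t x) = t (s x).
Proof. by case: Hks. Qed.

Lemma abelian_ext_sep x : ks x -> exists p : {poly Om},
  [/\ coefs_in k p, separable_poly p, p != 0 & root p x].
Proof.
case: Hks => _ _ + _ => /[apply] -[p [p0 sp px]].
exists (map_poly iota p); split => //.
- by move=> i; rewrite coef_map; exists p`_i.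
- by rewrite separable_map.
- by rewrite map_poly_eq0.
Qed.

Lemma abelian_ext_fixed (K : sset Om) x : is_subfield K -> ssub k K -> ks x ->
  (forall s : {rmorphism Om -> Om}, (forall c, K c -> s c = c) -> s x = x) -> K x.
Proof.
move=> KK kK /abelian_ext_sep[p [kp sp _ px]] fx.
by apply: (fixed_separable KK (algebraic_overS kK ak) fx _ sp px) => i; apply: kK.
Qed.

(** Z collects the roots lying in ks of polynomials over k satisfied by a finite spanning family. It
    is finite and stable, and it determines an endomorphism over k on all of ks, so that actions on
    ks can be read as permutations of Z. *)
Lemma stable_root_set : exists Z : seq Om, [/\ forall z, z \in Z -> ks z,
  forall s : {rmorphism Om -> Om}, fixes_k iota s -> forall z, z \in Z -> s z \in Z &
  forall s t : {rmorphism Om -> Om}, fixes_k iota s -> fixes_k iota t ->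
    (forall z, z \in Z -> s z = t z) -> forall x, ks x -> s x = t x].
Proof.
have [[_ _ [sl [slks span]]] _ _ _] := Hks.
have one x : ks x -> exists Z : seq Om, [/\ x \in Z, forall z, z \in Z -> ks z &
    forall s : {rmorphism Om -> Om}, fixes_k iota s -> forall z, z \in Z -> s z \in Z].
  move=> kx; have [p [kp _ p0 px]] := abelian_ext_sep kx.
  have [rs ers] := closed_field_poly_normal p.
  have mem_rs z : (z \in rs) = root p z.
    by rewrite ers rootZ ?lead_coef_eq0 // root_prod_XsubC.
  exists [seq z <- rs | `[< ks z >]]; split.
  - by rewrite mem_filter mem_rs px andbT; apply/asboolP.
  - by move=> z; rewrite mem_filter => /andP[/asboolP].
  - move=> s fs z; rewrite !mem_filter !mem_rs => /andP[/asboolP kz pz].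
    apply/andP; split; first by apply/asboolP; exact: stab.
    have ep : map_poly s p = p.
      apply/polyP => i; rewrite coef_map /=; exact: (proj1 (fixes_kP iota s) fs _ (kp i)).
    by rewrite -ep rootE horner_map (rootP pz) rmorph0.
have [Z [slZ ZK Zst]] : exists Z : seq Om, [/\ forall y, y \in sl -> y \in Z,
    forall z, z \in Z -> ks z &
    forall s : {rmorphism Om -> Om}, fixes_k iota s -> forall z, z \in Z -> s z \in Z].
  elim: sl slks {span} => [|y sl IH] slks; first by exists [::].
  have [Z [slZ ZK Zst]] := IH (fun z zs => slks z (mem_behead (s := y :: sl) zs)).
  have [Y [yY YK Yst]] := one y (slks y (mem_head _ _)).
  exists (Y ++ Z); split.
  - by move=> z; rewrite inE mem_cat => /orP[/eqP->|/slZ->]; rewrite ?yY ?orbT.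
  - by move=> z; rewrite mem_cat => /orP[/YK|/ZK].
  - by move=> s fs z; rewrite !mem_cat => /orP[/(Yst s fs)->|/(Zst s fs)->]; rewrite ?orbT.
exists Z; split => // s t fs ft agree x /span[c ->].
rewrite !rmorph_sum; apply: eq_bigr => i _; rewrite !rmorphM /= fs ft; congr (_ * _).
by apply: agree; apply: slZ; exact: mem_nth.
Qed.

Definition fixes_kbar (s : {rmorphism Om -> Om}) := forall c, kb c -> s c = c.

Lemma fixes_kbar_k s : fixes_kbar s -> fixes_k iota s.
Proof. by move=> H c; apply: H; apply: kbar_kimg; exists c. Qed.

(** * The group induced on ks by the endomorphisms over Fbar(T) *)

Section Permutations.
Variable Z : seq Om.
Hypotheses (ZK : forall z, z \in Z -> ks z)
  (Zst : forall s : {rmorphism Om -> Om}, fixes_k iota s -> forall z, z \in Z -> s z \in Z)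
  (Zdet : forall s t : {rmorphism Om -> Om}, fixes_k iota s -> fixes_k iota t ->
    (forall z, z \in Z -> s z = t z) -> forall x, ks x -> s x = t x).
Implicit Types (s t : {rmorphism Om -> Om}) (g h : {perm seq_sub Z}).

Definition induces s g := forall z : seq_sub Z, ssval (g z) = s (ssval z).

Lemma induces_exists s : fixes_k iota s -> exists g, induces s g.
Proof.
move=> fs; pose f (z : seq_sub Z) := SeqSub (Zst fs (ssvalP z)).
have fI : injective f by move=> x y /(congr1 (@ssval _ _)) /= /fmorph_inj; exact: val_inj.
by exists (perm fI) => z; rewrite permE.
Qed.

Lemma induces_agree s t g : fixes_k iota s -> fixes_k iota t -> induces s g -> induces t g ->
  forall x, ks x -> s x = t x.
Proof.
move=> fs ft Hs Ht; apply: Zdet => // z zZ.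
by have := Hs (SeqSub zZ); rewrite Ht.
Qed.

(** The Galois group of the compositum of ks and Fbar(T) over Fbar(T), realised by permutations of
    Z. *)
Definition galset : {set {perm seq_sub Z}} := [set g | `[< exists2 s, fixes_kbar s & induces s g >]].

Lemma galsetP g : reflect (exists2 s, fixes_kbar s & induces s g) (g \in galset).
Proof. by rewrite inE; apply: asboolP. Qed.

Lemma induces_comp s t g h : induces s g -> induces t h -> induces (t \o s) (g * h)%g.
Proof. by move=> Hs Ht z; rewrite permM Ht Hs. Qed.

Lemma galset_group : group_set galset.
Proof.
apply/group_setP; split.
  apply/galsetP; exists (idfun : {rmorphism Om -> Om}) => // z; by rewrite perm1.
move=> g h /galsetP[s fs Hs] /galsetP[t ft Ht]; apply/galsetP; exists (t \o s).
  by move=> c kc /=; rewrite fs // ft.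
exact: induces_comp.
Qed.
Canonical galgroup := Group galset_group.

Lemma galgroup_abelian : abelian galgroup.
Proof.
apply/centsP => g /galsetP[s fs Hs] h /galsetP[t ft Ht].
apply/permP => z; apply: val_inj; rewrite !permM /= (Ht (g z)) (Hs z) (Hs (h z)) (Ht z).
by apply: comm; [exact: fixes_kbar_k|exact: fixes_kbar_k|apply: ZK; exact: ssvalP].
Qed.

Lemma gal_rep_exists g : exists s, g \in galset -> fixes_kbar s /\ induces s g.
Proof.
have [/galsetP[s fs Hs]|_] := boolP (g \in galset); first by exists s.
by exists idfun.
Qed.
Definition gal_rep g : {rmorphism Om -> Om} := sval (cid (gal_rep_exists g)).
Lemma gal_repP g : g \in galset -> fixes_kbar (gal_rep g) /\ induces (gal_rep g) g.
Proof. exact: (svalP (cid (gal_rep_exists g))). Qed.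

Lemma gal_rep_comp s g h x : fixes_kbar s -> induces s h -> h \in galset -> g \in galset ->
  ks x -> s (gal_rep g x) = gal_rep (g * h)%g x.
Proof.
move=> fs Hs hA gA; have [fg Hg] := gal_repP gA.
have [fgh Hgh] := gal_repP (groupM (gA : g \in galgroup) (hA : h \in galgroup)).
have fsg : fixes_k iota (s \o gal_rep g).
  by move=> c /=; rewrite (fixes_kbar_k fg) (fixes_kbar_k fs).
exact: (induces_agree fsg (fixes_kbar_k fgh) (induces_comp Hg Hs) Hgh).
Qed.

Lemma gal_sum_shift (G : {perm seq_sub Z} -> Om) h : h \in galset ->
  \sum_(g in galset) G (g * h)%g = \sum_(g in galset) G g.
Proof.
move=> hA; rewrite [RHS](reindex_inj (mulIg h)); apply: eq_bigl => g.
by rewrite (groupMr g (hA : h \in galgroup)).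
Qed.

Lemma gal_rep_independent (c : {perm seq_sub Z} -> Om) :
  (exists2 g, g \in galset & c g != 0) ->
  exists2 x, ks x & \sum_(g in galset) c g * gal_rep g x != 0.
Proof.
move=> [g gA cg]; apply: contrapT => no; move/eqP: cg; apply.
apply: (dedekind_independence (f := gal_rep) (c := c) ksR _ _ gA) => [g1 g2 A1 A2 ne|x kx].
  have [[z neq]|all] := pselect (exists z : seq_sub Z, g1 z != g2 z).
    exists (ssval z); first by apply: ZK; exact: ssvalP.
    rewrite -(gal_repP A1).2 -(gal_repP A2).2; apply: contra neq => /eqP e.
    by apply/eqP; exact: val_inj.
  case/eqP: ne; apply/permP => z; apply/eqP; apply: contrapT => /negP ne.
  by apply: all; exists z.
by apply/eqP; apply: contrapT => /negP ne; apply: no; exists x.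
Qed.

(** * Exponent M and Kummer generation of ks *)

Section Exponent.
Variables (M : nat) (V : sset Om).
Hypotheses (MF : (M %| q.-1)%N) (VV : is_subfield V) (kbV : ssub kb V) (ksV : ssub ks V).
Hypothesis vV : forall y, V y -> y != 0 -> kbar_val iota M y.

Let qgt : (1 < q)%N. Proof. exact: finNzRing_gt1. Qed.

Lemma exponent_prime_to_p p : p \in [pchar Om] -> ~~ (p %| M)%N.
Proof.
move=> pO; apply/negP => pM; have q0 := @card_natr0 _ _ iota 1 isT.
rewrite expn1 in q0; have pq : (p %| q)%N by rewrite (dvdn_pcharf pO) q0.
have : (p %| q.-1.+1)%N by rewrite prednK // ltnW.
rewrite -addn1 dvdn_addr ?(dvdn_trans pM MF) // dvdn1 => /eqP p1.
by have := pcharf_prime pO; rewrite p1.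
Qed.

(* A character of order p yields an element y of ks with s y = y + chi s, so that y^p - y is
   in kbar, and then y itself by descent. *)
Lemma galgroup_pchar_free p : p \in [pchar Om] -> ~~ (p %| #|galgroup|)%N.
Proof.
move=> pO; have pp := pcharf_prime pO; apply/negP => pA.
have [chi [chiM [g0 g0A g0n]]] := abelian_hom_mod galgroup_abelian pp pA.
have chiMr g h : g \in galset -> h \in galset ->
    (chi (g * h)%g)%:R = (chi g)%:R + (chi h)%:R :> Om.
  by move=> gA hA; rewrite -natrD; apply: (natr_mod_pchar pO); exact: chiM.
have [th kth tr0] : exists2 x, ks x & \sum_(g in galset) 1 * gal_rep g x != 0.
  by apply: gal_rep_independent; exists 1%g; [exact: group1 galgroup|rewrite oner_eq0].
set Tr := \sum_(g in galset) _ in tr0.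
(* Additive Hilbert 90: a group element h turns S into S - chi(h) Tr and fixes Tr, so - S / Tr is
   shifted by chi(h). The trace Tr does not vanish for this choice of th, by independence. *)
pose S := \sum_(g in galset) (chi g)%:R * gal_rep g th.
have krep g : g \in galset -> ks (gal_rep g th).
  by move=> gA; apply: stab => //; apply: fixes_kbar_k; case: (gal_repP gA).
pose y := - S / Tr.
have ky : ks y.
  apply: (subfield_div ksf).
    apply: (subringN ksR); apply: (subring_sum ksR) => g gA; apply: (subringM ksR); last exact: krep.
    exact: (subring_nat ksR).
  by apply: (subring_sum ksR) => g gA; rewrite mul1r; exact: krep.
have sy s h : fixes_kbar s -> induces s h -> h \in galset -> s y = y + (chi h)%:R.
  move=> fs Hs hA.
  have sTr : s Tr = Tr.
    rewrite /Tr rmorph_sum -[RHS](gal_sum_shift (fun g => 1 * gal_rep g th) hA).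
    by apply: eq_bigr => g gA; rewrite rmorphM rmorph1 (gal_rep_comp fs Hs).
  have sS : s S = S - (chi h)%:R * Tr.
    rewrite /S -[X in _ = X - _](gal_sum_shift _ hA) /Tr.
    rewrite -[X in _ = _ - _ * X](gal_sum_shift (fun g => 1 * gal_rep g th) hA).
    rewrite mulr_sumr -sumrB rmorph_sum; apply: eq_bigr => g gA.
    by rewrite rmorphM rmorph_nat (gal_rep_comp fs Hs) // chiMr //; ring.
  by rewrite /y fmorph_div rmorphN sTr sS; field.
have galh s : fixes_kbar s -> exists2 h, h \in galset & induces s h.
  move=> fs; have [h Hh] := induces_exists (fixes_kbar_k fs).
  by exists h => //; apply/galsetP; exists s.
have kby : kb y.
  apply: (artin_schreier_descent VV kbV vV pO (exponent_prime_to_p pO) (ksV ky)).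
  apply: abelian_ext_fixed => //; first exact: kbar_kimg.
    by apply: (subringB ksR) => //; apply: (subringX ksR).
  move=> s fs; have [h hA Hh] := galh s fs.
  rewrite rmorphB rmorphXn /= (sy s h) // -!(pFrobenius_autE pO).
  rewrite pFrobenius_autD_comm; last exact: mulrC.
  by rewrite pFrobenius_aut_nat opprD addrACA subrr addr0.
have [s fs Hs] := galsetP _ g0A.
have := sy s g0 fs Hs g0A; rewrite fs // -[LHS]addr0 => /addrI/esym/eqP.
by rewrite -(dvdn_pcharf pO) (negbTE g0n).
Qed.

(** Let h be the permutation of s. If h^M is not 1, some character chi is nonzero at h^M. The group
    order N is prime to the characteristic, so Fbar contains a root of unity zeta of order N, and
    the resolvent Y of chi satisfies s Y = zeta^chi(h) Y. A power of Y lies in Fbar(T), so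
    [kummer_descent] puts Y^M there; then M chi(h) vanishes modulo N, a contradiction. *)
Lemma fixes_kbar_exponent s x : (0 < M)%N -> fixes_kbar s -> ks x -> iter M s x = x.
Proof.
move=> M0 fs kx; have [p pp [pO _]] := card_pchar iota.
have iterP j : exists t : {rmorphism Om -> Om}, forall z, t z = iter j s z.
  elim: j => [|j [t Ht]]; first by exists idfun.
  by exists (s \o t) => z /=; rewrite Ht.
have [h Hh] := induces_exists (fixes_kbar_k fs).
have hA : h \in galset by apply/galsetP; exists s.
have [t Ht] := iterP M.
have ft : fixes_kbar t.
  by move=> c kc; rewrite Ht; elim: (M) => [//|j IH]; rewrite iterS IH fs.
have ind_t : induces t (h ^+ M)%g.
  move=> z; rewrite Ht; elim: (M) => [|j IH]; first by rewrite expg0 perm1.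
  by rewrite expgSr permM Hh IH iterS.
have [hM1|hM] := eqVneq (h ^+ M)%g 1%g.
  rewrite -Ht -[RHS]/((idfun : {rmorphism Om -> Om}) x).
  apply: (induces_agree (fixes_kbar_k ft) _ ind_t) => // z.
  by rewrite hM1 perm1.
have hMA : (h ^+ M)%g \in galgroup by rewrite groupX.
have [chi [chiM chih]] := abelian_separating galgroup_abelian hMA hM.
set N := #|galgroup| in chiM chih.
have N0 : N%:R != 0 :> Om by rewrite -(dvdn_pcharf pO) galgroup_pchar_free.
have Ngt0 : (0 < N)%N by apply: cardG_gt0.
have [zeta zP] := primitive_root_exists N0.
have z0 : zeta != 0.
  apply/eqP => e0; have /eqP := prim_expr_order zP.
  by rewrite e0 expr0n gtn_eqF // eq_sym oner_eq0.
have Fz : Fb zeta.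
  have FR := subfield_subring (Fbar_subfield iota).
  apply: (Fbar_root iota (p := 'X^N - 1%:P)).
  - apply: (coefs_inB FR); first exact: (subringX (coefs_subring FR) _ (coefs_inX FR)).
    exact: (coefs_inC FR (subring1 FR)).
  - exact: monic_neq0 (monicXnsubC _ Ngt0).
  - by rewrite rootE hornerD hornerN hornerXn hornerC (prim_expr_order zP) subrr.
have kz : kb zeta by apply: kbar_Fbar.
have chiX g j : g \in galgroup -> (chi (g ^+ j)%g = j * chi g %[mod N])%N.
  move=> gA; elim: j => [|j IH].
    have := chiM _ _ (group1 galgroup) (group1 galgroup).
    rewrite mulg1 -[X in X = _ %[mod N]]addn0 => /eqP; rewrite eqn_modDl => /eqP <-.
    by rewrite mul0n.
  by rewrite expgS chiM ?groupX // mulSn -modnDmr IH modnDmr.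
have zM g g' : g \in galset -> g' \in galset ->
    zeta ^+ chi (g * g')%g = zeta ^+ chi g * zeta ^+ chi g'.
  move=> gA gA'; rewrite -exprD; apply/eqP; rewrite (eq_prim_root_expr zP); apply/eqP; exact: chiM.
have [th kth Y0] : exists2 x, ks x & \sum_(g in galset) (zeta ^+ chi g)^-1 * gal_rep g x != 0.
  apply: (gal_rep_independent (c := fun g => (zeta ^+ chi g)^-1)).
  by exists 1%g; [exact: group1 galgroup|rewrite invr_eq0 expf_neq0].
set Y := \sum_(g in galset) _ in Y0.
have VY : V Y.
  apply: (subring_sum (subfield_subring VV)) => g gA; apply: (subringM (subfield_subring VV)).
    by apply: kbV; apply: (subfieldV kbk); apply: (subringX kbR).
  by apply: ksV; apply: stab => //; apply: fixes_kbar_k; case: (gal_repP gA).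
have sY s' h' : fixes_kbar s' -> induces s' h' -> h' \in galset -> s' Y = zeta ^+ chi h' * Y.
  move=> fs' Hs' hA'; rewrite /Y rmorph_sum mulr_sumr.
  rewrite -[RHS](gal_sum_shift (fun g => zeta ^+ chi h' * ((zeta ^+ chi g)^-1 * gal_rep g th)) hA').
  apply: eq_bigr => g gA; rewrite rmorphM fmorphV rmorphXn /= (fs' _ kz) (gal_rep_comp fs' Hs') //.
  by rewrite zM // invfM; field; rewrite !expf_neq0.
(* Y^N is fixed by all endomorphisms over Fbar(T), which gives membership only up to a power of p;
   [kummer_descent] accepts any positive exponent. *)
have [e kbYe] : exists e, kb ((Y ^+ N) ^+ (p ^ e)).
  apply: (fixed_pchar kbk akb pO) => s' fs'.
  have [h' Hh'] := induces_exists (fixes_kbar_k fs').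
  have hA' : h' \in galset by apply/galsetP; exists s'.
  by rewrite rmorphXn /= (sY s' h') // exprMn exprAC (prim_expr_order zP) expr1n mul1r.
have kbYM : kb (Y ^+ M).
  rewrite -exprM in kbYe; apply: (kummer_descent _ Y0 kbYe); last exact: vV.
  by rewrite muln_gt0 Ngt0 expn_gt0 prime_gt0.
have : s (Y ^+ M) = Y ^+ M by apply: fs.
rewrite rmorphXn /= (sY s h) // exprMn -[RHS]mul1r => /(mulIf (expf_neq0 M Y0)).
rewrite -exprM => /eqP; rewrite -(prim_order_dvd zP) => dN.
by case: chih; rewrite chiX // mulnC mod0n; apply/eqP.
Qed.

(** The group elements commute and have M-th power 1 on ks, so every element of ks is a sum of joint
    eigenvectors y. For these y^M is fixed and so lies both in ks and in Fbar(T), that is in k. The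
    induction diagonalises one group element after the other, with C any property stable under
    sums. *)
Lemma kummer_generated (C : Om -> Prop) : (0 < M)%N ->
  (forall x, ks x -> kb x -> k x) ->
  (forall x y, C x -> C y -> C (x + y)) -> (forall y, ks y -> k (y ^+ M) -> C y) ->
  forall x, ks x -> C x.
Proof.
move=> M0 inter CD Ck.
have MO : M%:R != 0 :> Om.
  have [p pp [pO _]] := card_pchar iota.
  by rewrite -(dvdn_pcharf pO) exponent_prime_to_p.
have [eta eP] := primitive_root_exists MO.
have keta : k eta.
  have eq : eta ^+ q = eta.
    rewrite -(prednK (ltnW qgt)) exprS; case/dvdnP: MF => j ->.
    by rewrite mulnC exprM (prim_expr_order eP) expr1n mulr1.
  by have [c ->] := cF_fixed iota eq; exact: kimg_cF.
have kbeta := kbar_kimg keta.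
have C0 : C 0.
  by apply: Ck; [exact: (subring0 ksR)|rewrite expr0n gtn_eqF //; exact: (subring0 kR)].
have fg g : g \in galset -> fixes_kbar (gal_rep g) by move=> /gal_repP[].
suff main (gs : seq {perm seq_sub Z}) : {subset gs <= galset} ->
    (forall y, ks y -> (forall g, g \in gs -> exists i : nat, gal_rep g y = eta ^+ i * y) -> C y) ->
    forall x, ks x -> C x.
  apply: (main (enum galset)) => [g|y ky Hy]; first by rewrite mem_enum.
  apply: Ck => //; apply: inter; first exact: (subringX ksR).
  apply: abelian_ext_fixed => //; [exact: kbar_kimg|exact: (subringX ksR)|].
  move=> s fs; have [h Hh] := induces_exists (fixes_kbar_k fs).
  have hA : h \in galset by apply/galsetP; exists s.
  have [fh Hh'] := gal_repP hA.
  have [|i ei] := Hy h; first by rewrite mem_enum.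
  rewrite rmorphXn /= (induces_agree (fixes_kbar_k fs) (fixes_kbar_k fh) Hh Hh') // ei.
  by rewrite exprMn exprAC (prim_expr_order eP) expr1n mul1r.
elim: gs => [|g gs IH] sub Cy x kx; first exact: Cy.
have gA : g \in galset by apply: sub; exact: mem_head.
apply: IH => //; first by move=> h hs; apply: sub; rewrite inE hs orbT.
move=> y ky Hy; have fgk := fixes_kbar_k (fg g gA).
have itk j : ks (iter j (gal_rep g) y) by elim: j => [//|j IHj]; rewrite iterS; apply: stab.
have exponent := fixes_kbar_exponent M0 (fg g gA) ky.
have -> : y = M%:R^-1 * \sum_(i < M) eigenpart (gal_rep g) M eta y i.
  by rewrite (sum_eigenpart _ eP) // mulKf.
have kM : k (M%:R^-1) by apply: (subfieldV kk); exact: (subring_nat kR).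
rewrite mulr_sumr; apply: big_ind => // i _.
have kei : ks (eigenpart (gal_rep g) M eta y i).
  apply: (subring_sum ksR) => j _; apply: (subringM ksR) => //.
  by apply: kks; apply: (subfieldV kk); apply: (subringX kR).
apply: Cy; first by apply: (subringM ksR) => //; exact: kks.
move=> h; rewrite inE => /orP[/eqP->|hgs].
  exists i; rewrite rmorphM fmorphV rmorph_nat.
  by rewrite (eigenpart_eigen eP (fg g gA _ kbeta) i exponent) mulrCA.
have [j ej] := Hy h hgs; exists j.
have hA : h \in galset by apply: sub; rewrite inE hgs orbT.
have fhk := fixes_kbar_k (fg h hA).
have hit m : gal_rep h (iter m (gal_rep g) y) = eta ^+ j * iter m (gal_rep g) y.
  elim: m => [|m IHm]; first exact: ej.
  by rewrite !iterS comm // IHm rmorphM rmorphXn /= (fg g gA _ kbeta).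
rewrite rmorphM fmorphV rmorph_nat mulrCA; congr (_ * _).
rewrite rmorph_sum mulr_sumr; apply: eq_bigr => m _.
by rewrite rmorphM fmorphV rmorphXn /= (fg h hA _ kbeta) hit mulrCA.
Qed.

End Exponent.
End Permutations.
End AbelianExtension.

(** * Kummer extensions of k *)

Lemma separable_Xn_subC (R : fieldType) M (c : R) : M%:R != 0 :> R -> c != 0 ->
  separable_poly ('X^M - c%:P).
Proof.
move=> M0 c0; have Mgt0 : (0 < M)%N by case: M M0 => //; rewrite eqxx.
rewrite separable_poly.unlock; apply/Bezout_eq1_coprimepP.
exists ((- c^-1)%:P, (M%:R^-1 * c^-1)%:P * 'X) => /=.
have e : 'X * ('X^(M.-1) *+ M) = (M%:R)%:P * 'X^M :> {poly R}.
  by rewrite mulrnAr -exprS prednK // polyC_natr mulr_natl.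
rewrite derivB derivXn derivC subr0 -mulrA e mulrA -polyCM mulrAC mulVf // mul1r.
by rewrite polyCN !mulNr mulrBr -polyCM mulVf // opprB polyC1 subrK.
Qed.

(** * Adjoining M-th roots to k gives an abelian extension *)

Section KummerAbelian.
Variables (F : finFieldType) (Om : closedFieldType) (iota : {rmorphism ratfun F -> Om}).
Local Notation q := #|F|.
Local Notation k := (kimg iota).
Hypothesis ak : algebraic_over k.
Let kk : is_subfield k := kimg_subfield iota.
Let kR := subfield_subring kk.
Variables (M r : nat) (g : nat -> Om).
Hypotheses (M0 : (0 < M)%N) (MF : (M %| q.-1)%N).

Lemma unity_order_unit : M%:R != 0 :> Om.
Proof.
have [p pp [pO _]] := card_pchar iota; rewrite -(dvdn_pcharf pO).
exact: (exponent_prime_to_p iota MF pO).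
Qed.

Lemma unity_constF : exists2 eta : Om, M.-primitive_root eta & constF iota eta.
Proof.
have [eta eP] := primitive_root_exists unity_order_unit; exists eta => //.
apply: cF_fixed; rewrite -(prednK (ltnW (finNzRing_gt1 F))) exprS; case/dvdnP: MF => j ->.
by rewrite mulnC exprM (prim_expr_order eP) expr1n mulr1.
Qed.

Hypothesis kg : forall j, (j < r)%N -> k (g j ^+ M).
Local Notation G := (kadjoin iota g r).
Implicit Types (s t : {rmorphism Om -> Om}).

Let GG : is_subfield G. Proof. exact: gen_subfield. Qed.
Let GR := subfield_subring GG.
Let kG : ssub k G. Proof. by move=> x kx; apply: gen_incl; left. Qed.
Let gG j : (j < r)%N -> G (g j).
Proof. by move=> jr; apply: gen_incl; right; exists j. Qed.

Lemma kummer_conjugate s (eta m : Om) : M.-primitive_root eta -> fixes_k iota s -> k (m ^+ M) ->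
  exists i : nat, s m = eta ^+ i * m.
Proof.
move=> eP /fixes_kP fs km; have [->|m0] := eqVneq m 0; first by exists 0%N; rewrite rmorph0 mulr0.
have [i ei] : exists i : 'I_M, s m / m = eta ^+ i.
  have e : (s m / m) ^+ M = 1.
    by rewrite expr_div_n -rmorphXn /= fs // mulfV // expf_neq0.
  by have [i ei] := prim_rootP eP e; exists i.
by exists i; rewrite -ei divfK.
Qed.

(** Products of elements whose M-th power is in k are again of this kind, so the sums of such
    elements form a ring, and hence a field. *)
Lemma kadjoin_kummer_sum x : G x -> exists l : seq Om,
  (forall m, m \in l -> G m /\ k (m ^+ M)) /\ x = \sum_(m <- l) m.
Proof.
pose S x := exists l : seq Om,
  (forall m, m \in l -> G m /\ k (m ^+ M)) /\ x = \sum_(m <- l) m.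
have S1 m : G m -> k (m ^+ M) -> S m.
  by move=> Gm km; exists [:: m]; rewrite big_seq1; split => // z; rewrite inE => /eqP ->.
have SD x1 x2 : S x1 -> S x2 -> S (x1 + x2).
  move=> [l [Hl ->]] [l' [Hl' ->]]; exists (l ++ l'); rewrite big_cat; split => // z.
  by rewrite mem_cat => /orP[/Hl|/Hl'].
have S0 : S 0 by exists [::]; rewrite big_nil.
have Ssum (l : seq Om) (f : Om -> Om) : (forall m, m \in l -> S (f m)) -> S (\sum_(m <- l) f m).
  by move=> H; rewrite big_seq; apply: big_ind => //.
have SR : is_subring S.
  split; first by apply: S1; [exact: (subring1 GR)|rewrite expr1n; exact: (subring1 kR)].
    move=> x1 x2 Sx1 [l [Hl ->]]; apply: SD => //; rewrite -sumrN; apply: (Ssum) => m /Hl[Gm km].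
    apply: S1; first exact: (subringN GR).
    rewrite -mulN1r exprMn; apply: (subringM kR) => //; apply: (subringX kR).
    exact/(subringN kR)/(subring1 kR).
  move=> _ _ [l [Hl ->]] [l' [Hl' ->]]; rewrite mulr_suml; apply: (Ssum) => m /Hl[Gm km].
  rewrite mulr_sumr; apply: (Ssum) => m' /Hl'[Gm' km'].
  by apply: S1; [exact: (subringM GR)|rewrite exprMn; exact: (subringM kR)].
have SF : is_subfield S.
  apply: (algebraic_subring kk ak SR) => y ky; apply: S1; [exact: kG|exact: (subringX kR)].
apply: (gen_min SF) => y [ky|[j jr ->]].
  by apply: S1; [exact: kG|exact: (subringX kR)].
by apply: S1; [exact: gG|exact: kg].
Qed.

(** For a summand m moved by s, the s^j m with j < M add up to 0; for a fixed one they add up to M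
    m. As x is fixed, x is the sum of its summands fixed by s, and each round discards at least one
    summand outside k. *)
Lemma kadjoin_fixed x : G x -> (forall s, fixes_k iota s -> s x = x) -> k x.
Proof.
move=> /kadjoin_kummer_sum[l [Hl ex]] fx.
have MO := unity_order_unit; have [eta eP eF] := unity_constF.
have [N] := ubnP (size l); elim: N l Hl ex => // N IH l Hl ex; rewrite ltnS => sl.
have [all_k|] := pselect (forall m, m \in l -> k m).
  by rewrite ex big_seq; apply: (subring_sum kR).
move=> /existsNP[m0 /not_implyP[m0l nk]].
have [Gm0 km0] := Hl m0 m0l.
have [s fs sm0] : exists2 s, fixes_k iota s & s m0 != m0.
  apply: contrapT => no; apply: (nk); have [->|m00] := eqVneq m0 0; first exact: (subring0 kR).
  apply: (fixed_separable kk ak (q := 'X^M - (m0 ^+ M)%:P)).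
  - move=> s fs; apply/eqP; apply: contrapT => /negP sm; apply: no; exists s => //.
    by move=> c; apply: fs; exists c.
  - apply: (coefs_inB kR); first exact: (subringX (coefs_subring kR) _ (coefs_inX kR)).
    exact: (coefs_inC kR).
  - by apply: separable_Xn_subC => //; rewrite expf_neq0.
  - by rewrite rootE hornerD hornerN hornerXn hornerC subrr.
have fs' := (fixes_kP iota s).1 fs.
have seta i : s (eta ^+ i) = eta ^+ i by apply: fs'; apply: (subringX kR); exact: constF_kimg.
have itx j : iter j s x = x by elim: j => [//|j IHj]; rewrite iterS IHj fx.
have part m : m \in l -> \sum_(j < M) iter j s m = (if s m == m then M%:R * m else 0).
  move=> /Hl[Gm km]; have [i ei] := kummer_conjugate eP fs km.
  have itm j : iter j s m = (eta ^+ i) ^+ j * m.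
    by elim: j => [|j IHj]; rewrite ?expr0 ?mul1r // iterS IHj rmorphM -exprM seta ei exprM exprSr mulrA.
  rewrite (eq_bigr (fun j : 'I_M => (eta ^+ i) ^+ j * m)) => [|j _]; last exact: itm.
  rewrite -mulr_suml; case: eqP => [e|ne].
    rewrite ei in e; have [->|mn0] := eqVneq m 0; first by rewrite !mulr0.
    have -> : eta ^+ i = 1 by apply: (mulIf mn0); rewrite mul1r.
    rewrite (eq_bigr (fun=> 1)) => [|j _]; last exact: expr1n.
    by rewrite sumr_const card_ord.
  have w1 : eta ^+ i - 1 != 0.
    by rewrite subr_eq0; apply/eqP => e; apply: ne; rewrite ei e mul1r.
  have : (eta ^+ i - 1) * \sum_(j < M) (eta ^+ i) ^+ j = 0.
    by rewrite -subrX1 exprAC (prim_expr_order eP) expr1n subrr.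
  by move/eqP; rewrite mulf_eq0 (negbTE w1) /= => /eqP ->; rewrite mul0r.
apply: (IH [seq m <- l | s m == m]).
- by move=> m; rewrite mem_filter => /andP[_ /Hl].
- apply: (mulfI MO); rewrite big_filter mulr_sumr.
  have -> : M%:R * x = \sum_(j < M) iter j s x.
    rewrite (eq_bigr (fun=> x)) => [|j _]; last exact: itx.
    by rewrite sumr_const card_ord mulr_natl.
  have its j : iter j s x = \sum_(m <- l) iter j s m.
    by elim: j => [//|j IHj]; rewrite iterS IHj rmorph_sum.
  rewrite (eq_bigr (fun j : 'I_M => \sum_(m <- l) iter j s m)) => [|j _]; last exact: its.
  rewrite exchange_big /= big_seq [RHS]big_mkcond [RHS]big_seq.
  by apply: eq_bigr => m ml; rewrite part.
- rewrite size_filter; apply: leq_trans sl.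
  rewrite -(count_predC (fun m => s m == m) l) -[X in (X < _)%N]addn0 ltn_add2l -has_count.
  by apply/hasP; exists m0.
Qed.

Lemma kadjoin_stable s x : fixes_k iota s -> G x -> G (s x).
Proof.
move=> fs; have [eta eP eF] := unity_constF.
have SF : is_subfield (fun x => G (s x)).
  split; rewrite ?rmorph0 ?rmorph1; [exact: (subring0 GR)|exact: (subring1 GR)| | |].
  - by move=> y z; rewrite rmorphB; exact: (subringB GR).
  - by move=> y z; rewrite rmorphM; exact: (subringM GR).
  - by move=> y; rewrite fmorphV; exact: subfieldV.
apply: (gen_min SF) => y [ky|[j jr ->]]; first by rewrite ((fixes_kP iota s).1 fs) //; exact: kG.
have [i ->] := kummer_conjugate eP fs (kg jr).
by apply: (subringM GR); [exact: (kG (subringX kR i (constF_kimg eF)))|exact: gG].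
Qed.

Lemma kadjoin_comm s t x : fixes_k iota s -> fixes_k iota t -> G x -> s (t x) = t (s x).
Proof.
move=> fs ft; have [eta eP eF] := unity_constF.
have SF : is_subfield (fun x => s (t x) = t (s x)).
  split; rewrite ?rmorph0 ?rmorph1 //.
  - by move=> y z e e'; rewrite !rmorphB e e'.
  - by move=> y z e e'; rewrite !rmorphM e e'.
  - by move=> y e; rewrite !fmorphV e.
have fs' := (fixes_kP iota s).1 fs; have ft' := (fixes_kP iota t).1 ft.
apply: (gen_min SF) => y [ky|[j jr ->]]; first by rewrite ft' // fs' // ft'.
have [i ei] := kummer_conjugate eP fs (kg jr); have [i' ei'] := kummer_conjugate eP ft (kg jr).
have ke m : k (eta ^+ m) := subringX kR m (constF_kimg eF).
by rewrite ei ei' !rmorphM /= (fs' _ (ke _)) (ft' _ (ke _)) ei ei' mulrCA.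
Qed.

Lemma kadjoin_finext : finext iota G.
Proof.
split => //.
(* The spanning family consists of the monomials in the g_j with exponents below M; larger exponents
   are reduced by means of g_j^M in k. *)
pose I := {ffun 'I_r -> 'I_M}; pose b (f : I) := \prod_(j < r) g j ^+ f j.
pose f0 : I := [ffun=> Ordinal M0].
pose S x := exists c : I -> ratfun F, x = \sum_(f : I) iota (c f) * b f.
have SD x y : S x -> S y -> S (x + y).
  move=> [c ->] [c' ->]; exists (fun f => c f + c' f); rewrite -big_split.
  by apply: eq_bigr => f _; rewrite rmorphD mulrDl.
have SZ c x : S x -> S (iota c * x).
  move=> [c' ->]; exists (fun f => c * c' f); rewrite mulr_sumr.
  by apply: eq_bigr => f _; rewrite rmorphM mulrA.
have Sb f : S (b f).
  exists (fun h => (h == f)%:R); rewrite (bigD1 f) //= eqxx rmorph1 mul1r big1 ?addr0 // => h hf.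
  by rewrite (negbTE hf) rmorph0 mul0r.
have S0 : S 0 by exists (fun=> 0); rewrite big1 // => f _; rewrite rmorph0 mul0r.
have Ssum (J : finType) (f : J -> Om) : (forall j, S (f j)) -> S (\sum_j f j).
  by move=> H; apply: big_ind => //.
have Sbb f h : S (b f * b h).
  pose e : I := [ffun j => Ordinal (ltn_pmod (f j + h j) M0)].
  have [c ec] : k (\prod_(j < r) (g j ^+ M) ^+ ((f j + h j) %/ M)).
    by apply: (subring_prod kR) => j _; apply: (subringX kR); exact: kg.
  have -> : b f * b h = iota c * b e.
    rewrite -ec /b -!big_split; apply: eq_bigr => j _ /=.
    by rewrite ffunE /= -!exprD -exprM -exprD mulnC -divn_eq.
  exact: SZ.
have SR : is_subring S.
  split.
  - have <- : b f0 = 1 by rewrite /b big1 // => j _; rewrite ffunE expr0.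
    exact: Sb.
  - by move=> x y Sx Sy; apply: SD => //; rewrite -mulN1r -(rmorphN1 iota); exact: SZ.
  - move=> _ _ [c ->] [c' ->]; rewrite mulr_suml; apply: (Ssum) => f; rewrite mulr_sumr.
    by apply: (Ssum) => h; rewrite mulrACA -rmorphM; apply: SZ.
have Sk x : k x -> S x by move=> [c ->]; rewrite -[iota c]mulr1; apply: SZ; exact: (subring1 SR).
have SF : is_subfield S by apply: (algebraic_subring kk ak SR).
exists [seq b f | f <- enum I]; split.
  move=> _ /mapP[f _ ->]; apply: (subring_prod GR) => j _; apply: (subringX GR); exact: gG.
have GS : ssub G S.
  apply: (gen_min SF) => y [/Sk//|[j jr ->]].
  (* For M = 1 the exponent 1 is not below M, but then g_j itself lies in k. *)
  have [M1|M1] := eqVneq M 1%N; first by apply: Sk; have := kg jr; rewrite M1 expr1.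
  have M2 : (1 < M)%N by case: M M0 M1 => [|[]].
  pose f : I := [ffun i : 'I_r => if i == Ordinal jr then Ordinal M2 else Ordinal M0].
  suff -> : g j = b f by exact: Sb.
  rewrite /b (bigD1 (Ordinal jr)) //= ffunE eqxx expr1 big1 ?mulr1 // => i ij.
  by rewrite ffunE (negbTE ij) expr0.
move=> x /GS[c ->]; exists (fun i => c (nth f0 (enum I) i)).
rewrite -(big_mkord xpredT (fun i => iota (c (nth f0 (enum I) i)) * [seq b f | f <- enum I]`_i)).
rewrite size_map -[LHS]big_enum (big_nth f0) /=; apply: eq_big_nat => i /andP[_ lt].
by rewrite (nth_map f0).
Qed.

(** The conjugates of x, listed without repetition, are the roots of a separable polynomial; its
    coefficients are fixed by all endomorphisms over k and so lie in k by [kadjoin_fixed]. *)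
Lemma kadjoin_separable x : G x -> exists p : {poly ratfun F},
  [/\ p != 0, separable_poly p & root (map_poly iota p) x].
Proof.
move=> Gx; have [p0 [kp p00 px]] := ak x.
have [rs ers] := closed_field_poly_normal p0.
have mem_rs z : (z \in rs) = root p0 z.
  by rewrite ers rootZ ?lead_coef_eq0 // root_prod_XsubC.
have conj_rs s : fixes_k iota s -> s x \in rs.
  move=> fs; have ep : map_poly s p0 = p0.
    apply/polyP => i; rewrite coef_map /=; exact: (proj1 (fixes_kP iota s) fs _ (kp i)).
  by rewrite mem_rs -ep rootE horner_map (rootP px) rmorph0.
pose O := undup [seq z <- rs | `[< exists2 s, fixes_k iota s & s x = z >]].
have memO z : z \in O <-> exists2 s, fixes_k iota s & s x = z.
  rewrite mem_undup mem_filter; split=> [/andP[/asboolP]//|[s fs <-]].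
  by rewrite conj_rs // andbT; apply/asboolP; exists s.
have uO : uniq O := undup_uniq _.
pose Q := \prod_(z <- O) ('X - z%:P).
have sQ s : fixes_k iota s -> map_poly s Q = Q.
  move=> fs; rewrite /Q map_prod_XsubC -(big_map s xpredT (fun z => 'X - z%:P)).
  apply: perm_big; apply: uniq_perm => //; first by rewrite map_inj_uniq //; exact: fmorph_inj.
  have sub : {subset map s O <= O}.
    move=> _ /mapP[z /memO[t ft <-] ->]; apply/memO; exists (s \o t) => //.
    by move=> c /=; rewrite ft fs.
  have uS : uniq (map s O) by rewrite map_inj_uniq //; exact: fmorph_inj.
  by have [] := uniq_min_size uS sub; rewrite ?size_map.
have GQ : coefs_in G Q.
  have H : coefs_in G Q; last by [].
  rewrite /Q big_seq; apply: (subring_prod (coefs_subring GR)) => z /memO[s fs <-].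
  apply: (coefs_inB GR); first exact: (coefs_inX GR).
  by apply: (coefs_inC GR); exact: kadjoin_stable.
have kQ : coefs_in k Q.
  move=> i; apply: kadjoin_fixed => // s fs.
  by rewrite -[in RHS](sQ s fs) coef_map.
pose p := \poly_(i < size Q) sval (cid (kQ i)).
have ep : map_poly iota p = Q.
  apply/polyP => i; rewrite coef_map /= coef_poly; case: ltnP => [_|le].
    by rewrite -(svalP (cid (kQ i))).
  by rewrite rmorph0 nth_default.
exists p; rewrite -(map_poly_eq0 iota) -(separable_map iota) ep; split.
- by apply: monic_neq0; exact: monic_prod_XsubC.
- by rewrite separable_prod_XsubC.
- by rewrite root_prod_XsubC; apply/memO; exists idfun.
Qed.

Lemma kadjoin_abelian : abelian_ext iota G.
Proof.
split; [exact: kadjoin_finext|by move=> s fs x Gx; apply: kadjoin_stable|exact: kadjoin_separable|].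
by move=> s t fs ft x Gx; apply: kadjoin_comm.
Qed.

End KummerAbelian.

(** * A Kummer extension at one place *)

Section KummerLocal.
Variables (Om : fieldType) (W : sset Om) (HW : valuation_ring W).
Let WW : is_subring W := HW.1.

Lemma uniformizer_mul_unit K pi c : is_subfield K -> K c -> vunit W c ->
  uniformizer W K pi -> uniformizer W K (c * pi).
Proof.
move=> KK Kc uc [Kpi pi0 mpi H]; have KR := subfield_subring KK; split.
- exact: (subringM KR).
- by rewrite mulf_neq0 // (vunit_neq0 uc).
- by apply: midealMl => //; exact: vunit_val.
move=> x Kx x0; have [i ui] := H x Kx x0; exists i.
rewrite expfzMl invfM mulrCA; apply: vunitM => //; apply: vunitV; exact: vunitXz.
Qed.

Variables (K : sset Om) (pi : Om).
Hypotheses (KK : is_subfield K) (aK : algebraic_over K) (uK : uniformizer W K pi).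
Let KR := subfield_subring KK.
Variables (beta delta : Om) (g h : nat) (w u v : int).
Hypotheses (g0 : (0 < g)%N) (h0 : (0 < h)%N) (Kdelta : K delta)
  (ebeta : beta ^+ (g * h) = delta) (udelta : vunit W (delta / pi ^ (w * g%:Z)))
  (bezout : u * w + v * h%:Z = 1) (ug : vunit W g%:R).

Let pi0 : pi != 0. Proof. by case: uK. Qed.
Let Kpi : K pi. Proof. by case: uK. Qed.
Let gamma := beta ^+ h / pi ^ w.
Let eps := delta / pi ^ (w * g%:Z).
Let varpi := beta ^ u * pi ^ v.

Let beta0 : beta != 0.
Proof.
apply: contraNneq (vunit_neq0 udelta) => b0.
by rewrite -ebeta b0 expr0n muln_eq0 !gtn_eqF // mul0r.
Qed.

Let gammaE : gamma ^+ g = eps.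
Proof.
by rewrite /gamma /eps expr_div_n -exprM mulnC ebeta -exprz_exp -exprnP.
Qed.

Let ugamma : vunit W gamma.
Proof. by apply: (vunit_root HW g0); rewrite gammaE. Qed.

Let varpiE : varpi ^+ h = gamma ^ u * pi.
Proof.
rewrite /varpi /gamma exprMn expfzMl [(beta ^ u) ^+ h]exprnP exprz_exp.
rewrite [beta ^+ h]exprnP exprz_exp [_ * u]mulrC -mulrA; congr (_ * _).
rewrite exprnP exprz_exp invr_expz exprz_exp -[X in _ = _ * X]expr1z -expfzDr //.
by congr (pi ^ _); rewrite -bezout; ring.
Qed.

Let betaE : beta = gamma ^ v * varpi ^ w.
Proof.
have e1 : h%:Z * v + u * w = 1 by rewrite -bezout; ring.
have e2 : - w * v + v * w = 0 by ring.
rewrite /varpi /gamma !expfzMl [beta ^+ h]exprnP !exprz_exp invr_expz exprz_exp mulrACA.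
by rewrite -!expfzDr // e1 e2 expr1z expr0z mulr1.
Qed.

Let Keps : K eps. Proof. by apply: (subfield_div KK) => //; exact: subfieldXz. Qed.
Let K1 := adjoin1 K gamma.
Let K1K : is_subfield K1. Proof. exact: gen_subfield. Qed.
Let KK1 : ssub K K1. Proof. exact: sub_adjoin1. Qed.
Let K1g : K1 gamma. Proof. exact: mem_adjoin1. Qed.
Let uK1 : uniformizer W K1 (gamma ^ u * pi).
Proof.
apply: (uniformizer_mul_unit K1K); [exact: (subfieldXz _ K1K K1g)|exact: (vunitXz HW _ ugamma)|].
by apply: (uniformizer_kummer HW KK aK KK (fun x Kx => Kx) uK ugamma (M := g)); rewrite ?gammaE.
Qed.

Let sub : ssub (adjoin1 K beta) (adjoin1 K1 varpi).
Proof.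
have GG := gen_subfield (sunion K1 (fun x => x = varpi)).
apply: adjoin1_min => //; first by move=> x /KK1; exact: sub_adjoin1.
have Gg : adjoin1 K1 varpi gamma by apply: sub_adjoin1.
have Gw : adjoin1 K1 varpi varpi by apply: mem_adjoin1.
rewrite betaE.
exact: (subringM (subfield_subring GG) (subfieldXz v GG Gg) (subfieldXz w GG Gw)).
Qed.

(** Here delta has order w g with w prime to h. The g-th power of gamma = beta^h / pi^w is a unit,
    so adjoining gamma is unramified; the h-th power of varpi = beta^u pi^v is the uniformizer
    gamma^u pi, so the second step is totally ramified. *)
Lemma uniformizer_kummer_local : exists varpi, [/\ uniformizer W (adjoin1 K beta) varpi,
  varpi ^+ (g * h) = (delta / pi ^ (w * g%:Z)) ^ u * pi ^+ g &
  forall C c, is_subfield C -> ssub C W -> ssub C K -> C c -> mideal W (beta ^+ h / pi ^ w - c) ->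
    residues_in W C K -> residues_in W C (adjoin1 K beta)].
Proof.
exists varpi; split.
- apply: (uniformizer_sub _ sub); first exact: (uniformizer_ramified HW KK aK K1K KK1 uK1 h0 varpiE).
  have GG := gen_subfield (sunion K (fun x => x = beta)).
  have Gb : adjoin1 K beta beta by apply: mem_adjoin1.
  have Gp : adjoin1 K beta pi by apply: sub_adjoin1.
  exact: (subringM (subfield_subring GG) (subfieldXz u GG Gb) (subfieldXz v GG Gp)).
- rewrite mulnC exprM varpiE exprMn -/eps -gammaE; congr (_ * _).
  by rewrite [LHS]exprnP [gamma ^+ g]exprnP !exprz_exp [u * _]mulrC.
- move=> C c CC CW CK Cc m rK.
  have r1 : residues_in W C K1.
    apply: (residues_kummer HW KK aK KK (fun x Kx => Kx) uK ugamma (M := g) _ _ CC CW CK Cc m rK) => //.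
    by rewrite gammaE.
  have r2 := residues_ramified HW KK aK K1K KK1 uK1 h0 varpiE r1.
  by move=> x /sub; apply: r2.
Qed.

End KummerLocal.

(** * The genus field of E *)

Lemma pstarM (F : finFieldType) (p p' : {poly F}) : p != 0 -> p' != 0 ->
  pstar (p * p') = pstar p * pstar p'.
Proof.
move=> p0 p'0; rewrite /pstar mulrACA -exprD; congr ((-1) ^+ _ * _).
rewrite /pdeg size_mul //.
move: p0 p'0; rewrite -!size_poly_gt0; case: (size p) => // i; case: (size p') => // j _ _.
by rewrite addnS.
Qed.

Lemma irreducible_factor (F : finFieldType) (f : {poly F}) : (1 < size f)%N ->
  exists Q, [/\ Q \is monic, irreducible_poly Q & Q %| f].
Proof.
move=> sf; pose A n := `[< exists Q : {poly F}, [/\ (1 < size Q)%N, Q %| f & size Q = n] >].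
have exA : exists n, A n by exists (size f); apply/asboolP; exists f.
case: (ex_minnP exA) => n /asboolP[Q [sQ Qf eQ]] minn.
have Q0 : Q != 0 by rewrite -size_poly_gt0 ltnW.
have irrQ : irreducible_poly Q.
  split => // d sd dQ; have d0 : d != 0 by apply: contraTneq dQ => ->; rewrite dvd0p.
  rewrite -(dvdp_size_eqp dQ) eqn_leq (dvdp_leq Q0 dQ) /= eQ; apply: minn.
  apply/asboolP; exists d; split => //; last exact: dvdp_trans Qf.
  by move: sd; rewrite neq_ltn ltnS leqn0 size_poly_eq0 (negbTE d0).
have c0 : (lead_coef Q)^-1 != 0 by rewrite invr_eq0 lead_coef_eq0.
exists ((lead_coef Q)^-1 *: Q); split.
- by rewrite monicE lead_coefZ mulVf // lead_coef_eq0.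
- case: irrQ => _ irr; split; first by rewrite size_scale.
  by move=> d sd; rewrite dvdpZr // => /(irr d sd) e; rewrite (eqp_trans e) // eqp_sym eqp_scale.
- by rewrite dvdpZl.
Qed.

Lemma factor_out (F : finFieldType) (Q f : {poly F}) : f != 0 -> (1 < size Q)%N ->
  exists (i : nat) f', f = Q ^+ i * f' /\ ~~ (Q %| f').
Proof.
have [n] := ubnP (size f); elim: n f => // n IH f; rewrite ltnS => sf f0 sQ.
have [/dvdpP[g eg]|nd] := boolP (Q %| f); last by exists 0%N, f; rewrite expr0 mul1r.
have g0 : g != 0 by apply: contraNneq f0 => g0; rewrite eg g0 mul0r.
have Q0 : Q != 0 by rewrite -size_poly_gt0 ltnW.
have [|//|//|i [f' [e nd]]] := IH g.
  apply: leq_trans sf; rewrite eg size_mul //.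
  by move: sQ; case: (size Q) => [|[|m]] // _; rewrite !addnS /= ltnS leq_addr.
by exists i.+1, f'; split => //; rewrite eg e exprS -mulrA mulrC.
Qed.

Lemma irreducible_dvdM (F : finFieldType) (Q f g : {poly F}) : irreducible_poly Q ->
  (Q %| f * g) = (Q %| f) || (Q %| g).
Proof.
move=> irr; apply/idP/orP => [d|[d|d]]; [|exact: dvdp_mulr|exact: dvdp_mull].
have [Qf|nQf] := boolP (Q %| f); [by left|right].
by rewrite -(@Gauss_dvdpr _ g f Q) // irreducible_poly_coprime.
Qed.

(** Irreducible factors of f are removed one by one; those different from all P_j have multiplicity
    divisible by M and go into h. Multiplicities are expressed by decompositions f = Q^i f' with Q
    not dividing f'. *)
Lemma kummer_factorization (F : finFieldType) (r M : nat) (P : nat -> {poly F}) (f : {poly F}) :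
  (forall j, (j < r)%N -> P j \is monic) -> f != 0 ->
  (forall Q, Q \is monic -> irreducible_poly Q -> (forall j, (j < r)%N -> P j != Q) ->
     forall i f', f = Q ^+ i * f' -> ~~ (Q %| f') -> (M %| i)%N) ->
  exists (c : F) (x : nat -> nat) (h : {poly F}),
    [/\ c != 0, h != 0 & f = c *: ((\prod_(j < r) P j ^+ x j) * h ^+ M)].
Proof.
move=> Pmon; have [n] := ubnP (size f); elim: n f => // n IH f; rewrite ltnS => sf f0 Hf.
have [s1|s1] := leqP (size f) 1.
  exists (f`_0), (fun=> 0%N), 1; rewrite oner_neq0; split => //.
    by apply: contraNneq f0 => e; rewrite (size1_polyC s1) e.
  rewrite expr1n mulr1 big1 ?alg_polyC; first exact: size1_polyC.
  by move=> j _; rewrite expr0.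
have [Q [Qm Qi Qf]] := irreducible_factor s1.
have sQ : (1 < size Q)%N by case: Qi.
have [i [f' [ef nQ]]] := factor_out f0 sQ.
have i0 : (0 < i)%N by case: i ef => // ef; move: Qf; rewrite ef expr0 mul1r (negbTE nQ).
have f'0 : f' != 0 by apply: contraNneq nQ => ->; rewrite dvdp0.
have Q0 : Q != 0 by rewrite -size_poly_gt0 ltnW.
have [|//||c [x [h [c0 h0 e]]]] := IH f'.
- apply: leq_trans sf; rewrite ef -(prednK i0) exprS -mulrA size_mul ?mulf_neq0 ?expf_neq0 //.
  have le : (size f' <= size (Q ^+ i.-1 * f')%R)%N by rewrite dvdp_leq ?dvdp_mull ?mulf_neq0 ?expf_neq0.
  by move: sQ; case: (size Q) => [|[|m]] // _; rewrite !addSn /= ltnS (leq_trans le) // leq_addl.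
- move=> Q' Q'm Q'i out i' f'' ef' nQ'.
  have [QQ'|QQ'] := eqVneq Q' Q.
    case: i' ef' => [|i'] ef'; first exact: dvdn0.
    by move: nQ; rewrite ef' QQ' exprS -mulrA dvdp_mulr.
  apply: (Hf Q' Q'm Q'i out i' (Q ^+ i * f'')); first by rewrite ef ef' mulrCA.
  rewrite irreducible_dvdM // negb_or nQ' andbT; apply: contra QQ' => d.
  have dQ : Q' %| Q.
    elim: (i) d => [|m IHm]; last by rewrite exprS irreducible_dvdM // => /orP[].
    by rewrite expr0 dvdp1 => /eqP e1; case: Q'i; rewrite e1.
  have [_ irr] := Qi; have := irr Q' _ dQ; rewrite gtn_eqF; last by case: Q'i.
  by move=> /(_ isT); rewrite (eqp_monic Q'm Qm).
have [[j0 [jr ej]]|out'] := pselect (exists j, (j < r)%N /\ P j = Q).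
  exists c, (fun j => if j == j0 then (x j + i)%N else x j), h; split => //.
  rewrite ef e -scalerAr; congr (_ *: _); rewrite mulrA; congr (_ * _).
  rewrite (bigD1 (Ordinal jr)) //= [RHS](bigD1 (Ordinal jr)) //= eqxx exprD ej mulrA.
  congr (_ * _); first exact: mulrC.
  by apply: eq_bigr => j nj; rewrite ifF //; apply/negbTE.
have /dvdnP[m em] : (M %| i)%N.
  by apply: (Hf Q Qm Qi _ i f' ef nQ) => j jr; apply/eqP => ej; apply: out'; exists j.
exists c, x, (Q ^+ m * h); split => //; first by rewrite mulf_neq0 // expf_neq0.
by rewrite ef e -scalerAr exprMn -exprM -em mulrCA.
Qed.

(** * Places of subfields and valuation rings of Om *)

Section PlaceExtension.
Variables (Om : fieldType) (L Q : sset Om).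
Hypotheses (LL : is_subfield L) (HQ : is_place L Q).
Let LR := subfield_subring LL.

Let QL : ssub Q L. Proof. by case: HQ => [[]]. Qed.
Let QR : is_subring Q. Proof. by case: HQ => [[]]. Qed.
Let Qval x : L x -> x != 0 -> Q x \/ Q x^-1. Proof. by case: HQ => _ [_]; exact. Qed.

Lemma place_idealM x y : Q y -> mideal Q x -> mideal Q (y * x).
Proof.
move=> Qy [Qx nx]; split; first exact: (subringM QR).
rewrite mulf_eq0 negb_or => /andP[y0 x0] H; apply: (nx x0).
have -> : x^-1 = y * (y * x)^-1 by rewrite invfM mulrA mulfV ?mul1r.
exact: (subringM QR).
Qed.

Lemma place_idealD x y : mideal Q x -> mideal Q y -> mideal Q (x + y).
Proof.
move=> mx my; have [->|x0] := eqVneq x 0; first by rewrite add0r.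
have [->|y0] := eqVneq y 0; first by rewrite addr0.
have H u v : u != 0 -> mideal Q u -> Q (v / u) -> mideal Q (u + v).
  move=> u0 mu Qvu; have -> : u + v = (1 + v / u) * u by rewrite mulrDl mul1r divfK.
  by apply: place_idealM => //; apply: (subringD QR) => //; exact: (subring1 QR).
have Lyx : L (y / x) by apply: subfield_div => //; apply: QL; [case: my|case: mx].
case: (Qval Lyx) => [||Qxy]; [by rewrite mulf_neq0 ?invr_eq0|exact: H|].
by rewrite addrC; apply: H => //; rewrite invfM invrK mulrC in Qxy.
Qed.

(** Chevalley's theorem for the ring Q and its maximal ideal. An element of L in W but not in Q
    would have its inverse in the maximal ideal of Q, hence in that of W. *)
Lemma place_extension : exists W, [/\ valuation_ring W, exists x, ~ W x,
  forall x, Q x <-> L x /\ W x & forall x, mideal Q x <-> L x /\ mideal W x].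
Proof.
have [||W [HW QW mW]] := @chevalley Om Q (mideal Q) QR _ place_idealD (fun y x => @place_idealM x y) _.
- by move=> x [].
- by move=> [_]; rewrite oner_neq0 invr1 => /(_ isT); apply; exact: (subring1 QR).
have LWQ x : L x -> W x -> Q x.
  move=> Lx Wx; apply: contrapT => nQx.
  have x0 : x != 0 by apply/eqP => x0; apply: nQx; rewrite x0; exact: (subring0 QR).
  have mx : mideal Q x^-1.
    by split; [case: (Qval Lx x0)|rewrite invrK].
  by have [_] := mW _ mx; rewrite invr_eq0 invrK => /(_ x0).
exists W; split => //.
- case: HQ => _ [[x [Lx nQx]] _]; exists x => Wx; exact/nQx/LWQ.
- by move=> x; split=> [Qx|[Lx Wx]]; [split; [exact: QL|exact: QW]|exact: LWQ].
- move=> x; split=> [mx|[Lx mx]].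
    by split; [apply: QL; case: mx|exact: mW].
  by split; [apply: LWQ => //; exact: mideal_val|move=> /(proj2 mx) nW /QW].
Qed.
End PlaceExtension.

Lemma restrict_place (Om : closedFieldType) (K L W : sset Om) : is_subfield L -> is_subfield K ->
  ssub K L -> algebraic_over K -> valuation_ring W -> (exists x, ~ W x) ->
  is_place L (fun x => L x /\ W x).
Proof.
move=> LL KK KL aK HW [x0 nW]; have LR := subfield_subring LL; have WW := HW.1.
split; first split.
- by move=> x [].
- by split; [exact: (subring1 LR)|exact: (subring1 WW)].
- by move=> x y [Lx Wx] [Ly Wy]; split; [exact: (subringB LR)|exact: (subringB WW)].
- by move=> x y [Lx Wx] [Ly Wy]; split; [exact: (subringM LR)|exact: (subringM WW)].
split; last first.
  move=> x Lx x0'; case: (HW.2 x x0') => Wx; [by left|right; split => //; exact: subfieldV].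
apply: contrapT => no; apply: nW; apply: (subfield_val_trivial HW KK aK) => x Kx.
by apply: contrapT => nWx; apply: no; exists x; split; [exact: KL|case].
Qed.

(** * Local structure of E *)

Section Core.
Variables (F : finFieldType) (Om : closedFieldType) (iota : {rmorphism ratfun F -> Om}).
Local Notation q := #|F|.
Local Notation k := (kimg iota).
Local Notation T := (TT iota).
Local Notation ev := (ev iota).
Local Notation pinf := (pinf iota).
Local Notation cst := (constF iota).
Hypothesis ak : algebraic_over k.
Let kk : is_subfield k := kimg_subfield iota.
Let kR := subfield_subring kk.
Let cc : is_subfield cst := constF_subfield iota.
Let cR := subfield_subring cc.

Variables (l n r t : nat) (P : nat -> {poly F}) (alpha a : nat -> nat) (beta : Om).
Local Notation M := (l ^ n)%N.
Let D := \prod_(j < r) P j ^+ alpha j.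
Hypotheses (Hl : prime l) (MF : (M %| q.-1)%N)
  (Pmon : forall j, (j < r)%N -> P j \is monic)
  (Pirr : forall j, (j < r)%N -> irreducible_poly (P j))
  (Pdist : forall i j, (i < r)%N -> (j < r)%N -> P i = P j -> i = j)
  (Ha : forall j, (j < r)%N -> gcdn (alpha j) M = (l ^ a j)%N)
  (Han : forall j, (j < r)%N -> (a j <= n)%N)
  (Ht : gcdn (pdeg D) M = (l ^ (n - t))%N)
  (Hbeta : beta ^+ M = ev (pstar D)).

Local Notation E := (kadjoin iota (fun _ => beta) 1).
Let M0 : (0 < M)%N. Proof. by rewrite expn_gt0 prime_gt0. Qed.
Let EE : is_subfield E. Proof. exact: gen_subfield. Qed.
Let ER := subfield_subring EE.
Let kE : ssub k E. Proof. by move=> x kx; apply: gen_incl; left. Qed.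

Let E_adjoin : ssub E (adjoin1 k beta).
Proof. by apply: gen_mono => x [kx|[j _ ->]]; [left|right]. Qed.
Let adjoin_E : ssub (adjoin1 k beta) E.
Proof. by apply: gen_mono => x [kx|->]; [left|right; exists 0%N]. Qed.

(** The product S_x. Exponents are integers, as negative ones occur in the generators of the genus
    field. *)
Definition star_prod (x : nat -> int) : Om := \prod_(j < r) ev (pstar (P j)) ^ x j.

Let P0 j : (j < r)%N -> P j != 0. Proof. by move=> /Pmon/monic_neq0. Qed.

Lemma star_prod_kimg x : k (star_prod x).
Proof. by apply: (subring_prod kR) => j _; apply: subfieldXz => //; exact: kimg_ev. Qed.

Lemma star_prod_alpha : ev (pstar D) = star_prod (fun j => (alpha j)%:Z).
Proof.
have [_ ->] : D != 0 /\ pstar D = \prod_(j < r) pstar (P j) ^+ alpha j.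
  rewrite /D; apply: (big_ind2 (fun x y : {poly F} => x != 0 /\ pstar x = y)).
  - by rewrite oner_neq0 /pstar /pdeg size_poly1 expr0 mul1r.
  - by move=> x _ y _ [x0 <-] [y0 <-]; rewrite mulf_neq0 // pstarM.
  - move=> j _; have pj := P0 (ltn_ord j); split; first exact: expf_neq0.
    elim: (alpha j) => [|m IH]; first by rewrite !expr0 /pstar /pdeg size_poly1 expr0 mul1r.
    by rewrite !exprS pstarM ?expf_neq0 // IH.
by rewrite rmorph_prod; apply: eq_bigr => j _; rewrite rmorphXn.
Qed.

Lemma pdeg_D : pdeg D = (\sum_(j < r) alpha j * pdeg (P j))%N.
Proof.
suff [_ ->] : D != 0 /\ pdeg D = (\sum_(j < r) alpha j * pdeg (P j))%N by [].
rewrite /D; apply: (big_ind2 (fun (x : {poly F}) y => x != 0 /\ pdeg x = y)).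
- by rewrite oner_neq0 /pdeg size_poly1.
- move=> x _ y _ [x0 <-] [y0 <-]; rewrite mulf_neq0 // /pdeg size_mul //.
  move: x0 y0; rewrite -!size_poly_gt0; case: (size x) => // i; case: (size y) => // j _ _.
  by rewrite addnS.
- move=> j _; have pj := P0 (ltn_ord j); split; first exact: expf_neq0.
  by rewrite /pdeg size_exp /= mulnC.
Qed.

(* The good exponent vectors: star_prod x has valuation divisible by M at each place of E. *)
Definition exponent_cond (x : nat -> int) : Prop :=
  (forall j, (j < r)%N -> ((l ^ a j)%N%:Z %| x j)%Z) /\
  ((l ^ (n - t))%N%:Z %| (\sum_(j < r) x j * (pdeg (P j))%:Z))%Z.

Lemma exponent_cond_alpha : exponent_cond (fun j => (alpha j)%:Z).
Proof.
split=> [j jr|]; first by have := dvdn_gcdl (alpha j) M; rewrite (Ha jr).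
have -> : \sum_(j < r) (alpha j)%:Z * (pdeg (P j))%:Z = (pdeg D)%:Z.
  by rewrite pdeg_D -[RHS]natz natr_sum; apply: eq_bigr => j _; rewrite natrM !natz.
by have := dvdn_gcdl (pdeg D) M; rewrite Ht.
Qed.

Section LocalData.
Variable W : sset Om.
Hypothesis HW : valuation_ring W.
Let WW : is_subring W := HW.1.

Let vunit_nat m : (m %| M)%N -> vunit W m%:R.
Proof.
move=> dm; have mO : m%:R != 0 :> Om.
  by apply: (unity_order_unit iota (M := m)); exact: dvdn_trans MF.
have -> : m%:R = cF iota m%:R by rewrite rmorph_nat.
apply: (Fbar_vunit (F := F) HW); first exact: Fbar_cF.
by rewrite rmorph_nat.
Qed.

(** As M divides q - 1, the element (u/e)^M - 1 is the product of the u/e - eta^i with eta in F; if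
    the product is small, one factor is. *)
Lemma unity_residue u e : cst e -> vunit W e -> W u -> mideal W (u ^+ M - e ^+ M) ->
  exists2 c, cst c & mideal W (u - c).
Proof.
move=> ce ue Wu mu; have [eta eP eF] := unity_constF iota MF.
have e0 := vunit_neq0 ue.
have m1 : mideal W (\prod_(z <- [seq u / e - eta ^+ i | i <- index_iota 0 M]) z).
  rewrite big_map.
  have -> : \prod_(i <- index_iota 0 M) (u / e - eta ^+ i) = (u / e) ^+ M - 1.
    have := congr1 (fun p => p.[u / e]) (factor_Xn_sub_1 eP).
    rewrite hornerD hornerN hornerXn hornerC horner_prod => <-.
    by apply: eq_bigr => i _; rewrite hornerXsubC.
  have -> : (u / e) ^+ M - 1 = (u ^+ M - e ^+ M) * (e ^+ M)^-1.
    by rewrite expr_div_n mulrBl mulfV // expf_neq0.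
  by apply: midealM => //; apply: vunit_val; apply: vunitV; exact: vunitX.
have Weta i : W (eta ^+ i).
  by apply: (subringX WW); apply: (Fbar_val HW); exact: constF_Fbar eF.
have We : W e^-1 by apply: vunit_val; exact: vunitV.
have [|z /mapP[i _ ->] mz] := mideal_prod HW _ m1.
  move=> z /mapP[i _ ->]; apply: (subringB WW) => //; exact: (subringM WW).
exists (e * eta ^+ i); first by apply: (subringM cR) => //; exact: (subringX cR).
have -> : u - e * eta ^+ i = (u / e - eta ^+ i) * e by rewrite mulrBl divfK // [e * _]mulrC.
by apply: midealM => //; exact: vunit_val.
Qed.

(** With w the order of D^* and l^e = gcd(w, M), the ramification index of E is l^(n-e); w = 0 is
    included, with e = n. If D^* / pi^w is a one-unit, so is the l^e-th power of gamma; then gamma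
    reduces to a root of unity in F, and the residue field does not grow. *)
Lemma local_E pi (w : int) e : uniformizer W k pi -> vunit W (ev (pstar D) / pi ^ w) ->
  (e <= n)%N -> gcdz w M%:Z = (l ^ e)%N%:Z -> exists varpi (u : int),
  [/\ uniformizer W E varpi, varpi ^+ M = (ev (pstar D) / pi ^ w) ^ u * pi ^+ (l ^ e) &
    (vone W (ev (pstar D) / pi ^ w) -> residues_in W cst k -> residues_in W cst E)].
Proof.
move=> uk ud en gw.
have le0 : (0 < l ^ e)%N by rewrite expn_gt0 prime_gt0.
have h0 : (0 < l ^ (n - e))%N by rewrite expn_gt0 prime_gt0.
have eM : (l ^ e * l ^ (n - e) = M)%N by rewrite -expnD subnKC.
have /dvdzP[w' ew] : ((l ^ e)%N%:Z %| w)%Z by rewrite -gw dvdz_gcdl.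
have [u [v euv]] := Bezoutz w M%:Z; rewrite gw in euv.
have bez : u * w' + v * (l ^ (n - e))%N%:Z = 1.
  have l0 : (l ^ e)%N%:Z != 0 by rewrite eqz_nat -lt0n.
  by apply: (mulIf l0); rewrite mul1r -[RHS]euv -eM PoszM [in RHS]ew; ring.
rewrite ew in ud *.
have dle : (l ^ e %| M)%N by rewrite -eM dvdn_mulr.
have eb : beta ^+ (l ^ e * l ^ (n - e)) = ev (pstar D) by rewrite eM.
have [varpi [uv ev' res]] := uniformizer_kummer_local HW kk ak uk le0 h0 (kimg_ev iota (pstar D))
  eb ud bez (vunit_nat dle).
exists varpi, u; rewrite eM in ev'; split => //.
  have [Av _ _ _] := uv; apply: (uniformizer_sub uv E_adjoin); exact: adjoin_E.
move=> o rk x /E_adjoin; set gam := beta ^+ (l ^ (n - e)) / pi ^ w' in res.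
have eg : gam ^+ (l ^ e) = ev (pstar D) / pi ^ (w' * (l ^ e)%N).
  by rewrite /gam expr_div_n -exprM mulnC eb -exprz_exp -exprnP.
have Wg : W gam.
  by apply: (val_root HW le0); rewrite eg; exact: vunit_val.
have [c Fc mc] : exists2 c, cst c & mideal W (gam - c).
  apply: (@unity_residue gam 1) => //; [exact: (subring1 cR)|exact: vunit1|].
  rewrite expr1n -eM exprM eg; exact: voneX.
apply: (res cst c) => //; last exact: constF_kimg.
by move=> z /constF_Fbar; exact: Fbar_val.
Qed.

Let ev_pstar_unit (p : {poly F}) : vunit W (ev p) -> vunit W (ev (pstar p)).
Proof.
move=> up; rewrite /pstar rmorphM rmorphXn rmorphN1; apply: vunitM => //; apply: vunitX => //.
exact/(vunitN HW)/vunit1.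
Qed.

Section AtPrime.
Variable Q : {poly F}.
Hypotheses (WT : W T) (Qmon : Q \is monic) (Qirr : irreducible_poly Q) (mQ : mideal W (ev Q)).
Let uQ := uniformizer_prime HW WT Qirr mQ.

Lemma other_prime_unit j : (j < r)%N -> P j != Q -> vunit W (ev (pstar (P j))).
Proof.
move=> jr PQ; apply: ev_pstar_unit; apply: (ev_vunit HW WT Qirr mQ).
apply: contra PQ => QP; have [sQ _] := Qirr; have [_ irr] := Pirr jr.
have := irr Q _ QP; rewrite gtn_eqF // => /(_ isT); rewrite eqp_sym => e.
by rewrite -(eqp_monic (Pmon jr) Qmon).
Qed.

Lemma star_prod_at_out x : (forall j, (j < r)%N -> P j != Q) -> vunit W (star_prod x).
Proof.
move=> out; apply: vunit_prod => // j _; apply: vunitXz => //; apply: other_prime_unit => //.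
exact: out.
Qed.

Lemma star_prod_at_in x j : (j < r)%N -> P j = Q -> vunit W (star_prod x / ev Q ^ x j).
Proof.
move=> jr ej; rewrite /star_prod (bigD1 (Ordinal jr)) //= mulrAC; apply: vunitM => //.
  have Q0 : ev Q != 0 by rewrite ev_eq0 monic_neq0.
  rewrite ej /pstar rmorphM rmorphXn rmorphN1 expfzMl mulfK ?expfz_neq0 //.
  by apply: vunitXz => //; apply: vunitX => //; exact/(vunitN HW)/vunit1.
apply: vunit_prod => // i ij; apply: vunitXz => //; apply: other_prime_unit => //.
by rewrite -ej; apply: contra ij => /eqP e; apply/eqP/val_inj/(Pdist _ _ e).
Qed.

Lemma local_prime_out : (forall j, (j < r)%N -> P j != Q) ->
  exists varpi, uniformizer W E varpi /\ vunit W (varpi ^+ M / ev Q ^+ M).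
Proof.
move=> out; have ud : vunit W (ev (pstar D) / ev Q ^ 0).
  by rewrite expr0z divr1 star_prod_alpha; exact: star_prod_at_out.
have [|varpi [u [uv e _]]] := local_E uQ ud (leqnn n) _; first by rewrite gcd0z.
exists varpi; split => //; rewrite e mulfK; first exact: vunitXz.
by rewrite expf_neq0 // ev_eq0 monic_neq0.
Qed.

Lemma local_prime_in j : (j < r)%N -> P j = Q ->
  exists varpi, uniformizer W E varpi /\ vunit W (varpi ^+ M / ev Q ^+ (l ^ a j)).
Proof.
move=> jr ej; have ud : vunit W (ev (pstar D) / ev Q ^ (alpha j)%:Z).
  by rewrite star_prod_alpha; exact: (star_prod_at_in (fun j => (alpha j)%:Z) jr ej).
have [|varpi [u [uv e _]]] := local_E uQ ud (Han jr) _; first by rewrite /gcdz /= Ha.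
exists varpi; split => //; rewrite e mulfK; first exact: vunitXz.
by rewrite expf_neq0 // ev_eq0 monic_neq0.
Qed.

End AtPrime.

Section AtInfinity.
Hypothesis mT : mideal W T^-1.
Let uinf := uniformizer_inf_kimg HW mT.
Let p0 : pinf != 0. Proof. by case: uinf. Qed.

Lemma residues_kimg : residues_in W cst k.
Proof.
move=> x /kimgP[m [d [d0 ex]]] ux.
have m0 : m != 0.
  by apply: contraTneq (vunit_neq0 ux) => m0; rewrite ex m0 rmorph0 mul0r eqxx.
have o (f : {poly F}) : f != 0 -> vone W (ev f / (cF iota (lead_coef f) * T ^+ (size f).-1)).
  move=> f0; have := vone_inf HW mT (coefs_cF iota f); rewrite map_poly_eq0 => /(_ f0).
  by rewrite lead_coef_map size_map_poly -ev_horner.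
have T0 := TT_neq0 iota.
pose c := cF iota (lead_coef m) / cF iota (lead_coef d).
have c0 (f : {poly F}) : f != 0 -> cF iota (lead_coef f) != 0 by move=> f0; rewrite cF_eq0 lead_coef_eq0.
have Fc : cst c by exists (lead_coef m / lead_coef d); rewrite fmorph_div.
have uc : vunit W c.
  by apply: (Fbar_vunit HW (constF_Fbar Fc)); rewrite mulf_neq0 ?invr_eq0 ?c0.
have o1 : vone W (x / (c * (T ^+ (size m).-1 / T ^+ (size d).-1))).
  have := voneM HW (o m m0) (voneV HW (o d d0)); congr (vone W _); rewrite ex /c.
  by field; rewrite !c0 // ?expf_neq0 // ev_eq0.
have Tz : T ^+ (size m).-1 / T ^+ (size d).-1 = T^-1 ^ ((size d).-1%:Z - (size m).-1%:Z).
  by rewrite expfzDr ?invr_eq0 // -invr_expz -!exprnP !exprVn invrK mulrC.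
have T'0 : T^-1 != 0 by rewrite invr_eq0.
rewrite Tz in o1; have : vunit W (T^-1 ^ ((size d).-1%:Z - (size m).-1%:Z)).
  have := vunit_div HW ux (vone_unit HW o1); rewrite invfM invrK mulrA mulfV ?mul1r.
    exact: vunit_mull.
  exact: (vunit_neq0 ux).
move=> /(vunit_Xz HW T'0 mT) e; rewrite e expr0z mulr1 in o1.
exists c => //; have -> : x - c = (x / c - 1) * c by rewrite mulrBl mul1r divfK // (vunit_neq0 uc).
by apply: midealM => //; exact: vunit_val.
Qed.

Lemma star_prod_inf x : vone W (star_prod x * pinf ^ (\sum_(j < r) x j * (pdeg (P j))%:Z)).
Proof.
have -> : pinf ^ (\sum_(j < r) x j * (pdeg (P j))%:Z) = \prod_(j < r) pinf ^ (x j * (pdeg (P j))%:Z).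
  elim/big_rec2: _ => [|j y z _ <-]; first by rewrite expr0z.
  by rewrite expfzDr.
rewrite -big_split; apply: vone_prod => // j _.
have := voneXz HW (x j) (pstar_vone HW mT (Pmon (ltn_ord j))); congr (vone W _).
by rewrite expfzMl exprnP exprz_exp [_ * x j]mulrC.
Qed.

Lemma local_inf : exists varpi, [/\ uniformizer W E varpi,
  vone W (varpi ^+ M / pinf ^+ (l ^ (n - t))) & residues_in W cst E].
Proof.
have od : vone W (ev (pstar D) / pinf ^ (- (pdeg D)%:Z)).
  rewrite -invr_expz invrK star_prod_alpha.
  have := star_prod_inf (fun j => (alpha j)%:Z); congr (vone W (_ * pinf ^ _)).
  by rewrite pdeg_D -[RHS]natz natr_sum; apply: eq_bigr => j _; rewrite natrM !natz.
have [|varpi [u [uv e res]]] := local_E uinf (vone_unit HW od) (leq_subr t n) _.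
  by rewrite /gcdz abszN /= Ht.
exists varpi; split => //; last by apply: res => //; exact: residues_kimg.
by rewrite e mulfK ?expf_neq0 //; exact: voneXz.
Qed.

End AtInfinity.
End LocalData.

Let quot_shift (S B w : Om) (z : int) : B != 0 -> w != 0 ->
  S / w ^ (z * M%:Z) = (S / B ^ z) / ((w ^+ M / B) ^ z).
Proof.
move=> B0 w0; rewrite expfzMl exprz_inv -invr_expz exprnP exprz_exp [z * _]mulrC.
by field; rewrite !expfz_neq0.
Qed.

(** One form for the three kinds of places: primes Q away from D, the P_j, and infinity. Up to
    units, w^M is Q^M, P_j^(l^a_j) or pinf^(l^(n-t)), and goodness of x makes S_x a power of it. At
    infinity one-units replace units, which controls the residues as well. *)
Lemma local_data W : valuation_ring W -> (exists x, ~ W x) -> exists varpi,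
  [/\ uniformizer W E varpi, exists2 c, k c & vunit W (varpi ^+ M / c),
   forall x, exponent_cond x -> exists z : int, vunit W (star_prod x / varpi ^ (z * M%:Z)) /\
     (mideal W T^-1 -> vone W (star_prod x / varpi ^ (z * M%:Z)))
   & mideal W T^-1 -> residues_in W cst E].
Proof.
move=> HW nW; have WW := HW.1; have [WT|nWT] := pselect (W T).
  have nmT : ~ mideal W T^-1.
    by move=> [_]; rewrite invr_eq0 TT_neq0 invrK => /(_ isT); apply.
  have [Q [Qmon Qirr mQ]] := prime_below HW ak nW WT.
  have Q0 : ev Q != 0 by rewrite ev_eq0 monic_neq0.
  have [[j [jr ej]]|out'] := pselect (exists j, (j < r)%N /\ P j = Q).
    have [w [uw ew]] := local_prime_in HW WT Qmon Qirr mQ jr ej; have [_ w0 _ _] := uw.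
    exists w; split => //; first by exists (ev Q ^+ (l ^ a j)) => //; apply: (subringX kR); exact: kimg_ev.
    move=> x [/(_ j jr)/dvdzP[z ez] _]; exists z; split => //.
    rewrite (quot_shift _ z (B := ev Q ^+ (l ^ a j))) ?expf_neq0 //.
    apply: vunit_div => //; last exact: vunitXz.
    have := star_prod_at_in HW WT Qmon Qirr mQ x jr ej; rewrite ez.
    by rewrite [z * _]mulrC -exprz_exp -exprnP.
  have out j : (j < r)%N -> P j != Q by move=> jr; apply/eqP => e; apply: out'; exists j.
  have [w [uw ew]] := local_prime_out HW WT Qmon Qirr mQ out.
  exists w; split => //; first by exists (ev Q ^+ M) => //; apply: (subringX kR); exact: kimg_ev.
  move=> x Cx; exists 0; split => //; rewrite mul0r expr0z divr1.
  exact: (star_prod_at_out HW WT Qmon Qirr mQ x out).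
have mT : mideal W T^-1 by case: (nval_mideal HW nWT).
have [w [uw ow rE]] := local_inf HW mT; have [_ w0 _ _] := uw.
have [kp p0 _ _] := uniformizer_inf_kimg HW mT.
exists w; split => //.
  exists (pinf ^+ (l ^ (n - t))); first exact: (subringX kR).
  exact: vone_unit.
move=> x [_ /dvdzP[z ez]]; exists (- z).
suff o : vone W (star_prod x / w ^ (- z * M%:Z)) by split => //; exact: vone_unit.
rewrite (quot_shift _ (- z) (B := pinf ^+ (l ^ (n - t)))) ?expf_neq0 //.
apply: voneM => //; last by apply: voneV => //; exact: voneXz.
have := star_prod_inf HW mT x; rewrite ez; congr (vone W (_ * _)).
by rewrite -invr_expz invrK exprnP exprz_exp mulrC.
Qed.

(** * The field G generated by M-th roots of the S_x *)

Section GenusField.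
Variable g : nat -> Om.
Local Notation G := (kadjoin iota g r).
Hypotheses
  (hG1 : forall j, (j < r)%N -> exists x e,
     [/\ exponent_cond x, cst e, e != 0 & g j ^+ M = e ^+ M * star_prod x])
  (hG2 : forall x, exponent_cond x -> exists2 z, G z & z ^+ M = star_prod x).

Let GG : is_subfield G. Proof. exact: gen_subfield. Qed.
Let GR := subfield_subring GG.
Let kG : ssub k G. Proof. by move=> x kx; apply: gen_incl; left. Qed.

(** The M-th roots of unity lie in F, so one M-th root in G brings all others with it, also after
    multiplication by a constant. *)
Lemma root_mem_G y z c : G z -> cst c -> y ^+ M = c ^+ M * z ^+ M -> G y.
Proof.
move=> Gz cc' e; have [eta eP eF] := unity_constF iota MF.
have [cz0|cz0] := eqVneq (c * z) 0.
  move/eqP: e; rewrite -exprMn cz0 expr0n gtn_eqF // expf_eq0 M0 => /eqP ->.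
  exact: (subring0 GR).
have [i ei] : exists i : 'I_M, y / (c * z) = eta ^+ i.
  have e1 : (y / (c * z)) ^+ M = 1 by rewrite expr_div_n e -exprMn mulfV // expf_neq0.
  by have [i ei] := prim_rootP eP e1; exists i.
rewrite -(divfK cz0 y) ei; apply: (subringM GR).
  exact: (kG (subringX kR i (constF_kimg eF))).
by apply: (subringM GR) => //; exact: (kG (constF_kimg cc')).
Qed.

Lemma E_sub_G : ssub E G.
Proof.
apply: (gen_min GG) => x [kx|[j _ ->]]; first exact: kG.
have [z Gz ez] := hG2 exponent_cond_alpha.
apply: (root_mem_G Gz (subring1 cR)).
by rewrite expr1n mul1r ez Hbeta star_prod_alpha.
Qed.

Lemma kimg_gM j : (j < r)%N -> k (g j ^+ M).
Proof.
move=> /hG1[x [e [_ Fe _ ->]]]; apply: (subringM kR); last exact: star_prod_kimg.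
by apply: (subringX kR); exact: constF_kimg.
Qed.

(** The g_i are adjoined to E one at a time. Dividing g_i by a power of w leaves a unit u with u^M
    in the previous field, so the step is unramified; at infinity u^M is congruent to e^M, so u
    reduces to a constant in F. *)
Lemma local_data_G W : valuation_ring W -> (exists x, ~ W x) -> exists varpi,
  [/\ uniformizer W E varpi, uniformizer W G varpi &
      mideal W T^-1 -> residues_in W cst E /\ residues_in W cst G].
Proof.
move=> HW nW; have WW := HW.1; have [w [uw _ Hx rE]] := local_data HW nW.
exists w; have [Ew w0 _ _] := uw.
have cW : ssub cst W by move=> c /constF_Fbar; exact: Fbar_val.
suff [K [KK EK gK uK rK]] : exists K, [/\ is_subfield K, ssub E K,
    forall j, (j < r)%N -> K (g j), uniformizer W K w & mideal W T^-1 -> residues_in W cst K].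
  have GK : ssub G K.
    by apply: (gen_min KK) => x [/kE/EK//|[j jr ->]]; exact: gK.
  split => //; first by apply: (uniformizer_sub uK) => //; exact: E_sub_G.
  move=> mT; split; first exact: rE.
  by move=> x /GK; apply: rK.
suff main i : (i <= r)%N -> exists K, [/\ is_subfield K, ssub E K,
    forall j, (j < i)%N -> K (g j), uniformizer W K w & mideal W T^-1 -> residues_in W cst K].
  exact: main.
elim: i => [|i IH] ir; first by exists E; split.
have [K [KK EK gK uK rK]] := IH (ltnW ir).
have KR := subfield_subring KK.
have kK : ssub k K by move=> x /kE/EK.
have [x [e [Cx Fe e0 egM]]] := hG1 ir; have [z [uz oz]] := Hx x Cx.
pose u := g i / w ^ z.
have euM : u ^+ M = e ^+ M * (star_prod x / w ^ (z * M%:Z)).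
  by rewrite /u expr_div_n egM -exprz_exp -exprnP mulrA.
have ue : vunit W e by apply: (Fbar_vunit HW (constF_Fbar Fe)).
have uu : vunit W u.
  by apply: (vunit_root HW M0); rewrite euM; apply: vunitM => //; exact: vunitX.
have KuM : K (u ^+ M).
  rewrite euM; apply: (subringM KR); first exact: (subringX KR _ (kK _ (constF_kimg Fe))).
  apply: (subfield_div KK); first exact/kK/star_prod_kimg.
  by apply: (subfieldXz _ KK); exact: EK.
have uM : vunit W M%:R.
  have mO : M%:R != 0 :> Om := unity_order_unit iota MF.
  have -> : M%:R = cF iota M%:R by rewrite rmorph_nat.
  by apply: (Fbar_vunit (F := F) HW); [exact: Fbar_cF|rewrite rmorph_nat].
exists (adjoin1 K u); split.
- exact: gen_subfield.
- by move=> y /EK; exact: sub_adjoin1.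
- have AK := subfield_subring (gen_subfield (sunion K (fun x => x = u))).
  move=> j; rewrite ltnS leq_eqVlt => /orP[/eqP->|/gK]; last exact: sub_adjoin1.
  have -> : g i = u * w ^ z by rewrite /u divfK // expfz_neq0.
  apply: (subringM AK); first exact: mem_adjoin1.
  by apply: sub_adjoin1; apply: (subfieldXz _ KK); exact: EK.
- exact: (uniformizer_kummer HW kk ak KK kK uK uu KuM uM).
- move=> mT; have [c Fc mc] : exists2 c, cst c & mideal W (u - c).
    apply: (unity_residue HW Fe ue); first exact: vunit_val.
    rewrite euM -{2}[e ^+ M]mulr1 -mulrBr; apply: midealMl => //; first exact: oz.
    by apply: (subringX WW); exact: vunit_val.
  apply: (residues_kummer HW kk ak KK kK uK uu KuM uM cc cW _ Fc mc); last exact: rK.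
  by move=> y /constF_kimg/kK.
Qed.

Lemma kadjoin_admissible : admissible iota E G.
Proof.
have ramif Q : is_place G Q -> exists W, [/\ valuation_ring W, exists x, ~ W x,
    forall x, Q x <-> G x /\ W x & forall x, mideal Q x <-> G x /\ mideal W x].
  exact: place_extension.
have unr : unram_ext E G.
  move=> Q HQ y; have [W [HW nW QW mQW]] := ramif Q HQ; move=> /mQW[Gy my].
  have WW := HW.1; have [w [uE uG _]] := local_data_G HW nW; have [Ew w0 mw _] := uE.
  have [y0|y0] := eqVneq y 0.
    exists 0, 1; rewrite y0 mul0r; split => //; last by apply/QW; split; [exact: (subring1 GR)|exact: (subring1 WW)].
    split; last by rewrite eqxx.
    by split; [exact: (subring0 ER)|apply/QW; split; [exact: (subring0 GR)|exact: (subring0 WW)]].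
  have [_ _ _ /(_ y Gy y0)[i ui]] := uG.
  have Ewi : E (w ^ i) := subfieldXz i EE Ew.
  have mwi : mideal W (w ^ i).
    have -> : w ^ i = y * (y / w ^ i)^-1 by rewrite invfM invrK mulrA mulfV ?mul1r.
    by apply: midealM => //; apply: vunit_val; exact: vunitV.
  exists (w ^ i), (y / w ^ i); split; last by rewrite mulrC divfK // expfz_neq0.
    split; first by split => //; apply/QW; split; [exact: E_sub_G|exact: mideal_val].
    by move=> /(proj2 mwi) nWi [_ /QW[_]].
  apply/QW; split; last exact: vunit_val.
  by apply: (subfield_div GG) => //; exact: E_sub_G.
split => //.
  (* G serves as its own abelian extension of k, since it already contains E. *)
  exists G; split; first exact: (kadjoin_abelian ak M0 MF kimg_gM).
  move=> x; split=> [Gx|]; first by apply: gen_incl; right.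
  by apply: (gen_min GG) => z [/E_sub_G//|].
move=> Q HQ oinf; split; first exact: unr.
have [W [HW nW QW mQW]] := ramif Q HQ; have WW := HW.1.
have mT : mideal W T^-1 by have [_] := (mQW _).1 oinf; rewrite fmorphV.
have [w [_ _ /(_ mT)[_ rG]]] := local_data_G HW nW.
move=> y /QW[Gy Wy]; have [uy|my] := val_cases Wy.
  have [c Fc mc] := rG y Gy uy; have Gc : G c := kG (constF_kimg Fc).
  exists c; split; first exact: (kE (constF_kimg Fc)).
    by apply/QW; split => //; apply: (Fbar_val HW); exact: (constF_Fbar Fc).
  by apply/mQW; split => //; exact: (subringB GR).
exists 0; rewrite subr0; split; [exact: (subring0 ER)|by apply/QW; split; [exact: (subring0 GR)|exact: (subring0 WW)]|].
exact/mQW.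
Qed.


(** * Maximality among admissible extensions *)

Section Maximality.
Variable L : sset Om.
Hypotheses (LL : is_subfield L) (kL : ssub k L).
Hypothesis uL : forall W w, valuation_ring W -> (exists x, ~ W x) ->
  uniformizer W E w -> uniformizer W L w.
Hypothesis rL : forall W, valuation_ring W -> mideal W T^-1 -> residues_in W cst L.
Let LR := subfield_subring LL.

Let valuation_power W w B y : uniformizer W L w -> valuation_ring W -> B != 0 ->
  vunit W (w ^+ M / B) -> L y -> y != 0 -> exists z : int, vunit W (y ^+ M / B ^ z).
Proof.
move=> [_ w0 _ Hw] HW B0 uB Ly y0; have [z uz] := Hw y Ly y0; exists z.
have := vunitM HW (vunitX HW M uz) (vunitXz HW z uB); congr (vunit W _).
rewrite expr_div_n expfzMl exprz_inv -invr_expz [(w ^ z) ^+ M]exprnP exprz_exp.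
rewrite [w ^+ M]exprnP exprz_exp [z * _]mulrC.
by field; rewrite !expfz_neq0.
Qed.

Let nontriv_prime W Q : valuation_ring W -> mideal W (ev Q) -> Q != 0 -> exists x, ~ W x.
Proof. by move=> HW [_ H] Q0; exists (ev Q)^-1; apply: H; rewrite ev_eq0. Qed.

(** After y^M is made a polynomial, its orders at primes away from D must be multiples of M, those
    at the P_j multiples of l^a_j, and the order at infinity a multiple of l^(n-t), because E and L
    share their uniformizers. The residue at infinity decides the constant. *)
Lemma kummer_element_mem y : L y -> k (y ^+ M) -> G y.
Proof.
move=> Ly; have [->|y0] := eqVneq y 0; first by move=> _; exact: (subring0 GR).
move=> /kimgP[m [d [d0 eyM]]].
have d0' : ev d != 0 by rewrite ev_eq0.
have m0 : m != 0.
  by apply: contraNneq (expf_neq0 M y0) => m0; rewrite eyM m0 rmorph0 mul0r.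
(* From y^M = m / d it follows that (y d)^M = m d^(M-1), a polynomial. *)
pose f := m * d ^+ M.-1; have f0 : f != 0 by rewrite mulf_neq0 // expf_neq0.
pose y' := y * ev d.
have y'0 : y' != 0 by rewrite mulf_neq0.
have Ly' : L y' by apply: (subringM LR) => //; apply: kL; exact: kimg_ev.
have ey' : y' ^+ M = ev f.
  rewrite /y' /f exprMn eyM rmorphM rmorphXn /=.
  have -> : ev d ^+ M = ev d * ev d ^+ M.-1 by rewrite -exprS prednK.
  by rewrite mulrA divfK.
have [|c [x [h [c0 h0 ef]]]] := kummer_factorization (M := M) Pmon f0.
  move=> Q Qm Qi out i f' ef nQ; have [W [HW WT mQ]] := place_prime iota Qi.
  have Q0 : Q != 0 by apply: monic_neq0.
  have [w [uw ew]] := local_prime_out HW WT Qm Qi mQ out.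
  have uwL := uL HW (nontriv_prime HW mQ Q0) uw.
  have Q0' : ev Q != 0 by rewrite ev_eq0.
  have [|z uz] := valuation_power uwL HW _ ew Ly' y'0; first by rewrite expf_neq0.
  have ui : vunit W (y' ^+ M / ev Q ^ i%:Z).
    rewrite ey' ef rmorphM rmorphXn /= -exprnP mulrAC mulfV ?expf_neq0 // mul1r.
    exact: (ev_vunit HW WT Qi mQ nQ).
  rewrite [ev Q ^+ M]exprnP exprz_exp in uz; have e := vunit_Xz_inj HW Q0' mQ ui uz.
  have : (M%:Z %| i%:Z)%Z by rewrite e dvdz_mulr.
  by rewrite /dvdz.
have h0' : ev h != 0 by rewrite ev_eq0.
pose x' j := (x j)%:Z.
(* The signs by which the P_j differ from the P_j^* are moved into the constant. *)
pose c' := cF iota (c * \prod_(j < r) (-1) ^+ (pdeg (P j) * x j)).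
have Fc' : cst c' by exists (c * \prod_(j < r) (-1) ^+ (pdeg (P j) * x j)).
have c'0 : c' != 0.
  rewrite cF_eq0 mulf_neq0 //; apply/prodf_neq0 => j _.
  by rewrite expf_neq0 // oppr_eq0 oner_eq0.
pose y1 := y' / ev h.
have y10 : y1 != 0 by rewrite mulf_neq0 ?invr_eq0.
have Ly1 : L y1 by apply: subfield_div => //; apply: kL; exact: kimg_ev.
have ey1 : y1 ^+ M = c' * star_prod x'.
  rewrite /y1 expr_div_n ey' ef -mul_polyC rmorphM rmorphM rmorphXn /= mulrA mulfK ?expf_neq0 //.
  rewrite /c' rmorphM -mulrA; congr (_ * _); rewrite !rmorph_prod -big_split /=.
  apply: eq_bigr => j _; rewrite /x' -exprnP -rmorphXn /= /pstar exprMn -exprM.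
  rewrite !rmorphM !rmorphXn !rmorphN1 mulrA -exprMn mulN1r opprK expr1n mul1r.
  by rewrite -rmorphXn.
have uc' W : valuation_ring W -> vunit W c'.
  by move=> HW; apply: (Fbar_vunit HW (constF_Fbar Fc')).
have condP j : (j < r)%N -> ((l ^ a j)%N%:Z %| x' j)%Z.
  move=> jr; have [W [HW WT mQ]] := place_prime iota (Pirr jr).
  have [w [uw ew]] := local_prime_in HW WT (Pmon jr) (Pirr jr) mQ jr erefl.
  have uwL := uL HW (nontriv_prime HW mQ (P0 jr)) uw.
  have Q0' : ev (P j) != 0 by rewrite ev_eq0 P0.
  have [|z uz] := valuation_power uwL HW _ ew Ly1 y10; first by rewrite expf_neq0.
  rewrite [ev (P j) ^+ _]exprnP exprz_exp in uz.
  have ux : vunit W (y1 ^+ M / ev (P j) ^ x' j).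
    rewrite ey1 -mulrA; apply: vunitM => //; first exact: uc'.
    exact: (star_prod_at_in HW WT (Pmon jr) (Pirr jr) mQ x' jr erefl).
  by rewrite (vunit_Xz_inj HW Q0' mQ ux uz) dvdz_mulr.
have [W [HW mT]] := place_inf iota; have WW := HW.1.
have nW : exists x, ~ W x.
  by exists T^-1^-1; apply: (proj2 mT); rewrite invr_eq0 TT_neq0.
have [w [uw ow _]] := local_inf HW mT.
have uwL := uL HW nW uw; have [Lw w0 _ Hw] := uwL.
have [_ p0 mp _] := uniformizer_inf_kimg HW mT.
have [z uz] := Hw y1 Ly1 y10; pose u := y1 / w ^ z.
pose A := (l ^ (n - t))%N; pose S := \sum_(j < r) x' j * (pdeg (P j))%:Z.
pose o := star_prod x' * pinf ^ S / (w ^+ M / pinf ^+ A) ^ z.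
have oo : vone W o.
  by apply: voneM => //; [exact: star_prod_inf|apply: voneV => //; exact: voneXz].
have euM : u ^+ M = c' * o * pinf ^ (- S - A%:Z * z).
  rewrite /u /o expr_div_n ey1 expfzMl exprz_inv -invr_expz [(w ^ z) ^+ M]exprnP exprz_exp.
  rewrite [w ^+ M]exprnP exprz_exp [z * _]mulrC [pinf ^+ A]exprnP exprz_exp.
  rewrite expfzDr // -!invr_expz; field.
  by rewrite !expfz_neq0.
(* u^M, c' and o are units at infinity, so the remaining power of [pinf] has exponent 0: this is the
   degree condition on x'. *)
have e0 : - S - A%:Z * z = 0.
  apply: (vunit_Xz HW p0 mp); apply: (@vunit_mull _ _ HW (c' * o)).
    by apply: vunitM => //; [exact: uc'|exact: vone_unit].
  by rewrite -euM; apply: vunitX.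
have [c2 Fc2 mc2] := rL HW mT (subfield_div LL Ly1 (subfieldXz z LL Lw)) uz.
have Wc2 : W c2 by apply: (Fbar_val HW); exact: (constF_Fbar Fc2).
(* u reduces to a constant c2 of F, and u^M = c' o with o a one-unit; so c' - c2^M is a constant in
   the maximal ideal, which is 0. *)
have ec : c' = c2 ^+ M.
  apply/eqP; rewrite -subr_eq0; apply/eqP.
  have Fd : Fbar F (c' - c2 ^+ M).
    have FR := subfield_subring (Fbar_subfield iota).
    by apply: (subringB FR); [exact: (constF_Fbar Fc')|apply: (subringX FR); exact: (constF_Fbar Fc2)].
  apply: (Fbar_mideal HW Fd).
  have m1 : mideal W (u ^+ M - c2 ^+ M) by apply: mideal_congX => //; exact: vunit_val.
  have m2 : mideal W (u ^+ M - c').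
    rewrite euM e0 expr0z mulr1 -[X in _ - X]mulr1 -mulrBr; apply: midealMl => //.
    exact: vunit_val (uc' _ HW).
  have -> : c' - c2 ^+ M = (u ^+ M - c2 ^+ M) - (u ^+ M - c') by ring.
  exact: midealB.
have Cx : exponent_cond x'.
  split => //; rewrite -/S; apply/dvdzP; exists (- z).
  by apply/eqP; rewrite mulNr -subr_eq0 opprK -oppr_eq0 opprD [z * _]mulrC e0.
have [z0 Gz0 ez0] := hG2 Cx.
have Gy1 : G y1 by apply: (root_mem_G Gz0 Fc2); rewrite ez0 -ec.
have -> : y = y1 * ev h / ev d by rewrite /y1 divfK // /y' mulfK.
apply: (subfield_div GG); last exact: (kG (kimg_ev iota d)).
by apply: (subringM GR) => //; exact: (kG (kimg_ev iota h)).
Qed.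

End Maximality.

(** Every nontrivial W cuts out a place of L, where unramifiedness and splitting become the two
    local hypotheses of the maximality argument. The exponent argument for ks takes place in L Fbar:
    uniformizers of E remain uniformizers there, so M kills the ramification of its elements over
    Fbar(T). *)
Lemma admissible_sub_kadjoin L : admissible iota E L -> ssub L G.
Proof.
move=> [[ks [Hks eqL]] unr spl].
have eL : L = gen (sunion E ks) by apply/funext => x; apply/propext; exact: eqL.
have LL : is_subfield L by rewrite eL; exact: gen_subfield.
have LR := subfield_subring LL.
have EL : ssub E L by rewrite eL => x Ex; apply: gen_incl; left.
have ksL : ssub ks L by rewrite eL => x Ex; apply: gen_incl; right.
have kL : ssub k L by move=> x /kE/EL.
have midL (K W : sset Om) x : is_subfield K -> mideal (fun z => K z /\ W z) x <-> K x /\ mideal W x.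
  move=> KK; split=> [[[Kx Wx] H]|[Kx [Wx H]]]; split => //.
    by split => // /H nKW Wx'; apply: nKW; split => //; exact: subfieldV.
  by move=> /H nWx [].
have midE W x : mideal (restr E (fun z => L z /\ W z)) x <-> E x /\ mideal W x.
  have e : restr E (fun z => L z /\ W z) = (fun z => E z /\ W z).
    apply/funext => z; apply/propext; split=> [[Ez [_ Wz]]|[Ez Wz]]; split => //.
    by split => //; exact: EL.
  by rewrite e; apply: midL.
have uL W w : valuation_ring W -> (exists x, ~ W x) -> uniformizer W E w -> uniformizer W L w.
  move=> HW nW uw; apply: (uniformizer_unramified HW ak EE kE uw EL _ LL) => y Ly my.
  have HQ := restrict_place LL kk kL ak HW nW.
  have [|x [u [/midE[Ex mx] [Lu Wu] e]]] := unr _ HQ y; first exact/midL.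
  by exists x, u.
have rL W : valuation_ring W -> mideal W T^-1 -> residues_in W cst L.
  move=> HW mT; have nW : exists x, ~ W x.
    by exists T^-1^-1; apply: (proj2 mT); rewrite invr_eq0 TT_neq0.
  have HQ := restrict_place LL kk kL ak HW nW.
  have oinf : over_inf iota (fun z => L z /\ W z).
    rewrite /over_inf fmorphV; apply/midL => //; split => //.
    by apply: (subfieldV LL); apply: kL; exact: kimg_ev.
  have [_ res] := spl _ HQ oinf; have [_ [_ _ rE]] := local_inf HW mT.
  move=> x Lx ux; have [|x0 [Ex0 _ /midL -/(_ LL)[_ mx]]] := res x; first by split => //; exact: vunit_val.
  have [c Fc mc] := rE x0 Ex0 (vunit_cong HW ux mx); exists c => //.
  by rewrite -(subrKA x0); apply: midealD.
have ksG : ssub ks G.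
  have [Z [ZK Zst Zdet]] := stable_root_set Hks.
  have VV := gen_subfield (sunion L (@Fbar F Om)).
  apply: (kummer_generated ak Hks ZK Zst Zdet MF VV (kbar_sub_gen kL) _ _ M0).
  - by move=> x /ksL Lx; apply: gen_incl; left.
  - move=> y Vy y0 W HW nW; have [w [uw [c kc uc] _ _]] := local_data HW nW.
    have [_ w0 _ Hw] := uniformizer_constants ak HW LL kL (uL W w HW nW uw).
    have [z uz] := Hw y Vy y0; exists (c ^ z).
      by apply: kbar_kimg; exact: subfieldXz.
    have c0 : c != 0 by apply: contraTneq (vunit_neq0 uc) => ->; rewrite invr0 mulr0 eqxx.
    have := vunitM HW (vunitX HW M uz) (vunitXz HW z uc); congr (vunit W _).
    rewrite expr_div_n expfzMl exprz_inv -invr_expz [(w ^ z) ^+ M]exprnP exprz_exp.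
    rewrite [w ^+ M]exprnP exprz_exp [z * _]mulrC.
    by field; rewrite !expfz_neq0.
  - move=> x kx kbx; apply: (abelian_ext_fixed ak Hks kk) => // s fs.
    apply: (split_kbar_fixed ak LL kL rL _ (ksL _ kx) kbx).
    exact: (proj2 (fixes_kP iota s) fs).
  - by move=> x y; exact: (subringD GR).
  - by move=> y ky; apply: (kummer_element_mem LL kL uL rL); exact: ksL.
by rewrite eL; apply: (gen_min GG) => x [/E_sub_G|/ksG].
Qed.

(** Of the generators only two facts enter: up to a constant of F each g_j is an M-th root of some
    S_x with x good, and every such S_x has an M-th root in G. Their explicit shape is thus
    separated from the field theory. *)
Lemma kadjoin_genus_field : is_genus_field iota E G.
Proof. by split; [exact: kadjoin_admissible|exact: admissible_sub_kadjoin]. Qed.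

End GenusField.
End Core.

(** * The explicit generators *)

Lemma gcdn_prime_power l n m : prime l -> (0 < m)%N ->
  gcdn m (l ^ n) = (l ^ minn n (logn l m))%N.
Proof.
move=> Hl m0; apply/eqP; rewrite eqn_dvd; apply/andP; split.
  have /dvdn_pfactor -/(_ Hl)[j jn ej] : (gcdn m (l ^ n) %| l ^ n)%N by apply: dvdn_gcdr.
  have : (l ^ j %| m)%N by rewrite -ej dvdn_gcdl.
  by rewrite ej pfactor_dvdn // => jm; rewrite dvdn_exp2l // leq_min jn.
rewrite dvdn_gcd dvdn_exp2l ?geq_minl // andbT.
by rewrite pfactor_dvdn // geq_minr.
Qed.

Lemma logn_coprime_mul l c d : prime l -> coprime c l -> logn l (c * l ^ d) = d.
Proof. by move=> Hl cop; rewrite logn_Gauss 1?coprime_sym // pfactorK. Qed.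

Section StarProducts.
Variables (F : finFieldType) (Om : closedFieldType) (iota : {rmorphism ratfun F -> Om}).
Variables (r : nat) (P : nat -> {poly F}).
Hypothesis P0 : forall j, (j < r)%N -> P j != 0.
Local Notation ev := (ev iota).
Local Notation star_prod := (star_prod iota r P).

Lemma star_prod_pair i j (e f : int) : (i < r)%N -> (j < r)%N -> j != i ->
  star_prod (fun s => if s == j then e else if s == i then f else 0) =
  ev (pstar (P j)) ^ e * ev (pstar (P i)) ^ f.
Proof.
move=> ir jr ji; rewrite /star_prod (bigD1 (Ordinal jr)) //= eqxx; congr (_ * _).
rewrite (bigD1 (Ordinal ir)) /=; last by rewrite -val_eqE /= eq_sym.
rewrite eq_sym (negbTE ji) eqxx big1 ?mulr1 // => s /andP[sj si].
rewrite ifF ?ifF ?expr0z //; [by apply/negbTE; rewrite -val_eqE in si|by apply/negbTE; rewrite -val_eqE in sj].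
Qed.

Lemma star_prod_single j (e : int) : (j < r)%N ->
  star_prod (fun s => if s == j then e else 0) = ev (pstar (P j)) ^ e.
Proof.
move=> jr; rewrite /star_prod (bigD1 (Ordinal jr)) //= eqxx big1 ?mulr1 // => s sj.
by rewrite ifF ?expr0z //; apply/negbTE; rewrite -val_eqE in sj.
Qed.

End StarProducts.

Lemma sum_single r j (e : int) (w : nat -> int) : (j < r)%N ->
  \sum_(s < r) (if s == j :> nat then e else 0) * w s = e * w j.
Proof.
move=> jr; rewrite (bigD1 (Ordinal jr)) //= eqxx big1 ?addr0 // => s sj.
by rewrite ifF ?mul0r //; apply/negbTE; rewrite -val_eqE in sj.
Qed.

Lemma sum_pair r i j (e f : int) (w : nat -> int) : (i < r)%N -> (j < r)%N -> j != i ->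
  \sum_(s < r) (if s == j :> nat then e else if s == i :> nat then f else 0) * w s = e * w j + f * w i.
Proof.
move=> ir jr ji; rewrite (bigD1 (Ordinal jr)) //= eqxx; congr (_ + _).
rewrite (bigD1 (Ordinal ir)) /=; last by rewrite -val_eqE /= eq_sym.
rewrite eq_sym (negbTE ji) eqxx big1 ?addr0 // => s /andP[sj si].
rewrite ifF ?ifF ?mul0r //; [by apply/negbTE; rewrite -val_eqE in si|by apply/negbTE; rewrite -val_eqE in sj].
Qed.

(** * Generators as exponent vectors *)

Section Generators.
Variables (F : finFieldType) (Om : closedFieldType) (iota : {rmorphism ratfun F -> Om}).
Local Notation ev := (ev iota).
Local Notation cst := (constF iota).
Variables (l n r t : nat) (P : nat -> {poly F}) (a : nat -> nat) (g : nat -> Om).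
Local Notation M := (l ^ n)%N.
Local Notation star_prod := (star_prod iota r P).
Local Notation cond := (exponent_cond l n r t P a).
Local Notation G := (kadjoin iota g r).
Hypotheses (Hl : prime l) (Pmon : forall j, (j < r)%N -> P j \is monic).

Let GG : is_subfield G. Proof. exact: gen_subfield. Qed.
Let GR := subfield_subring GG.
Let gG j : (j < r)%N -> G (g j).
Proof. by move=> jr; apply: gen_incl; right; exists j. Qed.
Let P0 j : (j < r)%N -> P j != 0. Proof. by move=> /Pmon/monic_neq0. Qed.
Let star0 j : (j < r)%N -> ev (pstar (P j)) != 0.
Proof. by move=> jr; rewrite ev_eq0 /pstar mulf_neq0 ?P0 // expf_neq0 // oppr_eq0 oner_eq0. Qed.
Let lX k : (l ^ k)%N%:Z != 0.
Proof. by rewrite eqz_nat -lt0n expn_gt0 prime_gt0. Qed.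

Lemma ev_pstar p : ev p = (-1) ^ (pdeg p)%:Z * ev (pstar p).
Proof.
rewrite /pstar rmorphM rmorphXn rmorphN1 mulrA -exprnP -exprD -signr_odd addnn odd_double.
by rewrite expr0 mul1r.
Qed.

Lemma cst_sign (w : int) : cst ((-1) ^ w).
Proof.
have cc := constF_subfield iota.
by apply: (subfieldXz w cc); apply: (subringN (subfield_subring cc)); case: cc.
Qed.

(** By the second hypothesis each vector with the single entry l^a_j is good; a vector satisfying
    the conditions at the P_j is an integral combination of these. *)
Lemma single_generators :
  (forall j, (j < r)%N -> g j ^+ M = ev (pstar (P j)) ^+ (l ^ a j)) ->
  (forall j, (j < r)%N -> (l ^ (n - t) %| l ^ a j * pdeg (P j))%N) ->
  (forall j, (j < r)%N -> exists x e, [/\ cond x, cst e, e != 0 & g j ^+ M = e ^+ M * star_prod x]) /\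
  (forall x, cond x -> exists2 z, G z & z ^+ M = star_prod x).
Proof.
move=> Hg Hd; split=> [j jr|x [xa _]].
  exists (fun s => if s == j then (l ^ a j)%N%:Z else 0), 1; split.
  - split=> [s sr|]; first by case: eqP => [->|_]; rewrite ?dvdz0 ?dvdzz.
    by rewrite (sum_single _ (fun s => (pdeg (P s))%:Z) jr) -PoszM; exact: Hd.
  - by case: (constF_subfield iota).
  - exact: oner_neq0.
  - by rewrite expr1n mul1r star_prod_single // Hg.
exists (\prod_(j < r) g j ^ (x j %/ (l ^ a j)%N%:Z)%Z).
  by apply: (subring_prod GR) => j _; apply: (subfieldXz _ GG); exact: gG.
rewrite -prodrXl /star_prod; apply: eq_bigr => j _.
rewrite exprnP exprzAC -exprnP Hg // exprnP exprz_exp mulrC divzK //; exact: xa.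
Qed.

Variables (i s c d : nat) (f w : nat -> int).
Hypotheses (ir : (i < r)%N) (Hci : pdeg (P i) = (c * l ^ d)%N) (cop : coprime c l)
  (Hs : (s + d = n - t)%N) (ais : (a i <= s)%N)
  (Hgi : g i ^+ M = ev (pstar (P i)) ^+ (l ^ s))
  (Hg : forall j, (j < r)%N -> j != i -> g j ^+ M = ev (P j) ^+ (l ^ a j) * ev (P i) ^ f j)
  (Hf : forall j, (j < r)%N -> j != i -> ((l ^ a i)%N%:Z %| f j)%Z)
  (Hw : forall j, (j < r)%N -> j != i ->
     (l ^ a j)%N%:Z * (pdeg (P j))%:Z + f j * (pdeg (P i))%:Z = w j * M%:Z).

(** g_j is a root of a product of the P_j, not of the P_j^*. The sign this causes is -1 to the total
    degree, and that degree is w_j M, so the sign is an M-th power in F. *)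
Lemma pair_generator_star j : (j < r)%N -> j != i ->
  g j ^+ M = ((-1) ^ w j) ^+ M * (ev (pstar (P j)) ^ (l ^ a j)%N * ev (pstar (P i)) ^ f j).
Proof.
move=> jr ji; have N1 : (-1 : Om) != 0 by rewrite oppr_eq0 oner_eq0.
have -> : ((-1) ^ w j : Om) ^+ M = (-1) ^ ((l ^ a j)%N%:Z * (pdeg (P j))%:Z + f j * (pdeg (P i))%:Z).
  by rewrite Hw // exprnP exprz_exp.
rewrite Hg // [ev (P j) ^+ _]exprnP (ev_pstar (P j)) (ev_pstar (P i)) !expfzMl !exprz_exp.
by rewrite expfzDr // [f j * _]mulrC [(l ^ a j)%N%:Z * _]mulrC; ring.
Qed.

(** As a vector, g_j has the entries l^a_j at j and f_j at i, and g_i has the entry l^s at i.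
    Subtracting multiples of the former from a good x leaves an entry f' at i. Its degree f' c l^d
    is divisible by l^(n-t) = l^(s+d), and c is prime to l, so l^s divides f'. *)
Lemma pair_generators :
  (forall j, (j < r)%N -> exists x e, [/\ cond x, cst e, e != 0 & g j ^+ M = e ^+ M * star_prod x]) /\
  (forall x, cond x -> exists2 z, G z & z ^+ M = star_prod x).
Proof.
have dM : ((l ^ (n - t))%N%:Z %| M%:Z)%Z by apply: dvdn_exp2l; exact: leq_subr.
have N1 : (-1 : Om) != 0 by rewrite oppr_eq0 oner_eq0.
split=> [j jr|x [xa xd]].
  have [->|ji] := eqVneq j i.
    exists (fun s' => if s' == i then (l ^ s)%N%:Z else 0), 1; split.
    - split=> [s' sr|]; first by case: eqP => [->|_]; rewrite ?dvdz0 //; exact: dvdn_exp2l.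
      rewrite (sum_single _ (fun s' => (pdeg (P s'))%:Z) ir) -PoszM Hci mulnCA -expnD Hs.
      exact: dvdn_mull.
    - by case: (constF_subfield iota).
    - exact: oner_neq0.
    - by rewrite expr1n mul1r star_prod_single // Hgi.
  exists (fun s' => if s' == j then (l ^ a j)%N%:Z else if s' == i then f j else 0), ((-1) ^ w j); split.
  - split=> [s' sr|].
      by case: eqP => [->|_]; [rewrite dvdzz|case: eqP => [->|_]; [exact: Hf|rewrite dvdz0]].
    rewrite (sum_pair _ _ (fun s' => (pdeg (P s'))%:Z) ir jr ji) Hw //.
    exact: dvdz_mull.
  - exact: cst_sign.
  - exact: expfz_neq0.
  - by rewrite star_prod_pair // pair_generator_star.
pose y j := (x j %/ (l ^ a j)%N%:Z)%Z.
have ey j : (j < r)%N -> y j * (l ^ a j)%N%:Z = x j by move=> jr; rewrite divzK //; exact: xa.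
pose f' := x i - \sum_(j < r | val j != i) f j * y j.
have /dvdzP[v ev'] : ((l ^ s)%N%:Z %| f')%Z.
  have : ((l ^ (n - t))%N%:Z %| f' * (pdeg (P i))%:Z)%Z.
    have -> : f' * (pdeg (P i))%:Z = \sum_(j < r) x j * (pdeg (P j))%:Z -
        (\sum_(j < r | val j != i) y j * w j) * M%:Z.
      rewrite (bigD1 (Ordinal ir)) //= /f' mulrBl -addrA; congr (_ + _).
      rewrite !mulr_suml -sumrB -sumrN; apply: eq_big => [j|j ji]; first by rewrite -val_eqE.
      rewrite -mulrA -Hw // -(ey _ (ltn_ord j)); ring.
    by rewrite rpredB // dvdz_mull.
  rewrite Hci PoszM -Hs expnD PoszM mulrA dvdz_mul2r ?lX //.
  have cs : coprimez (l ^ s)%N%:Z c%:Z.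
    by have : coprime (l ^ s) c by rewrite coprime_sym coprimeXr.
  by rewrite (Gauss_dvdzl f' cs).
exists (\prod_(j < r | val j != i) (g j / (-1) ^ w j) ^ y j * g i ^ v).
  apply: (subringM GR); last by apply: (subfieldXz _ GG); exact: gG.
  apply: (subring_prod GR) => j _; apply: (subfieldXz _ GG).
  apply: (subringM GR); first exact: gG.
  have [_ G1 _ _ GV] := GG; apply: GV; apply: (subfieldXz _ GG); exact: (subringN GR).
rewrite exprMn -prodrXl exprnP exprzAC -exprnP Hgi exprnP exprz_exp [_ * v]mulrC -ev'.
rewrite (eq_bigr (fun j : 'I_r => ev (pstar (P j)) ^ x j * ev (pstar (P i)) ^ (f j * y j))); last first.
  move=> j ji; rewrite exprnP exprzAC -exprnP expr_div_n pair_generator_star //.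
  rewrite mulrAC mulfV ?expf_neq0 ?expfz_neq0 // mul1r expfzMl !exprz_exp.
  by rewrite [_ * y j]mulrC ey.
rewrite big_split /=.
have -> : \prod_(j < r | val j != i) ev (pstar (P i)) ^ (f j * y j) =
   ev (pstar (P i)) ^ (\sum_(j < r | val j != i) f j * y j).
  by apply: (big_ind2 (fun u v => u = ev (pstar (P i)) ^ v)) => // [u u' v1 v2 -> ->]; rewrite expfzDr ?star0.
rewrite -mulrA -expfzDr ?star0 // addrC subrK mulrC /star_prod [in RHS](bigD1 (Ordinal ir)) //=.
Qed.

End Generators.

(** A positive m excludes n - a as the minimum, so the minimum is d. *)
Lemma ramification_split n a d m : (n - a - minn (n - a) d = m)%N -> (0 < m)%N -> (d + m + a = n)%N.
Proof. lia. Qed.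

Lemma ramification_le n a d m : (n - a - minn (n - a) d <= m)%N -> (n - m <= a + d)%N.
Proof. lia. Qed.

(** * The exponents of the stated generators *)

Section GfData.
Variables (F : finFieldType) (Om : closedFieldType) (iota : {rmorphism ratfun F -> Om}).
Local Notation ev := (ev iota).
Variables (l n t i : nat) (P : nat -> {poly F}) (a c d : nat -> nat) (za zb : int) (y : nat -> int).
Local Notation M := (l ^ n)%N.
Local Notation X := (gf_data l n t i P a c d za y).

(** The exponent of P_i in g_j^M, in one formula for the three cases: the defining equation of g_j
    is raised to the power l^a_j if j < i or d_i <= d_j, and to l^(a_j + d_j - d_i) otherwise. The
    truncated difference is exact for d_i <= a_j + d_j. *)
Definition pair_exponent (j : nat) : int :=
  (if (j < i)%N then - za * (c j)%:Z else y j) * (l ^ (a j + d j - d i))%N%:Z.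

Lemma gf_data_pivot x : (d i + t <= n)%N ->
  x ^+ (X i).1 = iota (X i).2 -> x ^+ M = ev (pstar (P i)) ^+ (l ^ (n - (d i + t))).
Proof.
rewrite /gf_data ltnn eqxx /= => dn ex.
by rewrite -[ev _]ex -exprM -expnD subnKC.
Qed.

Lemma gf_data_pair x j : j != i -> (a j <= n)%N -> ((j < i) -> d i <= d j)%N ->
  (d i <= a j + d j)%N ->
  x ^+ (X j).1 = iota (X j).2 -> x ^+ M = ev (P j) ^+ (l ^ a j) * ev (P i) ^ pair_exponent j.
Proof.
move=> ji an dij dad.
have main N (p : nat) (u : int) k Z : x ^+ N = iota Z -> Z = pfrac (P j) ^+ p * pfrac (P i) ^ u ->
    (N * k = M)%N -> (p * k = l ^ a j)%N -> u * k%:Z = pair_exponent j ->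
    x ^+ M = ev (P j) ^+ (l ^ a j) * ev (P i) ^ pair_exponent j.
  move=> ex eZ <- <- <-; rewrite exprM ex eZ rmorphM rmorphXn fmorphXz exprMn -exprM.
  by congr (_ * _); rewrite exprnP exprz_exp.
rewrite /gf_data (negbTE ji) /pair_exponent in main *; case: ltnP main => [lji|lij] main /=.
  move=> ex; apply: (main _ 1%N _ (l ^ a j)%N _ ex); rewrite ?expr1 ?mul1n // -?expnD ?subnK //.
  by rewrite -[LHS]mulrA -PoszM -expnD addnC addnBA // dij.
case: leqP => dd /= ex.
  apply: (main _ 1%N _ (l ^ a j)%N _ ex); rewrite ?expr1 ?mul1n // -?expnD ?subnK //.
  by rewrite -[LHS]mulrA -PoszM -expnD addnC addnBA.
apply: (main _ _ _ (l ^ (a j + d j - d i))%N _ ex) => //; rewrite -expnD; congr (l ^ _)%N; lia.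
Qed.

Hypotheses (Hci : pdeg (P i) = (c i * l ^ d i)%N)
  (Hza : za * (pdeg (P i))%:Z + zb * M%:Z = (l ^ d i)%N%:Z).

(** The first summand is c_j l^(a_j + d_j). Modulo M it is cancelled for j < i by the Bezout
    relation for deg P_i, and for j > i by the congruence defining y_j, as deg P_i = c_i l^d_i. *)
Lemma pair_exponent_degree j : pdeg (P j) = (c j * l ^ d j)%N -> (d i <= a j + d j)%N ->
  ((i < j)%N -> (y j * (c i)%:Z + (c j)%:Z == 0 %[mod M%:Z])%Z) -> j != i ->
  (M%:Z %| (l ^ a j)%N%:Z * (pdeg (P j))%:Z + pair_exponent j * (pdeg (P i))%:Z)%Z.
Proof.
move=> Hcj dad Hy ji; rewrite /pair_exponent.
have eL : (l ^ a j)%N%:Z * (pdeg (P j))%:Z = (c j)%:Z * ((l ^ (a j + d j - d i))%N%:Z * (l ^ d i)%N%:Z).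
  by rewrite -!PoszM -expnD subnK // Hcj expnD; congr Posz; ring.
rewrite eL; case: ltnP => [lji|lij].
  have -> : (c j)%:Z * ((l ^ (a j + d j - d i))%N%:Z * (l ^ d i)%N%:Z) +
      - za * (c j)%:Z * (l ^ (a j + d j - d i))%N%:Z * (pdeg (P i))%:Z =
      (c j)%:Z * (l ^ (a j + d j - d i))%N%:Z * zb * M%:Z by rewrite -Hza; ring.
  exact: dvdz_mull.
have lt : (i < j)%N by rewrite ltn_neqAle eq_sym ji.
have /eqP := Hy lt; rewrite mod0z => /dvdz_mod0P dv.
have -> : (c j)%:Z * ((l ^ (a j + d j - d i))%N%:Z * (l ^ d i)%N%:Z) +
   y j * (l ^ (a j + d j - d i))%N%:Z * (pdeg (P i))%:Z =
   (l ^ (a j + d j - d i))%N%:Z * (l ^ d i)%N%:Z * (y j * (c i)%:Z + (c j)%:Z) by rewrite Hci PoszM; ring.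
exact: dvdz_mull.
Qed.

End GfData.

Theorem theorem3p2
  (F : finFieldType) (Om : closedFieldType) (iota : {rmorphism ratfun F -> Om})
  (* Om is an algebraic closure of k = F(T) *)
  (Halg : forall x : Om, exists p : {poly ratfun F}, p != 0 /\ root (map_poly iota p) x)
  (l n r : nat) (P : nat -> {poly F}) (alpha a b c d : nat -> nat)
  (Hl : prime l) (Hn : (1 <= n)%N) (Hlq : (l ^ n %| #|F|.-1)%N)
  (Hr : (1 <= r)%N)
  (HPmon : forall j, (j < r)%N -> P j \is monic)
  (HPirr : forall j, (j < r)%N -> irreducible_poly (P j))
  (HPdist : forall i j, (i < r)%N -> (j < r)%N -> P i = P j -> i = j)
  (Halpha : forall j, (j < r)%N -> (1 <= alpha j <= l ^ n - 1)%N)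
  (Hab : forall j, (j < r)%N -> alpha j = (b j * l ^ a j)%N /\ coprime (b j) l)
  (Hcd : forall j, (j < r)%N -> pdeg (P j) = (c j * l ^ d j)%N /\ coprime (c j) l)
  (Ha0 : a 0%N = 0%N)
  (Hamono : forall i j, (i <= j < r)%N -> (a i <= a j)%N)
  (Har : (a r.-1 <= n - 1)%N)
  (beta : Om)
  (Hbeta : beta ^+ (l ^ n) =
           iota (pfrac (pstar (\prod_(j < r) P j ^+ alpha j))))
  : let D := \prod_(j < r) P j ^+ alpha j in
    let E := kadjoin iota (fun _ => beta) 1 in
    let t := (n - minn n (logn l (pdeg D)))%N in
    let m := (\max_(j < r) (n - a j - minn (n - a j) (d j)))%N in
    (* case m = t : E_ge = E_gex = E_1 ... E_r *)
    (m = t ->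
      forall g : nat -> Om,
        (forall j, (j < r)%N ->
           g j ^+ (l ^ (n - a j)) = iota (pfrac (pstar (P j)))) ->
        is_genus_field iota E (kadjoin iota g r))
    /\
    (* case m > t : E_ge = F_1 ... F_r *)
    ((t < m)%N ->
      forall i0 : nat, (i0 < r)%N ->
        (n - a i0 - minn (n - a i0) (d i0))%N = m ->
        (forall j, (i0 < j < r)%N ->
           ((n%:Z - (a j)%:Z - (d j)%:Z) < m%:Z)%R) ->
      forall za zb : int,
        za * (pdeg (P i0))%:Z + zb * (l ^ n)%N%:Z = (l ^ d i0)%N%:Z ->
      forall y : nat -> int,
        (forall j, (i0 < j < r)%N ->
           (y j * (c i0)%:Z + (c j)%:Z == 0 %[mod (l ^ n)%N%:Z])%Z) ->
      forall g : nat -> Om,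
        (forall j, (j < r)%N ->
           g j ^+ (gf_data l n t i0 P a c d za y j).1 =
           iota (gf_data l n t i0 P a c d za y j).2) ->
        is_genus_field iota E (kadjoin iota g r)).
Proof.
move=> D E t m.
have an j : (j < r)%N -> (a j < n)%N.
  by move=> jr; have := Hamono j r.-1; move: Har Hn; lia.
have Ha j : (j < r)%N -> gcdn (alpha j) (l ^ n) = (l ^ a j)%N.
  move=> jr; have [e cop] := Hab j jr; have /andP[a0 _] := Halpha j jr.
  by rewrite gcdn_prime_power // e logn_coprime_mul // (minn_idPr _) // ltnW // an.
(* [logn] is 0 at 0, so the formula for the gcd asks for a positive degree; the factor P_0 provides
   it. *)
have D0 : (0 < pdeg D)%N.
  rewrite pdeg_D // (bigD1 (Ordinal Hr)) //= addn_gt0 muln_gt0.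
  have /andP[-> _] := Halpha _ Hr.
  by have [+ _] := HPirr _ Hr; rewrite /pdeg /=; case: (size _) => [|[]].
have Ht : gcdn (pdeg D) (l ^ n) = (l ^ (n - t))%N.
  by rewrite gcdn_prime_power // /t subKn // geq_minl.
have core g := kadjoin_genus_field (kimg_algebraic Halg) Hl Hlq HPmon HPirr HPdist Ha
  (fun j jr => ltnW (an j jr)) Ht Hbeta (g := g).
have lem j : (j < r)%N -> (n - a j - minn (n - a j) (d j) <= m)%N.
  by move=> jr; exact: (leq_bigmax (Ordinal jr)).
split=> [mt g Hg|tm i ir im ilast za zb Hza y Hy g Hg].
  have [//| |h1 h2] := @single_generators F Om iota l n r t P a g.
  - by move=> j jr; rewrite -[ev _ _]Hg // -exprM -expnD subnK // ltnW // an.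
  (* With m = t, the bound n - t <= a_j + d_j expresses that m is an upper bound of the local
     exponents. *)
  - move=> j jr; have [-> _] := Hcd j jr; rewrite mulnCA -expnD dvdn_mull // dvdn_exp2l //.
by rewrite -mt; apply: ramification_le; exact: lem.
  - exact: core.
have [ci copi] := Hcd _ ir.
have di : (d i + m + a i = n)%N.
  by apply: ramification_split im _; apply: leq_ltn_trans tm.
have nm : (n - m = a i + d i)%N by rewrite -di addnAC addnK addnC.
(* Maximality of m seen from the pivot: a_i + d_i = n - m is the least of the a_j + d_j. As a is
   monotone, d_i <= d_j follows for j < i. *)
have adj j : (j < r)%N -> (a i + d i <= a j + d j)%N.
  by move=> jr; rewrite -nm; apply: ramification_le; exact: lem.
have dadj j : (j < r)%N -> (d i <= a j + d j)%N.
  by move=> /adj; apply: leq_trans; rewrite leq_addl.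
have aj_le j : (j < i)%N -> (a j <= a i)%N by move=> ji; apply: Hamono; rewrite ltnW.
have dij j : (j < i)%N -> (d i <= d j)%N.
  by move=> ji; move: (adj j (ltn_trans ji ir)) (aj_le j ji); clear; lia.
have ait : (a i + (d i + t) <= n)%N by rewrite -di addnC leq_add2r leq_add2l ltnW.
pose f := pair_exponent l i a c d za y.
(* The pivot generator is a root of order l^(d_i + t), whence s = n - (d_i + t). The quotients by M
   are exact by [pair_exponent_degree]. *)
have := @pair_generators F Om iota l n r t P a g Hl HPmon i (n - (d i + t)) (c i) (d i) f
  (fun j => ((l ^ a j)%N%:Z * (pdeg (P j))%:Z + f j * (pdeg (P i))%:Z) %/ (l ^ n)%N%:Z)%Z ir ci copi.
case=> [| | |j jr ji|j jr ji|j jr ji|]; last exact: core.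
- by move: ait; clear; lia.
- by rewrite leq_subRL ?(leq_trans _ ait) ?leq_addl // addnC.
- by apply: (gf_data_pivot _ (Hg i ir)); apply: leq_trans ait; rewrite leq_addl.
- exact: (gf_data_pair ji (ltnW (an j jr)) (dij j) (dadj j jr) (Hg j jr)).
- by apply: dvdz_mull; apply: dvdn_exp2l; rewrite leq_subRL ?dadj // addnC adj.
- rewrite divzK //; apply: (pair_exponent_degree ci Hza (proj1 (Hcd j jr)) (dadj j jr) _ ji).
  by move=> ij; apply: Hy; rewrite ij.
Qed.
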